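(* Let $N\ge 1$ be an integer, let $z\ne 0$ be complex, let $\theta=\arg z$, and let $R_N(z)$ be the remainder function defined in the context. Then: (i) If $\frac{\pi}{4}<|\theta|\le\frac{\pi}{2}$, then \[ |R_N(z)|\le\frac{|B_{2N+2}|}{2N(2N+1)(2N+2)|z|^{2N}}\,\min\left(|\csc(2\theta)|,\sqrt{\frac{e}{4}\left(2N+\frac52\right)}\right), \] and if $|\theta|\le\frac{\pi}{4}$, then \[ |R_N(z)|\le\frac{|B_{2N+2}|}{2N(2N+1)(2N+2)|z|^{2N}} . \] (ii) If $|\theta|<\pi$, then \[ |R_N(z)|\le\frac{|B_{2N+2}|}{2N(2N+1)(2N+2)|z|^{2N}}\,\sec^{2N+1}\left(\frac{\theta}{2}\right). \] (iii) If $z>0$, then $R_N(z)$ has the same sign as $\frac{B_{2N+2}}{2N(2N+1)(2N+2)z^{2N}}$ (the first neglected term), and \[ |R_N(z)|<\frac{|B_{2N+2}|}{2N(2N+1)(2N+2)z^{2N}} . \]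
   Context: $B_n$ denotes the $n$th Bernoulli number. $\arg$ and $\log z$ denote principal values. For $|\theta|=\frac{\pi}{2}$, $|\csc(2\theta)|$ is read as $+\infty$, so the minimum in (i) is then the second quantity. The Barnes $G$-function is the entire function given by \[ G(z+1)=(2\pi)^{z/2}e^{-[z(z+1)+\gamma z^2]/2}\prod_{n=1}^\infty\left[\left(1+\frac{z}{n}\right)^n e^{-z+z^2/(2n)}\right], \] where $\gamma$ is the Euler–Mascheroni constant. For $|\arg z|<\pi$, $\log G(z+1)$ and $\log\Gamma(z+1)$ denote the analytic branches on $\mathbb{C}\setminus(-\infty,0]$ that are real for $z>0$. The Glaisher–Kinkelin constant $A$ is given by $\log A=\frac{1}{12}-\zeta'(-1)$, where $\zeta$ is the Riemann zeta function. For $|\arg z|<\pi$ and $N\ge 1$ the remainder $R_N(z)$ is defined by \[ \log G(z+1)=\frac14 z^2+z\log\Gamma(z+1)-\left(\frac12 z(z+1)+\frac1{12}\right)\log z-\log A+\sum_{n=1}^{N-1}\frac{B_{2n+2}}{2n(2n+1)(2n+2)z^{2n}}+R_N(z), \] where empty sums are zero. *)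

(* Defs.v *)
From Stdlib Require Import Reals Lra Lia Arith.
From Coquelicot Require Import Coquelicot.

Open Scope R_scope.

(** * Bernoulli numbers *)

(** [bernoulli_tab n k] is [B_k] for [k <= n]. The values are given by
    [B_0 = 1] and [sum_{k=0}^{n} C(n+1,k) B_k = 0] for [n >= 1]
    (so [B_1 = -1/2]); see [bernoulli_S]. *)
Fixpoint bernoulli_tab (n : nat) : nat -> R :=
  match n with
  | O => fun _ => 1
  | S m => fun k =>
      if (k <=? m)%nat then bernoulli_tab m k
      else - / INR (S n) *
           sum_f_R0 (fun j => Binomial.C (S n) j * bernoulli_tab m j) m
  end.

Definition bernoulli (n : nat) : R := bernoulli_tab n n.

Lemma bernoulli_tab_le (n k : nat) :
  (k <= n)%nat -> bernoulli_tab n k = bernoulli k.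
Proof.
  induction n as [|n IH]; intros H.
  - now replace k with O by lia.
  - destruct (Nat.eq_dec k (S n)) as [->|Hk]; [reflexivity|].
    simpl. destruct (Nat.leb_spec k n); [now apply IH | lia].
Qed.

Lemma bernoulli_0 : bernoulli 0 = 1.
Proof. reflexivity. Qed.

Lemma bernoulli_S (n : nat) :
  bernoulli (S n) =
  - / INR (S (S n)) *
  sum_f_R0 (fun j => Binomial.C (S (S n)) j * bernoulli j) n.
Proof.
  unfold bernoulli at 1. cbn [bernoulli_tab].
  destruct (Nat.leb_spec (S n) n); [lia|].
  f_equal. apply sum_eq. intros j Hj. now rewrite bernoulli_tab_le.
Qed.

(** * Complex exponential, principal argument and logarithm *)

Definition Cexp (z : C) : C := (exp (Re z) * cos (Im z), exp (Re z) * sin (Im z)).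

(** Principal argument, with values in [(-PI, PI]] for [z <> 0]; see [Carg_spec]. *)
Definition Carg (z : C) : R :=
  if Rle_dec 0 (Im z) then acos (Re z / Cmod z) else - acos (Re z / Cmod z).

Definition Clog (z : C) : C := (ln (Cmod z), Carg z).

Lemma Carg_spec (z : C) :
  z <> 0 ->
  - PI < Carg z <= PI /\ z = (Cmod z * cos (Carg z), Cmod z * sin (Carg z)).
Proof.
  intros Hz. assert (Hm : 0 < Cmod z) by now apply Cmod_gt_0.
  pose proof (Cmod2_alt z) as H2.
  assert (Hb : -1 <= Re z / Cmod z <= 1).
  { pose proof (re_le_Cmod z) as H. apply Rabs_le_between in H.
    split; [apply Rle_div_r | apply Rle_div_l]; lra. }
  pose proof (acos_bound (Re z / Cmod z)) as Ha. pose proof PI_RGT_0 as Hpi.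
  assert (Hs : sqrt (1 - (Re z / Cmod z)²) = Rabs (Im z) / Cmod z).
  { apply sqrt_lem_1.
    - revert Hb. generalize (Re z / Cmod z). unfold Rsqr. intros u Hu. nra.
    - apply Rmult_le_pos; [apply Rabs_pos | left; now apply Rinv_0_lt_compat].
    - replace (Rabs (Im z) / Cmod z * (Rabs (Im z) / Cmod z))
        with (Rsqr (Rabs (Im z)) / (Cmod z)^2) by (unfold Rsqr; field; lra).
      rewrite <- Rsqr_abs. unfold Rsqr.
      replace (Im z * Im z) with ((Cmod z)^2 - (Re z)^2) by (rewrite H2; ring).
      field. lra. }
  unfold Carg. destruct (Rle_dec 0 (Im z)) as [Hi|Hi].
  - split; [lra|].
    rewrite cos_acos, sin_acos, Hs by assumption.
    rewrite Rabs_right by lra.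
    rewrite (surjective_pairing z) at 1. f_equal; unfold Re, Im; field; lra.
  - split.
    + split; [|lra].
      enough (acos (Re z / Cmod z) <> PI) by lra. intros E.
      assert (E' : Re z / Cmod z = -1) by (rewrite <- cos_PI, <- E, cos_acos; lra).
      assert (Re z = - Cmod z).
      { replace (Re z) with (Re z / Cmod z * Cmod z) by (field; lra).
        rewrite E'. ring. }
      rewrite H in H2. nra.
    + rewrite cos_neg, sin_neg, cos_acos, sin_acos, Hs by assumption.
      rewrite Rabs_left by lra.
      rewrite (surjective_pairing z) at 1. f_equal; unfold Re, Im; field; lra.
Qed.

(** * Limits and infinite products of complex sequences *)

(** Total operator, meaningful for convergent sequences; see [CLim_seq_unique]. *)
Definition CLim_seq (u : nat -> C) : C :=
  (real (Lim_seq (fun n => Re (u n))), real (Lim_seq (fun n => Im (u n)))).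

Lemma CLim_seq_unique (u : nat -> C) (l : C) :
  filterlim u eventually (locally l) -> CLim_seq u = l.
Proof.
  intros H.
  assert (H1 : is_lim_seq (fun n => Re (u n)) (Re l)).
  { intros P [e He]. apply (H (fun w => P (Re w))). exists e.
    intros w [Hw _]. now apply He. }
  assert (H2 : is_lim_seq (fun n => Im (u n)) (Im l)).
  { intros P [e He]. apply (H (fun w => P (Im w))). exists e.
    intros w [_ Hw]. now apply He. }
  unfold CLim_seq.
  now rewrite (is_lim_seq_unique _ _ H1), (is_lim_seq_unique _ _ H2),
    (surjective_pairing l).
Qed.

(** [Cprod f n] is the product of [f 1], ..., [f n]. *)
Fixpoint Cprod (f : nat -> C) (n : nat) : C :=
  match n with
  | O => RtoC 1
  | S m => (Cprod f m * f n)%C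
  end.

Definition Cprod_inf (f : nat -> C) : C := CLim_seq (Cprod f).

(** * Special functions *)

Definition euler_gamma : R :=
  real (Lim_seq (fun n => sum_n_m (fun k => / INR k) 1 n - ln (INR n))).

(** Weierstrass's product for the Gamma function. At the poles
    [0, -1, -2, ...] this takes the junk value [/ 0 = 0]. *)
Definition CGamma (z : C) : C :=
  (/ (z * Cexp (euler_gamma * z) *
      Cprod_inf (fun n => (1 + z / INR n) * Cexp (- (z / INR n)))))%C.

(** The defining product, with [z + 1] as the argument of [G]. *)
Definition barnesG1 (z : C) : C :=
  (Cexp (z / 2 * ln (2 * PI)) *
   Cexp (- ((z * (z + 1) + euler_gamma * z ^ 2) / 2)) *
   Cprod_inf (fun n =>
     (1 + z / INR n) ^ n * Cexp (- z + z ^ 2 / (2 * INR n))))%C.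

Definition barnesG (w : C) : C := barnesG1 (w - 1)%C.

(** [D] is meant to be open. *)
Definition analytic_on (D : C -> Prop) (f : C -> C) : Prop :=
  forall z0 : C, D z0 ->
  exists (a : nat -> C) (r : R), 0 < r /\
    forall z : C, Cmod (z - z0) < r ->
      @is_pseries C_AbsRing C_NormedModule a (z - z0)%C (f z).

(** The complement of the half-line [(-oo, 0]]. *)
Definition slit_plane (z : C) : Prop := 0 < Re z \/ Im z <> 0.

(** [L] is, on the slit plane, the analytic branch of [log F] that is real on
    the positive half-line. For [F] positive there, this determines [L] on the
    slit plane. *)
Definition is_log_branch (F L : C -> C) : Prop :=
  analytic_on slit_plane L /\
  (forall z : C, slit_plane z -> Cexp (L z) = F z) /\
  (forall x : R, 0 < x -> Im (L (RtoC x)) = 0).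

(** The analytic continuation to [C \ {1}] of [sum_{n >= 1} n^(-s)], [Re s > 1];
    this determines [zeta s] for every [s <> 1]. *)
Definition is_riemann_zeta (zeta : C -> C) : Prop :=
  analytic_on (fun s => s <> RtoC 1) zeta /\
  forall s : C, 1 < Re s ->
    @is_series C_AbsRing C_NormedModule
      (fun n => Cexp (- s * ln (INR (S n)))%C) (zeta s).

(** [log A], for [A] the Glaisher-Kinkelin constant. *)
Definition log_glaisher (zeta : C -> C) : C :=
  (1 / 12 - C_derive zeta (- (1)))%C.

(** * The asymptotic expansion and its remainder *)

Definition barnes_coef (n : nat) : R :=
  bernoulli (2 * n + 2) / (INR (2 * n) * INR (2 * n + 1) * INR (2 * n + 2)).

(** [logG1 z] and [logGamma1 z] stand for [log G(z+1)] and [log Gamma(z+1)]. *)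
Definition barnes_remainder (zeta logG1 logGamma1 : C -> C) (N : nat) (z : C) : C :=
  (logG1 z -
   (1 / 4 * z ^ 2 + z * logGamma1 z
    - (1 / 2 * (z * (z + 1)) + 1 / 12) * Clog z
    - log_glaisher zeta
    + @sum_n_m C_AbelianMonoid
        (fun n => barnes_coef n / z ^ (2 * n)) 1 (N - 1)))%C.

(** [min (|csc (2 theta)|, K)], where [|csc (2 theta)|] is [+oo] for
    [|theta| = PI / 2]. *)
Definition min_csc (theta K : R) : R :=
  if Req_EM_T (Rabs theta) (PI / 2) then K
  else Rmin (Rabs (/ sin (2 * theta))) K.

(* Main.v *)
Require Import Defs.
From Stdlib Require Import Reals Lra Lia Psatz Factorial.
From Coquelicot Require Import Coquelicot.
Open Scope R_scope.

(** The remainder has a Laplace representation along any ray on which both the kernel and the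
    exponential are under control; the different bounds are different choices of the ray.

    Let [d(w)] be the error of the corrected trapezoidal rule for [w log w] on the segment from
    [w] to [w + 1] ([em_delta]). The remainder after no term of the asymptotic series is [R_1(z)
    = - (d(z) + d(z + 1) + d(z + 2) + ...)] ([em_sum_limit]). Indeed each of the two given
    branches is the limit of the sums of principal logarithms of the factors of its product: on
    a segment from [1] inside the slit plane the difference is continuous, takes its values
    among the multiples of [2 i PI], and vanishes at [1] ([log_branch_limit]). In [log G(z+1) -
    z log Gamma(z+1)] these sums combine into sums of [(z + k) log (z + k)]
    ([partial_difference]), and what remains is matched by the definition of Euler's constant,
    by Stirling's formula ([stirling]) and by the constant [log A = 1/12 - zeta'(-1)]. For the
    latter, Euler-Maclaurin summation of the Dirichlet series of zeta gives an expression
    analytic on [Re s > - 3/2] apart from the pole at [1]; it agrees with zeta for [Re s > 1],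
    hence along the half-circle from [3] to [-1] around the pole ([identity_along_arc]), and its
    derivative at [-1] is a sum of errors [d(k)] ([glaisher_em]).

    By the Euler-Maclaurin formula [d(w)] is the integral over [[0, 1]] of [B3(u) / (6 (w +
    u)^2)], and writing [/ (w + u)^2] as a Laplace integral along a ray turns it into a Laplace
    integral with kernel [t / 6] times the transform of [B3] ([lap_ker_limit]). The partial
    fractions of the hyperbolic cotangent, here obtained from Fejer's theorem
    ([coth_partial_fractions]), show that this kernel is [(1 - exp (- t)) 2 t] times the sum of
    [/ (a^2 (t^2 + a^2))] over [a = 2 PI n], [n >= 1] ([B3_laplace_frac_tail]). Summing over the
    translates of [z] removes the factor [1 - exp (- t)]. Expanding [/ (t^2 + a^2)] in powers of
    [t^2 / a^2] reproduces the terms of the asymptotic series, because [B_(2k)] is up to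
    elementary factors the sum of the [a^(- 2k)] ([bernoulli_freq_zeta]), and leaves for
    [R_N(z)] the Laplace integral of [2 (-1)^N t^(2N-1)] times the sum of [a^(- 2N) / (t^2 +
    a^2)]. Integrate along the ray of argument [- phi]. If [q a^2 <= |t^2 + a^2|] on it for all
    [a], comparison with the same integral without the [t^2] in the denominator shows that
    [|R_N(z)|] is at most the first omitted term divided by [q cos^(2N) (theta - phi)]
    ([em_limit_bound], [ray_bound]).

    It remains to choose [phi]. For [|theta| <= PI/4] take [phi = theta] and [q = 1]; for [PI/4
    < |theta| < PI/2] take [phi = theta] and [q = |sin (2 theta)|]. For (ii) take [phi = theta /
    2] and [q = cos (theta / 2)]. The other bound in (i) comes from stopping at the angle [PI/2
    - d] with [tan^2 d = / (2N + 1)] ([optimal_angle], [remainder_bound_uniform]). For (iii), on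
    the positive axis the integrand has the sign [(-1)^N] throughout ([em_limit_sign]). So [R_N]
    and [R_(N+1)] have opposite signs, and as they differ by the first omitted term, [R_N] has
    the sign of that term and is strictly smaller in modulus. *)

(** * Complex moduli *)

Lemma C_eq (x y : C) : Re x = Re y -> Im x = Im y -> x = y.
Proof. destruct x, y; simpl; intros; now subst. Qed.

Lemma re_minus (a b : C) : Re (a - b) = Re a - Re b.
Proof. destruct a, b; reflexivity. Qed.

Lemma im_minus (a b : C) : Im (a - b) = Im a - Im b.
Proof. destruct a, b; reflexivity. Qed.

Lemma im_le_Cmod (c : C) : Rabs (Im c) <= Cmod c.
Proof. eapply Rle_trans; [apply Rmax_r | apply Rmax_Cmod]. Qed.

Lemma Cmod_le_Re_Im (c : C) : Cmod c <= Rabs (Re c) + Rabs (Im c).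
Proof.
  apply Rsqr_incr_0_var; [|pose proof (Rabs_pos (Re c)); pose proof (Rabs_pos (Im c)); lra].
  unfold Rsqr. pose proof (Cmod2_alt c) as H.
  pose proof (Rabs_pos (Re c)); pose proof (Rabs_pos (Im c)).
  pose proof (pow2_abs (Re c)); pose proof (pow2_abs (Im c)). nra.
Qed.

Lemma Cmod_minus_sym (x y : C) : Cmod (x - y) = Cmod (y - x).
Proof. rewrite <- Cmod_opp. f_equal. ring. Qed.

Lemma Cmod_triangle' (x y : C) : Cmod (x - y) <= Cmod x + Cmod y.
Proof. unfold Cminus. rewrite <- (Cmod_opp y). apply Cmod_triangle. Qed.

Lemma Cmod_triangle_rev (x y : C) : Cmod x - Cmod y <= Cmod (x - y).
Proof.
  pose proof (Cmod_triangle (x - y) y) as H. replace (x - y + y)%C with x in H by ring. lra.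
Qed.

Lemma Cmod_Rpos (x : R) : 0 <= x -> Cmod x = x.
Proof. intros H. now rewrite Cmod_R, Rabs_pos_eq. Qed.

(** * Complex-valued functions of a real variable *)

(** Componentwise, so that the real theory of derivatives, continuity and integrals applies
    directly. *)
Definition Cderiv (f : R -> C) (t : R) (l : C) : Prop :=
  is_derive (fun x => Re (f x)) t (Re l) /\ is_derive (fun x => Im (f x)) t (Im l).

Definition Ccont (f : R -> C) (t : R) : Prop :=
  continuous (fun x => Re (f x)) t /\ continuous (fun x => Im (f x)) t.

Definition CInt (f : R -> C) (a b : R) : C :=
  (RInt (fun t => Re (f t)) a b, RInt (fun t => Im (f t)) a b).

Lemma Cderiv_val f t l l' : Cderiv f t l -> l = l' -> Cderiv f t l'.
Proof. now intros H <-. Qed.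

Lemma Cderiv_ext f g t l : (forall x, f x = g x) -> Cderiv f t l -> Cderiv g t l.
Proof.
  intros E [H1 H2]; split; (eapply is_derive_ext; [|eassumption]); intros; simpl; now rewrite E.
Qed.

Lemma Cderiv_const c t : Cderiv (fun _ => c) t 0.
Proof. split; simpl; apply (@is_derive_const R_AbsRing R_NormedModule). Qed.

Lemma Cderiv_RtoC (f : R -> R) t l : is_derive f t l -> Cderiv (fun x => RtoC (f x)) t l.
Proof. intros H. split; simpl; [exact H | apply (@is_derive_const R_AbsRing R_NormedModule)]. Qed.

Lemma Cderiv_id t : Cderiv (fun x => RtoC x) t 1.
Proof. apply (Cderiv_RtoC (fun x => x)). apply (@is_derive_id R_AbsRing). Qed.

Lemma Cderiv_plus f g t l k :
  Cderiv f t l -> Cderiv g t k -> Cderiv (fun x => f x + g x)%C t (l + k)%C.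
Proof.
  intros [A B] [A' B']; split; simpl;
    apply (@is_derive_plus R_AbsRing R_NormedModule); assumption.
Qed.

Lemma Cderiv_opp f t l : Cderiv f t l -> Cderiv (fun x => - f x)%C t (- l)%C.
Proof.
  intros [A B]; split; simpl; apply (@is_derive_opp R_AbsRing R_NormedModule); assumption.
Qed.

Lemma Cderiv_minus f g t l k :
  Cderiv f t l -> Cderiv g t k -> Cderiv (fun x => f x - g x)%C t (l - k)%C.
Proof. intros. apply Cderiv_plus; [|apply Cderiv_opp]; assumption. Qed.

Lemma is_derive_Rmult (f g : R -> R) t l k :
  is_derive f t l -> is_derive g t k ->
  is_derive (fun x => f x * g x) t (l * g t + f t * k).
Proof. intros A B. apply (is_derive_mult f g t l k A B). intros; apply Rmult_comm. Qed.

Lemma Cderiv_mult f g t l k :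
  Cderiv f t l -> Cderiv g t k ->
  Cderiv (fun x => f x * g x)%C t (l * g t + f t * k)%C.
Proof.
  intros [A B] [A' B']; split.
  - eapply is_derive_ext; [intros; symmetry; apply re_mult|].
    rewrite re_plus, !re_mult.
    replace (_ + _) with ((Re l * Re (g t) + Re (f t) * Re k) - (Im l * Im (g t) + Im (f t) * Im k))
      by ring.
    apply (@is_derive_minus R_AbsRing R_NormedModule); apply is_derive_Rmult; assumption.
  - eapply is_derive_ext; [intros; symmetry; apply im_mult|].
    rewrite im_plus, !im_mult.
    replace (_ + _) with ((Re l * Im (g t) + Re (f t) * Im k) + (Im l * Re (g t) + Im (f t) * Re k))
      by ring.
    apply (@is_derive_plus R_AbsRing R_NormedModule); apply is_derive_Rmult; assumption.
Qed.

Lemma Cderiv_scal c f t l : Cderiv f t l -> Cderiv (fun x => c * f x)%C t (c * l)%C.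
Proof.
  intros H. eapply Cderiv_val; [apply Cderiv_mult; [apply Cderiv_const | exact H]|]. cbv beta. ring.
Qed.

Lemma is_derive_eq (f : R -> R) t l l' : is_derive f t l -> l = l' -> is_derive f t l'.
Proof. now intros H <-. Qed.

Lemma Cderiv_exp f t l : Cderiv f t l -> Cderiv (fun x => Cexp (f x)) t (l * Cexp (f t))%C.
Proof.
  intros [A B].
  assert (E : is_derive (fun x => exp (Re (f x))) t (Re l * exp (Re (f t)))).
  { apply (is_derive_comp exp (fun x => Re (f x))); [apply is_derive_exp | exact A]. }
  assert (Co : is_derive (fun x => cos (Im (f x))) t (Im l * - sin (Im (f t)))).
  { apply (is_derive_comp cos (fun x => Im (f x))); [apply is_derive_cos | exact B]. }
  assert (Si : is_derive (fun x => sin (Im (f x))) t (Im l * cos (Im (f t)))).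
  { apply (is_derive_comp sin (fun x => Im (f x))); [apply is_derive_sin | exact B]. }
  split; unfold Cexp.
  - rewrite re_mult. cbn [Re Im fst snd].
    replace (_ - _) with (Re l * exp (Re (f t)) * cos (Im (f t))
      + exp (Re (f t)) * (Im l * - sin (Im (f t)))) by ring.
    now apply (is_derive_Rmult (fun x => exp (Re (f x))) (fun x => cos (Im (f x)))).
  - rewrite im_mult. cbn [Re Im fst snd].
    replace (_ + _) with (Re l * exp (Re (f t)) * sin (Im (f t))
      + exp (Re (f t)) * (Im l * cos (Im (f t)))) by ring.
    now apply (is_derive_Rmult (fun x => exp (Re (f x))) (fun x => sin (Im (f x)))).
Qed.

Lemma Cmod_neq_0_sq (z : C) : z <> 0 -> Re z * Re z + Im z * Im z <> 0.
Proof.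
  intros H. apply Cmod_gt_0 in H. pose proof (Cmod2_alt z). nra.
Qed.

Lemma Cderiv_inv (f : R -> C) t (l : C) :
  f t <> 0 -> Cderiv f t l -> Cderiv (fun x => / f x)%C t (- l / (f t * f t))%C.
Proof.
  intros Hf [A B]. pose proof (Cmod_neq_0_sq _ Hf) as Hn.
  assert (E : (- l / (f t * f t) = - l * (/ f t * / f t))%C) by (field; exact Hf).
  assert (D : is_derive (fun x => Re (f x) * Re (f x) + Im (f x) * Im (f x)) t
    ((Re l * Re (f t) + Re (f t) * Re l) + (Im l * Im (f t) + Im (f t) * Im l))).
  { apply (@is_derive_plus R_AbsRing R_NormedModule); now apply is_derive_Rmult. }
  rewrite E. split.
  - rewrite re_mult, re_mult, im_mult.
    eapply is_derive_ext with (f := fun x => Re (f x) / (Re (f x) * Re (f x) + Im (f x) * Im (f x))).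
    { intros x. unfold Cinv, Re, Im; simpl. f_equal. ring. }
    eapply is_derive_eq; [apply is_derive_div; [exact A | exact D | exact Hn]|].
    cbv beta. destruct (f t) as [a b], l as [c d]. unfold Cinv, Re, Im in *; simpl in *. field. lra.
  - rewrite im_mult, re_mult, im_mult.
    eapply is_derive_ext with (f := fun x => - Im (f x) / (Re (f x) * Re (f x) + Im (f x) * Im (f x))).
    { intros x. unfold Cinv, Re, Im; simpl. f_equal. ring. }
    eapply is_derive_eq; [apply is_derive_div;
      [apply (@is_derive_opp R_AbsRing R_NormedModule); exact B | exact D | exact Hn]|].
    cbv beta. destruct (f t) as [a b], l as [c d]. unfold Cinv, Re, Im, opp in *; simpl in *. field. lra.
Qed.

Lemma Cderiv_Ccont f t l : Cderiv f t l -> Ccont f t.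
Proof.
  intros [A B]; split; apply (@ex_derive_continuous R_AbsRing R_NormedModule); eexists; eassumption.
Qed.

Lemma Ccont_const c t : Ccont (fun _ => c) t.
Proof. split; apply continuous_const. Qed.

Lemma Ccont_RtoC (f : R -> R) t : continuous f t -> Ccont (fun x => RtoC (f x)) t.
Proof. intros H; split; simpl; [exact H | apply continuous_const]. Qed.

Lemma Ccont_plus f g t : Ccont f t -> Ccont g t -> Ccont (fun x => f x + g x)%C t.
Proof.
  intros [A B] [A' B']; split; simpl;
    apply (@continuous_plus R_UniformSpace R_AbsRing R_NormedModule); assumption.
Qed.

Lemma Ccont_opp f t : Ccont f t -> Ccont (fun x => - f x)%C t.
Proof.
  intros [A B]; split; simpl;
    apply (@continuous_opp R_UniformSpace R_AbsRing R_NormedModule); assumption.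
Qed.

Lemma Ccont_minus f g t : Ccont f t -> Ccont g t -> Ccont (fun x => f x - g x)%C t.
Proof. intros; apply Ccont_plus; [|apply Ccont_opp]; assumption. Qed.

Lemma continuous_Rmult (f g : R -> R) t :
  continuous f t -> continuous g t -> continuous (fun x => f x * g x) t.
Proof. intros. now apply (@continuous_mult R_UniformSpace R_AbsRing). Qed.

Lemma Ccont_mult f g t : Ccont f t -> Ccont g t -> Ccont (fun x => f x * g x)%C t.
Proof.
  intros [A B] [A' B']; split.
  - eapply continuous_ext; [intros; symmetry; apply re_mult|].
    apply (@continuous_minus R_UniformSpace R_AbsRing R_NormedModule); now apply continuous_Rmult.
  - eapply continuous_ext; [intros; symmetry; apply im_mult|].
    apply (@continuous_plus R_UniformSpace R_AbsRing R_NormedModule); now apply continuous_Rmult.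
Qed.

Lemma Ccont_ext f g t : (forall x, f x = g x) -> Ccont f t -> Ccont g t.
Proof.
  intros E [A B]; split; [eapply continuous_ext; [|exact A] | eapply continuous_ext; [|exact B]];
    intros; simpl; now rewrite E.
Qed.

Definition Cexint (f : R -> C) (a b : R) : Prop :=
  ex_RInt (fun t => Re (f t)) a b /\ ex_RInt (fun t => Im (f t)) a b.

Lemma Cexint_cont f a b :
  (forall t, Rmin a b <= t <= Rmax a b -> Ccont f t) -> Cexint f a b.
Proof.
  intros H; split; apply (@ex_RInt_continuous R_CompleteNormedModule); intros t Ht; now apply H.
Qed.

Lemma CInt_FTC (F f : R -> C) a b :
  a <= b ->
  (forall t, a <= t <= b -> Cderiv F t (f t)) -> (forall t, a <= t <= b -> Ccont f t) ->
  CInt f a b = (F b - F a)%C.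
Proof.
  intros Hab H1 H2. apply C_eq; unfold CInt; simpl.
  - apply is_RInt_unique.
    apply (is_RInt_derive (fun t => Re (F t)) (fun t => Re (f t)));
      rewrite Rmin_left, Rmax_right by assumption; intros t Ht; [apply H1 | apply H2]; assumption.
  - apply is_RInt_unique.
    apply (is_RInt_derive (fun t => Im (F t)) (fun t => Im (f t)));
      rewrite Rmin_left, Rmax_right by assumption; intros t Ht; [apply H1 | apply H2]; assumption.
Qed.

Lemma CInt_ext f g a b :
  a <= b -> (forall t, a < t < b -> f t = g t) -> CInt f a b = CInt g a b.
Proof.
  intros Hab H. unfold CInt. f_equal; apply RInt_ext;
    rewrite Rmin_left, Rmax_right by assumption; intros t Ht; simpl; now rewrite H.
Qed.

Lemma CInt_plus f g a b : Cexint f a b -> Cexint g a b ->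
  CInt (fun t => f t + g t)%C a b = (CInt f a b + CInt g a b)%C.
Proof.
  intros [A B] [A' B']. apply C_eq; unfold CInt; simpl;
    apply (@RInt_plus R_CompleteNormedModule); assumption.
Qed.

Lemma CInt_opp f a b : Cexint f a b -> CInt (fun t => - f t)%C a b = (- CInt f a b)%C.
Proof.
  intros [A B]. apply C_eq; unfold CInt; simpl;
    apply (@RInt_opp R_CompleteNormedModule); assumption.
Qed.

Lemma Cexint_plus f g a b : Cexint f a b -> Cexint g a b -> Cexint (fun t => f t + g t)%C a b.
Proof.
  intros [A B] [A' B']. split; simpl; apply (@ex_RInt_plus R_NormedModule); assumption.
Qed.

Lemma Cexint_opp f a b : Cexint f a b -> Cexint (fun t => - f t)%C a b.
Proof. intros [A B]. split; simpl; apply (@ex_RInt_opp R_NormedModule); assumption. Qed.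

Lemma Cexint_minus f g a b : Cexint f a b -> Cexint g a b -> Cexint (fun t => f t - g t)%C a b.
Proof. intros. apply Cexint_plus; auto using Cexint_opp. Qed.

Lemma CInt_minus f g a b : Cexint f a b -> Cexint g a b ->
  CInt (fun t => f t - g t)%C a b = (CInt f a b - CInt g a b)%C.
Proof.
  intros A B. unfold Cminus. rewrite CInt_plus, CInt_opp; auto using Cexint_opp.
Qed.

Lemma ex_RInt_scalR (k : R) f a b : ex_RInt f a b -> ex_RInt (fun t => k * f t) a b.
Proof. apply (@ex_RInt_scal R_NormedModule f). Qed.

Lemma ex_RInt_plusR (f g : R -> R) a b :
  ex_RInt f a b -> ex_RInt g a b -> ex_RInt (fun t => f t + g t) a b.
Proof. apply (@ex_RInt_plus R_NormedModule f g). Qed.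

Lemma ex_RInt_minusR (f g : R -> R) a b :
  ex_RInt f a b -> ex_RInt g a b -> ex_RInt (fun t => f t - g t) a b.
Proof. apply (@ex_RInt_minus R_NormedModule f g). Qed.

Lemma RInt_scalR (k : R) f a b : ex_RInt f a b -> RInt (fun t => k * f t) a b = k * RInt f a b.
Proof. apply (@RInt_scal R_CompleteNormedModule f). Qed.

Lemma RInt_plusR (f g : R -> R) a b :
  ex_RInt f a b -> ex_RInt g a b -> RInt (fun t => f t + g t) a b = RInt f a b + RInt g a b.
Proof. apply (@RInt_plus R_CompleteNormedModule f g). Qed.

Lemma RInt_minusR (f g : R -> R) a b :
  ex_RInt f a b -> ex_RInt g a b -> RInt (fun t => f t - g t) a b = RInt f a b - RInt g a b.
Proof. apply (@RInt_minus R_CompleteNormedModule f g). Qed.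

Lemma Cexint_scal c f a b : Cexint f a b -> Cexint (fun t => c * f t)%C a b.
Proof.
  intros [A B]. split.
  - eapply ex_RInt_ext; [intros; symmetry; apply re_mult|].
    apply ex_RInt_minusR; now apply ex_RInt_scalR.
  - eapply ex_RInt_ext; [intros; symmetry; apply im_mult|].
    apply ex_RInt_plusR; now apply ex_RInt_scalR.
Qed.

Lemma CInt_scal c f a b : Cexint f a b -> CInt (fun t => c * f t)%C a b = (c * CInt f a b)%C.
Proof.
  intros [A B].
  assert (E1 : RInt (fun t => Re (c * f t)) a b =
    Re c * RInt (fun t => Re (f t)) a b - Im c * RInt (fun t => Im (f t)) a b).
  { rewrite <- !RInt_scalR, <- RInt_minusR by auto using ex_RInt_scalR.
    apply RInt_ext. intros; apply re_mult. }
  assert (E2 : RInt (fun t => Im (c * f t)) a b =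
    Re c * RInt (fun t => Im (f t)) a b + Im c * RInt (fun t => Re (f t)) a b).
  { rewrite <- !RInt_scalR, <- RInt_plusR by auto using ex_RInt_scalR.
    apply RInt_ext. intros; apply im_mult. }
  apply C_eq; [rewrite re_mult | rewrite im_mult]; assumption.
Qed.

Lemma CInt_Chasles f a b c : Cexint f a b -> Cexint f b c ->
  (CInt f a b + CInt f b c)%C = CInt f a c.
Proof.
  intros [A B] [A' B']. apply C_eq; unfold CInt; simpl;
    apply (@RInt_Chasles R_CompleteNormedModule); assumption.
Qed.

Lemma CInt_RtoC (f : R -> R) a b : CInt (fun t => RtoC (f t)) a b = RtoC (RInt f a b).
Proof.
  apply C_eq; unfold CInt; simpl; [reflexivity|].
  rewrite (@RInt_const R_CompleteNormedModule). apply Rmult_0_r.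
Qed.

(** The component of the integral [I] along its own direction is [|I|], and it is the integral
    of a component of [f], which is at most [|f|]. *)
Lemma CInt_norm_le f g a b :
  a <= b -> Cexint f a b -> ex_RInt g a b ->
  (forall t, a < t < b -> Cmod (f t) <= g t) -> Cmod (CInt f a b) <= RInt g a b.
Proof.
  intros Hab [A B] Hg H. set (I := CInt f a b).
  destruct (Req_dec (Cmod I) 0) as [E|E].
  - rewrite E. apply RInt_ge_0; auto. intros t Ht.
    eapply Rle_trans; [apply Cmod_ge_0 | now apply H].
  - pose proof (Cmod_ge_0 I) as HI.
    apply Rmult_le_reg_l with (Cmod I); [lra|].
    replace (Cmod I * Cmod I) with (Cmod I ^ 2) by ring. rewrite Cmod2_alt.
    replace (Re I ^ 2 + Im I ^ 2) with
      (RInt (fun t => Re I * Re (f t) + Im I * Im (f t)) a b).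
    2:{ rewrite RInt_plusR, !RInt_scalR by auto using ex_RInt_scalR.
        change (RInt (fun t => Re (f t)) a b) with (Re I).
        change (RInt (fun t => Im (f t)) a b) with (Im I). simpl; ring. }
    rewrite <- RInt_scalR by assumption.
    apply RInt_le; auto.
    + apply ex_RInt_plusR; now apply ex_RInt_scalR.
    + now apply ex_RInt_scalR.
    + intros t Ht. specialize (H t Ht).
      apply Rle_trans with (Cmod I * Cmod (f t)); [|apply Rmult_le_compat_l; lra].
      apply Rsqr_incr_0_var; [|apply Rmult_le_pos; auto using Cmod_ge_0].
      unfold Rsqr. pose proof (Cmod2_alt I). pose proof (Cmod2_alt (f t)).
      replace (Cmod I * Cmod (f t) * (Cmod I * Cmod (f t)))
        with ((Cmod I ^ 2) * (Cmod (f t) ^ 2)) by ring.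
      rewrite H0, H1. generalize (Re I) (Im I) (Re (f t)) (Im (f t)). intros x y u v.
      pose proof (pow2_ge_0 (x * v - y * u)). nra.
Qed.

Lemma CInt_norm_le_const f M a b :
  a <= b -> Cexint f a b ->
  (forall t, a < t < b -> Cmod (f t) <= M) -> Cmod (CInt f a b) <= (b - a) * M.
Proof.
  intros Hab Hf H. replace ((b - a) * M) with (RInt (fun _ => M) a b)
    by apply (@RInt_const R_CompleteNormedModule).
  apply CInt_norm_le; auto. apply ex_RInt_const.
Qed.

(** The integral of the derivative takes the place of an intermediate point, which need not
    exist for a curve. *)
Lemma Cderiv_MVT (F f : R -> C) M a b :
  a <= b -> (forall t, a <= t <= b -> Cderiv F t (f t)) ->
  (forall t, a <= t <= b -> Ccont f t) ->
  (forall t, a < t < b -> Cmod (f t) <= M) -> Cmod (F b - F a) <= (b - a) * M.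
Proof.
  intros Hab H1 H2 H3. rewrite <- (CInt_FTC F f) by assumption.
  apply CInt_norm_le_const; auto. apply Cexint_cont.
  rewrite Rmin_left, Rmax_right by assumption. exact H2.
Qed.

(** * Limits of complex sequences *)

Definition Clim (u : nat -> C) (l : C) : Prop :=
  is_lim_seq (fun n => Re (u n)) (Re l) /\ is_lim_seq (fun n => Im (u n)) (Im l).

Lemma Clim_ext u v l : (forall n, u n = v n) -> Clim u l -> Clim v l.
Proof.
  intros E [A B]; split; (eapply is_lim_seq_ext; [|eassumption]); intros; simpl; now rewrite E.
Qed.

Lemma Clim_ext_loc u v l : (exists N, forall n, (N <= n)%nat -> u n = v n) -> Clim u l -> Clim v l.
Proof.
  intros [N E] [A B]; split; (eapply is_lim_seq_ext_loc; [|eassumption]);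
    exists N; intros; simpl; now rewrite E.
Qed.

Lemma Clim_const c : Clim (fun _ => c) c.
Proof. split; apply is_lim_seq_const. Qed.

Lemma Clim_plus u v l k : Clim u l -> Clim v k -> Clim (fun n => u n + v n)%C (l + k)%C.
Proof. intros [A B] [A' B']; split; simpl; apply is_lim_seq_plus'; assumption. Qed.

Lemma Clim_opp u l : Clim u l -> Clim (fun n => - u n)%C (- l)%C.
Proof.
  intros [A B]; split.
  - now apply -> (is_lim_seq_opp (fun n => Re (u n)) (Re l)).
  - now apply -> (is_lim_seq_opp (fun n => Im (u n)) (Im l)).
Qed.

Lemma Clim_minus u v l k : Clim u l -> Clim v k -> Clim (fun n => u n - v n)%C (l - k)%C.
Proof. intros. apply Clim_plus; [|apply Clim_opp]; assumption. Qed.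

Lemma Clim_mult u v l k : Clim u l -> Clim v k -> Clim (fun n => u n * v n)%C (l * k)%C.
Proof.
  intros [A B] [A' B']; split.
  - rewrite re_mult. eapply is_lim_seq_ext; [intros; symmetry; apply re_mult|].
    apply is_lim_seq_minus'; apply is_lim_seq_mult'; assumption.
  - rewrite im_mult. eapply is_lim_seq_ext; [intros; symmetry; apply im_mult|].
    apply is_lim_seq_plus'; apply is_lim_seq_mult'; assumption.
Qed.

Lemma Clim_scal c u l : Clim u l -> Clim (fun n => c * u n)%C (c * l)%C.
Proof. intros. apply Clim_mult; auto using Clim_const. Qed.

Lemma Clim_unique u l k : Clim u l -> Clim u k -> l = k.
Proof.
  intros [A B] [A' B']. apply C_eq.
  - apply is_lim_seq_unique in A, A'. rewrite A in A'. now injection A'.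
  - apply is_lim_seq_unique in B, B'. rewrite B in B'. now injection B'.
Qed.

Lemma Clim_RtoC (u : nat -> R) (l : R) : is_lim_seq u l -> Clim (fun n => RtoC (u n)) l.
Proof. intros H; split; simpl; [exact H | apply is_lim_seq_const]. Qed.

Lemma Clim_subseq u (phi : nat -> nat) l :
  filterlim phi eventually eventually -> Clim u l -> Clim (fun n => u (phi n)) l.
Proof.
  intros Hp [A B]; split.
  - exact (is_lim_seq_subseq (fun n => Re (u n)) _ phi Hp A).
  - exact (is_lim_seq_subseq (fun n => Im (u n)) _ phi Hp B).
Qed.

Lemma Clim_incr_1 u l : Clim (fun n => u (S n)) l <-> Clim u l.
Proof.
  split; intros [A B]; split.
  - now apply (is_lim_seq_incr_1 (fun n => Re (u n))).
  - now apply (is_lim_seq_incr_1 (fun n => Im (u n))).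
  - now apply (is_lim_seq_incr_1 (fun n => Re (u n))) in A.
  - now apply (is_lim_seq_incr_1 (fun n => Im (u n))) in B.
Qed.

Lemma Clim_mod u l : Clim u l <-> is_lim_seq (fun n => Cmod (u n - l)) 0.
Proof.
  split.
  - intros [A B].
    apply is_lim_seq_le_le with (u := fun _ => 0)
      (w := fun n => Rabs (Re (u n) - Re l) + Rabs (Im (u n) - Im l)).
    + intros n. split; [apply Cmod_ge_0|].
      rewrite <- re_minus, <- im_minus. apply Cmod_le_Re_Im.
    + apply is_lim_seq_const.
    + replace (Finite 0) with (Finite (Rabs 0 + Rabs 0)) by (f_equal; rewrite Rabs_R0; ring).
      apply is_lim_seq_plus'.
      * apply (is_lim_seq_abs (fun n => Re (u n) - Re l) 0).
        replace 0 with (Re l - Re l) by ring. apply is_lim_seq_minus'; auto using is_lim_seq_const.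
      * apply (is_lim_seq_abs (fun n => Im (u n) - Im l) 0).
        replace 0 with (Im l - Im l) by ring. apply is_lim_seq_minus'; auto using is_lim_seq_const.
  - intros H. split.
    + assert (K : is_lim_seq (fun n => Re (u n) - Re l) 0).
      { apply is_lim_seq_abs_0. eapply is_lim_seq_le_le; [|apply is_lim_seq_const|exact H].
        intros n. split; [apply Rabs_pos|]. rewrite <- re_minus. apply re_le_Cmod. }
      replace (Finite (Re l)) with (Finite (0 + Re l)) by (f_equal; ring).
      apply is_lim_seq_ext with (fun n => (Re (u n) - Re l) + Re l); [intros; ring|].
      apply is_lim_seq_plus'; auto using is_lim_seq_const.
    + assert (K : is_lim_seq (fun n => Im (u n) - Im l) 0).
      { apply is_lim_seq_abs_0. eapply is_lim_seq_le_le; [|apply is_lim_seq_const|exact H].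
        intros n. split; [apply Rabs_pos|]. rewrite <- im_minus. apply im_le_Cmod. }
      replace (Finite (Im l)) with (Finite (0 + Im l)) by (f_equal; ring).
      apply is_lim_seq_ext with (fun n => (Im (u n) - Im l) + Im l); [intros; ring|].
      apply is_lim_seq_plus'; auto using is_lim_seq_const.
Qed.

Lemma Clim_squeeze u l (v : nat -> R) :
  (exists N, forall n, (N <= n)%nat -> Cmod (u n - l) <= v n) -> is_lim_seq v 0 -> Clim u l.
Proof.
  intros [N H] Hv. apply Clim_mod.
  apply is_lim_seq_le_le_loc with (u := fun _ => 0) (w := v); auto using is_lim_seq_const.
  exists N. intros n Hn. split; [apply Cmod_ge_0 | now apply H].
Qed.

Lemma Clim_Cmod_le u l M :
  (exists N, forall n, (N <= n)%nat -> Cmod (u n) <= M) -> Clim u l -> Cmod l <= M.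
Proof.
  intros [N H] Hl. apply Clim_mod in Hl.
  apply (is_lim_seq_le_loc (fun _ => Cmod l - M) (fun n => Cmod (u n - l)) (Cmod l - M) 0) in Hl;
    [simpl in Hl; lra | | apply is_lim_seq_const].
  exists N. intros n Hn. specialize (H n Hn).
  rewrite Cmod_minus_sym. pose proof (Cmod_triangle_rev l (u n)). lra.
Qed.

Lemma Clim_Cexp u l : Clim u l -> Clim (fun n => Cexp (u n)) (Cexp l).
Proof.
  intros [A B]; split; unfold Cexp; simpl; apply is_lim_seq_mult'.
  - apply is_lim_seq_continuous; [apply derivable_continuous, derivable_exp | exact A].
  - apply is_lim_seq_continuous; [apply continuity_cos | exact B].
  - apply is_lim_seq_continuous; [apply derivable_continuous, derivable_exp | exact A].
  - apply is_lim_seq_continuous; [apply continuity_sin | exact B].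
Qed.

Lemma CLim_seq_Clim u l : Clim u l -> CLim_seq u = l.
Proof.
  intros [A B]. unfold CLim_seq. apply C_eq; simpl; now erewrite is_lim_seq_unique by eassumption.
Qed.

(** * Finite sums and series *)

Fixpoint csum (f : nat -> C) (n : nat) : C :=
  match n with O => RtoC 0 | S m => (csum f m + f m)%C end.

Fixpoint rsum (f : nat -> R) (n : nat) : R :=
  match n with O => 0 | S m => rsum f m + f m end.

Lemma csum_ext f g n : (forall k, (k < n)%nat -> f k = g k) -> csum f n = csum g n.
Proof. induction n; simpl; intros H; [easy|]. rewrite IHn, H; auto. Qed.

Lemma rsum_ext f g n : (forall k, (k < n)%nat -> f k = g k) -> rsum f n = rsum g n.
Proof. induction n; simpl; intros H; [easy|]. rewrite IHn, H; auto. Qed.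

Lemma csum_plus f g n : csum (fun k => f k + g k)%C n = (csum f n + csum g n)%C.
Proof. induction n; simpl; [ring|]. rewrite IHn. ring. Qed.

Lemma csum_scal c f n : csum (fun k => c * f k)%C n = (c * csum f n)%C.
Proof. induction n; simpl; [ring|]. rewrite IHn. ring. Qed.

Lemma csum_minus f g n : csum (fun k => f k - g k)%C n = (csum f n - csum g n)%C.
Proof. induction n; simpl; [ring|]. rewrite IHn. ring. Qed.

Lemma csum_RtoC (f : nat -> R) n : csum (fun k => RtoC (f k)) n = RtoC (rsum f n).
Proof. induction n; simpl; [easy|]. now rewrite IHn, RtoC_plus. Qed.

Lemma csum_tele f n : csum (fun k => f (S k) - f k)%C n = (f n - f 0%nat)%C.
Proof. induction n; simpl; [ring|]. rewrite IHn. ring. Qed.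

Lemma csum_Sl f n : csum f (S n) = (f 0%nat + csum (fun k => f (S k)) n)%C.
Proof. induction n; [simpl; ring|]. cbn [csum] in *. rewrite IHn. ring. Qed.

Lemma Re_csum f n : Re (csum f n) = rsum (fun k => Re (f k)) n.
Proof. induction n; simpl; [easy|]. unfold Re in *. simpl. now rewrite IHn. Qed.

Lemma Im_csum f n : Im (csum f n) = rsum (fun k => Im (f k)) n.
Proof. induction n; simpl; [easy|]. unfold Im in *. simpl. now rewrite IHn. Qed.

Lemma rsum_le f g n : (forall k, (k < n)%nat -> f k <= g k) -> rsum f n <= rsum g n.
Proof. induction n; simpl; intros H; [lra|]. specialize (IHn (fun k h => H k (Nat.lt_lt_succ_r _ _ h))). specialize (H n (Nat.lt_succ_diag_r n)). lra. Qed.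

Lemma rsum_scal c f n : rsum (fun k => c * f k) n = c * rsum f n.
Proof. induction n; simpl; [ring|]. rewrite IHn. ring. Qed.

Lemma rsum_ge_0 f n : (forall k, 0 <= f k) -> 0 <= rsum f n.
Proof. intros H; induction n; simpl; [lra|]. specialize (H n). lra. Qed.

Lemma rsum_Sl f n : rsum f (S n) = f 0%nat + rsum (fun k => f (S k)) n.
Proof. induction n; [simpl; ring|]. cbn [rsum] in *. rewrite IHn. ring. Qed.

Lemma Cmod_csum f n : Cmod (csum f n) <= rsum (fun k => Cmod (f k)) n.
Proof.
  induction n; simpl; [rewrite Cmod_0; lra|].
  eapply Rle_trans; [apply Cmod_triangle|]. lra.
Qed.

Lemma rsum_sum_n f n : rsum f (S n) = sum_n f n.
Proof.
  induction n; [simpl; rewrite sum_O; ring|].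
  rewrite sum_Sn, <- IHn. reflexivity.
Qed.

Lemma is_series_rsum (f : nat -> R) (l : R) : is_series f l <-> is_lim_seq (rsum f) l.
Proof.
  rewrite (is_lim_seq_incr_1 (rsum f)). unfold is_series.
  split; intros H; (eapply filterlim_ext; [|exact H]); intros n; simpl; now rewrite <- rsum_sum_n.
Qed.

Definition csums (f : nat -> C) (l : C) : Prop := Clim (csum f) l.

Lemma csums_components f l :
  csums f l <-> is_series (fun k => Re (f k)) (Re l) /\ is_series (fun k => Im (f k)) (Im l).
Proof.
  unfold csums, Clim. rewrite !is_series_rsum.
  split; intros [A B]; split; (eapply is_lim_seq_ext; [|eassumption]); intros n; simpl;
    rewrite ?Re_csum, ?Im_csum; reflexivity.
Qed.

Lemma csums_dominated f (g : nat -> R) :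
  (forall k, Cmod (f k) <= g k) -> ex_series g -> exists l, csums f l.
Proof.
  intros H [G HG].
  assert (A : ex_series (fun k => Re (f k))).
  { apply (@ex_series_le R_AbsRing R_CompleteNormedModule _ g); [|now exists G].
    intros n. eapply Rle_trans; [apply (re_le_Cmod (f n)) | apply H]. }
  assert (B : ex_series (fun k => Im (f k))).
  { apply (@ex_series_le R_AbsRing R_CompleteNormedModule _ g); [|now exists G].
    intros n. eapply Rle_trans; [apply (im_le_Cmod (f n)) | apply H]. }
  destruct A as [a A], B as [b B]. exists (a, b). apply csums_components. now split.
Qed.

Lemma rsum_le_series (g : nat -> R) (G : R) n :
  (forall k, 0 <= g k) -> is_series g G -> rsum g n <= G.
Proof.
  intros H HG. apply is_series_rsum in HG.
  apply (is_lim_seq_incr_compare (rsum g) G HG). intros m. simpl. specialize (H m). lra.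
Qed.

(** The terms between [n] and any later [m] are dominated by those of [g], hence by the tail of
    [g]. *)
Lemma csums_tail f (g : nat -> R) l (G : R) :
  (forall k, Cmod (f k) <= g k) -> is_series g G -> csums f l ->
  forall n, Cmod (l - csum f n) <= G - rsum g n.
Proof.
  intros H HG Hl n.
  assert (Hg : forall k, 0 <= g k) by (intros k; eapply Rle_trans; [apply Cmod_ge_0 | apply H]).
  apply (Clim_Cmod_le (fun m => csum f m - csum f n)%C).
  - exists n. intros m Hm. apply Rle_trans with (rsum g m - rsum g n).
    + induction Hm as [|m Hm IH].
      * replace (csum f n - csum f n)%C with (RtoC 0) by ring. rewrite Cmod_0. lra.
      * simpl. replace (csum f m + f m - csum f n)%C with ((csum f m - csum f n) + f m)%C by ring.
        eapply Rle_trans; [apply Cmod_triangle|]. specialize (H m). lra.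
    + pose proof (rsum_le_series g G m Hg HG). lra.
  - apply Clim_minus; [exact Hl | apply Clim_const].
Qed.

Lemma csums_le f (g : nat -> R) l (G : R) :
  (forall k, Cmod (f k) <= g k) -> is_series g G -> csums f l -> Cmod l <= G.
Proof.
  intros H HG Hl. pose proof (csums_tail f g l G H HG Hl 0) as K. simpl in K.
  replace (l - 0)%C with l in K by ring. lra.
Qed.

Lemma csums_ext f g l : (forall k, f k = g k) -> csums f l -> csums g l.
Proof. intros E. apply Clim_ext. intros n. apply csum_ext. auto. Qed.

Lemma csums_plus f g l k : csums f l -> csums g k -> csums (fun n => f n + g n)%C (l + k)%C.
Proof.
  intros A B. eapply Clim_ext; [intros; symmetry; apply csum_plus|]. now apply Clim_plus.
Qed.

Lemma csums_scal c f l : csums f l -> csums (fun n => c * f n)%C (c * l)%C.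
Proof.
  intros A. eapply Clim_ext; [intros; symmetry; apply csum_scal|]. now apply Clim_scal.
Qed.

Lemma csums_unique f l k : csums f l -> csums f k -> l = k.
Proof. apply Clim_unique. Qed.

Lemma csums_RtoC (f : nat -> R) (l : R) : is_series f l -> csums (fun k => RtoC (f k)) l.
Proof.
  intros H. apply is_series_rsum in H.
  eapply Clim_ext; [intros; symmetry; apply csum_RtoC|]. now apply Clim_RtoC.
Qed.

(** * Exponential and logarithm *)

Lemma Cexp_plus (a b : C) : Cexp (a + b) = (Cexp a * Cexp b)%C.
Proof.
  destruct a as [a a'], b as [b b'].
  apply C_eq; unfold Cexp, Re, Im; simpl; rewrite exp_plus, ?cos_plus, ?sin_plus; ring.
Qed.

Lemma Cexp_0 : Cexp 0 = 1.
Proof. apply C_eq; unfold Cexp; simpl; rewrite exp_0, ?cos_0, ?sin_0; ring. Qed.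

Lemma Cmod_Cexp (z : C) : Cmod (Cexp z) = exp (Re z).
Proof.
  unfold Cexp, Cmod. cbn [fst snd].
  replace (_ + _) with (exp (Re z) ^ 2).
  - apply sqrt_pow2. left; apply exp_pos.
  - pose proof (sin2_cos2 (Im z)) as H. unfold Rsqr in H.
    replace (exp (Re z) ^ 2) with (exp (Re z) ^ 2 * 1) by ring. rewrite <- H. ring.
Qed.

Lemma Cexp_neq_0 (z : C) : Cexp z <> 0.
Proof. apply Cmod_gt_0. rewrite Cmod_Cexp. apply exp_pos. Qed.

Lemma Cexp_opp (z : C) : Cexp (- z) = (/ Cexp z)%C.
Proof.
  assert (H : (Cexp (- z) * Cexp z = 1)%C) by
    (rewrite <- Cexp_plus; replace (- z + z)%C with (RtoC 0) by ring; apply Cexp_0).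
  replace (/ Cexp z)%C with (Cexp (- z) * Cexp z * / Cexp z)%C by (rewrite H; ring).
  field. apply Cexp_neq_0.
Qed.

Lemma Cexp_minus (a b : C) : Cexp (a - b) = (Cexp a / Cexp b)%C.
Proof. unfold Cminus. now rewrite Cexp_plus, Cexp_opp. Qed.

Lemma Cexp_RtoC (x : R) : Cexp x = exp x.
Proof. apply C_eq; unfold Cexp; simpl; rewrite ?cos_0, ?sin_0; ring. Qed.

Lemma Cexp_INR (n : nat) (z : C) : Cexp (INR n * z) = (Cexp z ^ n)%C.
Proof.
  induction n as [|n IH].
  - simpl. rewrite <- Cexp_0. f_equal. ring.
  - rewrite S_INR, RtoC_plus.
    replace ((INR n + 1) * z)%C with (z + INR n * z)%C by ring.
    now rewrite Cexp_plus, IH.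
Qed.

Lemma cos_eq_1 (x : R) : - (2 * PI) < x < 2 * PI -> cos x = 1 -> x = 0.
Proof.
  intros Hx H. replace x with (2 * (x / 2)) in H by lra.
  rewrite cos_2a_sin in H. assert (S : sin (x / 2) = 0) by nra.
  destruct (Rtotal_order x 0) as [L|[E|G]]; auto.
  - assert (0 < sin (- (x / 2))) by (apply sin_gt_0; lra). rewrite sin_neg in H0. lra.
  - assert (0 < sin (x / 2)) by (apply sin_gt_0; lra). lra.
Qed.

(** Two angles in the principal range differ by less than [2 PI], where [cos] takes the value
    [1] only at [0]. *)
Lemma Carg_unique (z : C) (r t : R) :
  0 < r -> - PI < t <= PI -> z = (r * cos t, r * sin t) -> Carg z = t.
Proof.
  intros Hr Ht E.
  assert (Hz : Cmod z = r).
  { rewrite E. unfold Cmod; cbn [fst snd].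
    replace ((r * cos t) ^ 2 + (r * sin t) ^ 2) with (r ^ 2).
    - apply sqrt_pow2; lra.
    - pose proof (sin2_cos2 t) as H. unfold Rsqr in H.
      replace (r ^ 2) with (r ^ 2 * 1) by ring. rewrite <- H. ring. }
  assert (Hz0 : z <> 0) by (apply Cmod_gt_0; lra).
  destruct (Carg_spec z Hz0) as [H1 H2].
  rewrite Hz in H2. set (a := Carg z) in *. rewrite E in H2. injection H2 as Hc Hs.
  apply Rmult_eq_reg_l in Hc; [|lra]. apply Rmult_eq_reg_l in Hs; [|lra].
  enough (a - t = 0) by lra. apply cos_eq_1; [lra|].
  rewrite cos_minus, <- Hc, <- Hs. pose proof (sin2_cos2 t) as H. unfold Rsqr in H. lra.
Qed.

Lemma slit_neq_0 (z : C) : slit_plane z -> z <> 0.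
Proof. intros [H|H] ->; simpl in H; lra. Qed.

Lemma slit_RtoC (x : R) : 0 < x -> slit_plane x.
Proof. now left. Qed.

Lemma cos_atan_pos (u : R) : 0 < cos (atan u).
Proof. pose proof (atan_bound u). apply cos_gt_0; lra. Qed.

Lemma Carg_Re_pos (z : C) : 0 < Re z -> Carg z = atan (Im z / Re z).
Proof.
  intros H. pose proof (atan_bound (Im z / Re z)) as Hb. pose proof PI_RGT_0.
  pose proof (cos_atan_pos (Im z / Re z)) as Hc.
  apply Carg_unique with (Re z / cos (atan (Im z / Re z))).
  - now apply Rdiv_lt_0_compat.
  - lra.
  - apply C_eq; cbn [Re Im fst snd]; [field; lra|].
    replace (Re z / cos (atan (Im z / Re z)) * sin (atan (Im z / Re z)))
      with (Re z * tan (atan (Im z / Re z))) by (unfold tan; field; lra).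
    rewrite tan_atan. unfold Re, Im in *; simpl in *; field; lra.
Qed.

Lemma Carg_Im_pos (z : C) : 0 < Im z -> Carg z = PI / 2 - atan (Re z / Im z).
Proof.
  intros H. pose proof (atan_bound (Re z / Im z)) as Hb. pose proof PI_RGT_0.
  pose proof (cos_atan_pos (Re z / Im z)) as Hc.
  apply Carg_unique with (Im z / cos (atan (Re z / Im z))).
  - now apply Rdiv_lt_0_compat.
  - lra.
  - rewrite cos_shift, sin_shift. apply C_eq; cbn [Re Im fst snd]; [|field; lra].
    replace (Im z / cos (atan (Re z / Im z)) * sin (atan (Re z / Im z)))
      with (Im z * tan (atan (Re z / Im z))) by (unfold tan; field; lra).
    rewrite tan_atan. unfold Re, Im in *; simpl in *; field; lra.
Qed.

Lemma Carg_Im_neg (z : C) : Im z < 0 -> Carg z = - (PI / 2) - atan (Re z / Im z).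
Proof.
  intros H. pose proof (atan_bound (Re z / Im z)) as Hb. pose proof PI_RGT_0.
  pose proof (cos_atan_pos (Re z / Im z)) as Hc.
  assert (E : - (PI / 2) - atan (Re z / Im z) = - (PI / 2 - (- atan (Re z / Im z)))) by ring.
  apply Carg_unique with (- Im z / cos (atan (Re z / Im z))).
  - apply Rdiv_lt_0_compat; lra.
  - lra.
  - rewrite E, cos_neg, sin_neg, cos_shift, sin_shift, cos_neg, sin_neg.
    apply C_eq; cbn [Re Im fst snd]; [|field; lra].
    replace (- Im z / cos (atan (Re z / Im z)) * - sin (atan (Re z / Im z)))
      with (Im z * tan (atan (Re z / Im z))) by (unfold tan; field; lra).
    rewrite tan_atan. unfold Re, Im in *; simpl in *; field; lra.
Qed.

Lemma Carg_RtoC (x : R) : 0 < x -> Carg x = 0.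
Proof.
  intros H. rewrite Carg_Re_pos by exact H. simpl.
  replace (0 / x) with 0 by (field; lra). apply atan_0.
Qed.

Lemma Clog_RtoC (x : R) : 0 < x -> Clog x = ln x.
Proof.
  intros H. unfold Clog. rewrite Carg_RtoC, Cmod_Rpos by lra. reflexivity.
Qed.

Lemma Cexp_Clog (z : C) : z <> 0 -> Cexp (Clog z) = z.
Proof.
  intros H. destruct (Carg_spec z H) as [_ E].
  unfold Cexp, Clog; cbn [Re Im fst snd]. rewrite exp_ln by now apply Cmod_gt_0. now symmetry.
Qed.

Lemma Clog_scal (r : R) (z : C) : 0 < r -> z <> 0 -> Clog (r * z) = (ln r + Clog z)%C.
Proof.
  intros Hr Hz. pose proof (proj1 (Cmod_gt_0 z) Hz) as Hm.
  destruct (Carg_spec z Hz) as [Hb E].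
  assert (Ha : Carg (r * z) = Carg z).
  { apply Carg_unique with (r * Cmod z); [now apply Rmult_lt_0_compat | exact Hb|].
    rewrite E at 1. apply C_eq; simpl; ring. }
  unfold Clog. rewrite Ha. rewrite Cmod_mult, Cmod_Rpos, ln_mult by lra.
  apply C_eq; simpl; ring.
Qed.

Lemma Cmod_sq (z : C) : Cmod z * Cmod z = Re z * Re z + Im z * Im z.
Proof. pose proof (Cmod2_alt z). simpl in H. lra. Qed.

Lemma ln_Cmod (z : C) : z <> 0 -> ln (Cmod z) = / 2 * ln (Re z * Re z + Im z * Im z).
Proof.
  intros H. apply Cmod_gt_0 in H. rewrite <- Cmod_sq, ln_mult by assumption. field.
Qed.

Lemma continuous_pos_loc (f : R -> R) t :
  continuous f t -> 0 < f t -> locally t (fun x => 0 < f x).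
Proof. intros H1 H2. apply (H1 (fun y => 0 < y)). now apply (open_gt 0). Qed.

(** Near each point of the slit plane the principal argument is one of three arctangents of
    quotients of [Re] and [Im], up to a constant; all have the imaginary part of [l / f t] as
    derivative. *)
Lemma Cderiv_Clog f t l :
  slit_plane (f t) -> Cderiv f t l -> Cderiv (fun x => Clog (f x)) t (l / f t)%C.
Proof.
  intros Hs Hd. pose proof (slit_neq_0 _ Hs) as Hz. pose proof (Cmod_neq_0_sq _ Hz) as Hn.
  destruct (Cderiv_Ccont _ _ _ Hd) as [CA CB]. destruct Hd as [A B].
  assert (Hp : 0 < Re (f t) * Re (f t) + Im (f t) * Im (f t)) by nra.
  assert (D : is_derive (fun x => Re (f x) * Re (f x) + Im (f x) * Im (f x)) t
    ((Re l * Re (f t) + Re (f t) * Re l) + (Im l * Im (f t) + Im (f t) * Im l))).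
  { apply (@is_derive_plus R_AbsRing R_NormedModule); now apply is_derive_Rmult. }
  assert (Lz : locally t (fun x => f x <> 0)).
  { pose proof (continuous_pos_loc _ t (@ex_derive_continuous R_AbsRing R_NormedModule _ _
      (ex_intro _ _ D)) Hp) as L.
    eapply filter_imp; [|exact L]. intros x Hx E. cbv beta in Hx. rewrite E in Hx. simpl in Hx. lra. }
  assert (E : (l / f t)%C = ((Re l * Re (f t) + Im l * Im (f t)) / (Re (f t) * Re (f t) + Im (f t) * Im (f t)),
     (Im l * Re (f t) - Re l * Im (f t)) / (Re (f t) * Re (f t) + Im (f t) * Im (f t)))).
  { destruct (f t) as [a b], l as [c d]. unfold Re, Im in *; simpl in *.
    apply C_eq; unfold Cdiv, Cinv; simpl; field; lra. }
  rewrite E. split; cbn [Re Im fst snd].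
  - eapply is_derive_ext_loc with (f := fun x => / 2 * ln (Re (f x) * Re (f x) + Im (f x) * Im (f x))).
    { eapply filter_imp; [|exact Lz]. intros x Hx. cbn [Clog Re fst]. now rewrite <- ln_Cmod. }
    eapply is_derive_eq.
    + apply is_derive_scal. apply (is_derive_comp ln _ t); [|exact D].
      apply is_derive_ln. exact Hp.
    + unfold scal; simpl; unfold mult; simpl. field. lra.
  - assert (Cases : 0 < Re (f t) \/ 0 < Im (f t) \/ 0 < - Im (f t)).
    { destruct Hs as [H|H]; [now left|]. right.
      destruct (Rtotal_order (Im (f t)) 0) as [|[|]]; lra. }
    assert (At : forall (u : R -> R) d, is_derive u t d ->
              is_derive (fun x => atan (u x)) t (d * / (1 + (u t) ^ 2))).
    { intros u d Hu. apply (is_derive_comp atan u t); [|exact Hu].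
      apply is_derive_Reals, derivable_pt_lim_atan. }
    destruct Cases as [H|[H|H]].
    + pose proof (continuous_pos_loc _ t CA H) as L.
      eapply is_derive_ext_loc with (f := fun x => atan (Im (f x) / Re (f x))).
      { eapply filter_imp; [|exact L]. intros x Hx. cbn [Clog Im snd]. now rewrite Carg_Re_pos. }
      eapply is_derive_eq; [apply At; apply is_derive_div; [exact B | exact A | lra]|].
      clear E Lz D L. cbv beta. destruct (f t) as [a b], l as [c d]. unfold Re, Im in *; simpl in *. field; repeat split; nra.
    + pose proof (continuous_pos_loc _ t CB H) as L.
      eapply is_derive_ext_loc with (f := fun x => minus (PI / 2) (atan (Re (f x) / Im (f x)))).
      { eapply filter_imp; [|exact L]. intros x Hx. cbn [Clog Im snd]. now rewrite Carg_Im_pos. }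
      eapply is_derive_eq; [apply (@is_derive_minus R_AbsRing R_NormedModule);
        [apply (@is_derive_const R_AbsRing R_NormedModule) |
         apply At; apply is_derive_div; [exact A | exact B | lra]]|].
      clear E Lz D L. cbv beta. destruct (f t) as [a b], l as [c d].
      unfold minus, zero, plus, opp, Re, Im in *; simpl in *. field; repeat split; nra.
    + assert (H' : Im (f t) < 0) by lra.
      pose proof (continuous_pos_loc _ t (@continuous_opp R_UniformSpace R_AbsRing R_NormedModule _ _ CB) H) as L.
      eapply is_derive_ext_loc with (f := fun x => minus (- (PI / 2)) (atan (Re (f x) / Im (f x)))).
      { eapply filter_imp; [|exact L]. unfold opp; simpl. intros x Hx. cbn [Clog Im snd].
        rewrite Carg_Im_neg; [reflexivity|]. unfold Im in *; lra. }
      eapply is_derive_eq; [apply (@is_derive_minus R_AbsRing R_NormedModule);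
        [apply (@is_derive_const R_AbsRing R_NormedModule) |
         apply At; apply is_derive_div; [exact A | exact B | lra]]|].
      clear E Lz D L. cbv beta. destruct (f t) as [a b], l as [c d].
      unfold minus, zero, plus, opp, Re, Im in *; simpl in *. field; repeat split; nra.
Qed.

(** * Taylor remainders of the exponential and the logarithm *)

Lemma Cderiv_csum (f : R -> nat -> C) l t n :
  (forall k, Cderiv (fun x => f x k) t (l k)) -> Cderiv (fun x => csum (f x) n) t (csum l n).
Proof.
  intros H. induction n as [|n IH]; simpl.
  - apply Cderiv_const.
  - apply Cderiv_plus; auto.
Qed.

Lemma Cderiv_pow f t l n :
  Cderiv f t l -> Cderiv (fun x => f x ^ S n)%C t (INR (S n) * l * f t ^ n)%C.
Proof.
  intros H. induction n as [|n IH].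
  - eapply Cderiv_val; [apply Cderiv_ext with f; [intros; simpl; ring | exact H]|]. simpl. ring.
  - eapply Cderiv_val.
    + apply (Cderiv_ext (fun x => f x * f x ^ S n)%C); [reflexivity|].
      apply Cderiv_mult; [exact H | exact IH].
    + cbv beta. rewrite (S_INR (S n)), RtoC_plus. simpl. ring.
Qed.

(** Differentiates an expression by the rules above, leaving as goals the derivatives of unknown
    functions and the side conditions of the inverse and of [Clog]. *)
Ltac cder :=
  lazymatch goal with
  | |- Cderiv (fun _ => ?c) _ _ => apply Cderiv_const
  | |- Cderiv (fun x => RtoC x) _ _ => apply Cderiv_id
  | |- Cderiv (fun x => (@?f x + @?g x)%C) _ _ => apply (Cderiv_plus f g); cder
  | |- Cderiv (fun x => (@?f x - @?g x)%C) _ _ => apply (Cderiv_minus f g); cder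
  | |- Cderiv (fun x => (@?f x * @?g x)%C) _ _ => apply (Cderiv_mult f g); cder
  | |- Cderiv (fun x => (@?f x / @?g x)%C) _ _ =>
      apply (Cderiv_mult f (fun x => (/ g x)%C)); cder
  | |- Cderiv (fun x => (- @?f x)%C) _ _ => apply (Cderiv_opp f); cder
  | |- Cderiv (fun x => Cexp (@?f x)) _ _ => apply (Cderiv_exp f); cder
  | |- Cderiv (fun x => (/ @?f x)%C) _ _ => apply (Cderiv_inv f); [ | cder]
  | |- Cderiv (fun x => Clog (@?f x)) _ _ => apply (Cderiv_Clog f); [ | cder]
  | |- Cderiv (fun x => (@?f x ^ S ?n)%C) _ _ => apply (Cderiv_pow f); cder
  | |- _ => idtac
  end.

(** Continuity of such an expression, through its differentiability. *)
Ltac ccont := eapply Cderiv_Ccont; cder.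

Lemma RtoC_neq (x : R) : x <> 0 -> RtoC x <> 0.
Proof. intros H E. apply H. now apply RtoC_inj. Qed.

Lemma INR_fact_S (n : nat) : INR (fact (S n)) = INR (S n) * INR (fact n).
Proof. now rewrite fact_simpl, mult_INR. Qed.

Definition cexp_poly (J : nat) (w : C) : C := csum (fun j => w ^ j / INR (fact j))%C J.

Lemma cexp_poly_0 J : cexp_poly (S J) 0 = 1.
Proof.
  induction J as [|J IH].
  - unfold cexp_poly. simpl. field.
  - unfold cexp_poly in *. cbn [csum] in *. rewrite IH.
    replace (0 ^ S J)%C with (RtoC 0) by (simpl; ring).
    field. apply RtoC_neq, INR_fact_neq_0.
Qed.

Lemma Cderiv_cexp_poly J (w : C) r :
  Cderiv (fun x => cexp_poly (S J) (x * w)) r (w * cexp_poly J (r * w))%C.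
Proof.
  eapply Cderiv_ext with (f := fun x => (1 + csum (fun j => (x * w) ^ S j / INR (fact (S j))) J)%C).
  { intros x. unfold cexp_poly. rewrite csum_Sl. f_equal. simpl. field. }
  eapply Cderiv_val.
  - apply Cderiv_plus; [apply Cderiv_const|].
    apply (Cderiv_csum (fun x j => (x * w) ^ S j / INR (fact (S j)))%C
             (fun j => INR (S j) * w * (r * w) ^ j / INR (fact (S j)))%C).
    intros j. eapply Cderiv_val; [cder|]. cbv beta.
    unfold Cdiv. ring.
  - rewrite Cplus_0_l. unfold cexp_poly. rewrite <- csum_scal. apply csum_ext.
    intros k _. rewrite INR_fact_S, RtoC_mult. field.
    split; apply RtoC_neq; [apply INR_fact_neq_0 | apply not_0_INR; lia].
Qed.

Lemma Cmod_scalR (r : R) (w : C) : 0 <= r -> Cmod (r * w) = r * Cmod w.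
Proof. intros H. now rewrite Cmod_mult, Cmod_Rpos. Qed.

Lemma Re_le_Cmod (w : C) : Re w <= Cmod w.
Proof. pose proof (re_le_Cmod w). pose proof (Rle_abs (Re w)). lra. Qed.

Lemma exp_mono (x y : R) : x <= y -> exp x <= exp y.
Proof. intros [H| ->]; [left; now apply exp_increasing | right; reflexivity]. Qed.

Lemma is_RInt_pow (K : R) J a b :
  is_RInt (fun r => K * r ^ J) a b (K * b ^ S J / INR (S J) - K * a ^ S J / INR (S J)).
Proof.
  assert (HS : INR (S J) <> 0) by (apply not_0_INR; lia).
  apply (is_RInt_derive (fun r => K * r ^ S J / INR (S J)) (fun r => K * r ^ J)).
  - intros x _. auto_derive; [easy|]. rewrite <- ?pred_Sn. change (match J with O => 1 | S _ => INR J + 1 end) with (INR (S J)). field. exact HS.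
  - intros x _. apply (@ex_derive_continuous R_AbsRing R_NormedModule). auto_derive. easy.
Qed.

(** Induction on [J]: along [r w] the remainder of order [J + 1] has as derivative [w] times the
    remainder of order [J], and both vanish at [0]. *)
Lemma cexp_taylor J : forall w : C,
  Cmod (Cexp w - cexp_poly J w) <= Cmod w ^ J / INR (fact J) * exp (Cmod w).
Proof.
  induction J as [|J IH]; intros w.
  - unfold cexp_poly; simpl. replace (Cexp w - 0)%C with (Cexp w) by ring.
    rewrite Cmod_Cexp. replace (1 / 1 * exp (Cmod w)) with (exp (Cmod w)) by field.
    apply exp_mono, Re_le_Cmod.
  - set (F := fun r : R => (Cexp (r * w) - cexp_poly (S J) (r * w))%C).
    set (f := fun r : R => (w * (Cexp (r * w) - cexp_poly J (r * w)))%C).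
    assert (D : forall r, Cderiv F r (f r)).
    { intros r. unfold F, f. eapply Cderiv_val.
      - apply Cderiv_minus; [cder | apply Cderiv_cexp_poly].
      - cbv beta. ring. }
    assert (Cf : forall r, Ccont f r).
    { intros r. unfold f. apply Ccont_mult; [apply Ccont_const|]. apply Ccont_minus; [ccont|].
      destruct J as [|J]; [apply Ccont_const|].
      eapply Cderiv_Ccont, Cderiv_cexp_poly. }
    replace (Cexp w - cexp_poly (S J) w)%C with (F 1 - F 0)%C.
    2:{ unfold F. replace (0 * w)%C with (RtoC 0) by ring. rewrite cexp_poly_0, Cexp_0.
        replace (1 * w)%C with w by ring. ring. }
    rewrite <- (CInt_FTC F f) by (auto; lra).
    set (K := Cmod w * (Cmod w ^ J / INR (fact J) * exp (Cmod w))).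
    assert (R1 : is_RInt (fun r => K * r ^ J) 0 1 (K * 1 ^ S J / INR (S J) - K * 0 ^ S J / INR (S J)))
      by apply is_RInt_pow.
    eapply Rle_trans.
    + apply CInt_norm_le with (g := fun r => K * r ^ J); [lra | | eexists; exact R1 |].
      * apply Cexint_cont. auto.
      * intros r Hr. unfold f. rewrite Cmod_mult. unfold K. rewrite Rmult_assoc.
        apply Rmult_le_compat_l; [apply Cmod_ge_0|]. eapply Rle_trans; [apply IH|].
        rewrite Cmod_scalR by lra. rewrite Rpow_mult_distr.
        replace (r ^ J * Cmod w ^ J / INR (fact J) * exp (r * Cmod w))
          with (Cmod w ^ J / INR (fact J) * r ^ J * exp (r * Cmod w)) by (unfold Rdiv; ring).
        replace (Cmod w ^ J / INR (fact J) * exp (Cmod w) * r ^ J)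
          with (Cmod w ^ J / INR (fact J) * r ^ J * exp (Cmod w)) by ring.
        pose proof (Cmod_ge_0 w).
        apply Rmult_le_compat_l.
        -- apply Rmult_le_pos; [|apply pow_le; lra].
           apply Rmult_le_pos; [now apply pow_le|]. left. apply Rinv_0_lt_compat, INR_fact_lt_0.
        -- apply exp_mono. nra.
    + rewrite (is_RInt_unique _ _ _ _ R1). unfold K.
      rewrite pow1, pow_i by lia. rewrite INR_fact_S. simpl (Cmod w ^ S J).
      apply Req_le. field. split; [apply INR_fact_neq_0 | apply not_0_INR; lia].
Qed.

(** A single term of the exponential series. *)
Lemma pow_le_fact_exp (x : R) (J : nat) : 0 <= x -> x ^ J / INR (fact J) <= exp x.
Proof.
  intros Hx. assert (HJ : 0 < INR (fact J)) by apply INR_fact_lt_0.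
  pose proof (is_exp_Reals x) as H. apply is_pseries_R in H. apply is_series_rsum in H.
  eapply Rle_trans; [|apply (is_lim_seq_incr_compare _ _ H) with (n := S J)].
  - simpl. assert (0 <= rsum (fun k => / INR (fact k) * x ^ k) J).
    { apply rsum_ge_0. intros k. apply Rmult_le_pos; [|now apply pow_le].
      left. apply Rinv_0_lt_compat, INR_fact_lt_0. }
    unfold Rdiv. lra.
  - intros k. simpl. assert (0 <= / INR (fact k) * x ^ k); [|lra].
    apply Rmult_le_pos; [|now apply pow_le].
    left. apply Rinv_0_lt_compat, INR_fact_lt_0.
Qed.

(** Since [(2 x) ^ J / J!] is at most [exp (2 x)], the factorial can be traded for a factor [2 ^
    (- J)]. The error is then small uniformly in [w] up to a power of [exp |w|], as needed when
    the exponential is expanded inside a series of integrals. *)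
Lemma cexp_taylor_geom J (w : C) :
  Cmod (Cexp w - cexp_poly J w) <= (/ 2) ^ J * exp (3 * Cmod w).
Proof.
  eapply Rle_trans; [apply cexp_taylor|].
  replace (3 * Cmod w) with (2 * Cmod w + Cmod w) by ring. rewrite exp_plus.
  rewrite <- Rmult_assoc. apply Rmult_le_compat_r; [left; apply exp_pos|].
  pose proof (Cmod_ge_0 w) as Hw.
  pose proof (pow_le_fact_exp (2 * Cmod w) J ltac:(lra)) as H.
  rewrite Rpow_mult_distr in H.
  replace (Cmod w ^ J / INR (fact J)) with ((/ 2) ^ J * (2 ^ J * Cmod w ^ J / INR (fact J))).
  - apply Rmult_le_compat_l; [apply pow_le; lra | exact H].
  - rewrite pow_inv. field. split; [apply INR_fact_neq_0 | apply pow_nonzero; lra].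
Qed.

Lemma Cmod_1_plus_ge (w : C) r : Cmod w <= / 2 -> 0 <= r <= 1 -> / 2 <= Cmod (1 + r * w).
Proof.
  intros Hw Hr. pose proof (Cmod_triangle_rev 1 (- (r * w))) as H.
  rewrite Cmod_opp, Cmod_1, Cmod_scalR in H by lra.
  replace (1 - - (r * w))%C with (1 + r * w)%C in H by ring.
  pose proof (Cmod_ge_0 w). nra.
Qed.

Lemma slit_1_plus (w : C) r : Cmod w <= / 2 -> 0 <= r <= 1 -> slit_plane (1 + r * w).
Proof.
  intros Hw Hr. left. rewrite re_plus, re_RtoC, re_scal_l.
  pose proof (re_le_Cmod w) as H. apply Rabs_le_between in H. nra.
Qed.

Lemma Clog_1 : Clog 1 = 0.
Proof. rewrite Clog_RtoC by lra. now rewrite ln_1. Qed.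

Lemma Cmod_div_1_plus (a w : C) r M :
  Cmod w <= / 2 -> 0 <= r <= 1 -> Cmod a <= M -> Cmod (a / (1 + r * w)) <= 2 * M.
Proof.
  intros Hw Hr Ha. pose proof (Cmod_1_plus_ge w r Hw Hr) as H.
  rewrite Cmod_div by (apply Cmod_gt_0; lra).
  apply Rle_div_l; [lra|]. pose proof (Cmod_ge_0 a). nra.
Qed.

(** The derivative of the remainder along [r w] is [- r w ^ 2 / (1 + r w)], whose denominator
    has modulus at least [1 / 2]. *)
Lemma Clog_taylor2 (w : C) : Cmod w <= / 2 -> Cmod (Clog (1 + w) - w) <= 2 * Cmod w ^ 2.
Proof.
  intros Hw. pose proof (Cmod_ge_0 w).
  set (F := fun r : R => (Clog (1 + r * w) - r * w)%C).
  set (f := fun r : R => (- r * w ^ 2 / (1 + r * w))%C).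
  assert (N : forall r, 0 <= r <= 1 -> (1 + r * w <> 0)%C)
    by (intros; now apply slit_neq_0, slit_1_plus).
  replace (Clog (1 + w) - w)%C with (F 1 - F 0)%C.
  2:{ unfold F. replace (1 + 0 * w)%C with (RtoC 1) by ring.
      replace (1 + 1 * w)%C with (1 + w)%C by ring. rewrite Clog_1. ring. }
  replace (2 * Cmod w ^ 2) with ((1 - 0) * (2 * Cmod w ^ 2)) by ring.
  apply (Cderiv_MVT F f); [lra| | |].
  - intros r Hr. unfold F, f. eapply Cderiv_val; [cder; now apply slit_1_plus|].
    cbv beta. field. now apply N.
  - intros r Hr. unfold f. ccont. now apply N.
  - intros r Hr. unfold f. apply Cmod_div_1_plus; try lra.
    rewrite Cmod_mult, Cmod_opp, Cmod_Rpos, Cmod_pow by lra.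
    pose proof (pow2_ge_0 (Cmod w)). nra.
Qed.

Lemma Clog_taylor3 (w : C) :
  Cmod w <= / 2 -> Cmod (Clog (1 + w) - w + w ^ 2 / 2) <= 2 * Cmod w ^ 3.
Proof.
  intros Hw. pose proof (Cmod_ge_0 w).
  set (F := fun r : R => (Clog (1 + r * w) - r * w + r * r * w ^ 2 / 2)%C).
  set (f := fun r : R => (r * r * w ^ 3 / (1 + r * w))%C).
  assert (N : forall r, 0 <= r <= 1 -> (1 + r * w <> 0)%C)
    by (intros; now apply slit_neq_0, slit_1_plus).
  replace (Clog (1 + w) - w + w ^ 2 / 2)%C with (F 1 - F 0)%C.
  2:{ unfold F. replace (1 + 0 * w)%C with (RtoC 1) by ring.
      replace (1 + 1 * w)%C with (1 + w)%C by ring. rewrite Clog_1. field. }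
  replace (2 * Cmod w ^ 3) with ((1 - 0) * (2 * Cmod w ^ 3)) by ring.
  apply (Cderiv_MVT F f); [lra| | |].
  - intros r Hr. unfold F, f. eapply Cderiv_val; [cder; now apply slit_1_plus|].
    cbv beta. field. now apply N.
  - intros r Hr. unfold f. ccont. now apply N.
  - intros r Hr. unfold f. apply Cmod_div_1_plus; try lra.
    assert (0 <= r * r <= 1) by nra.
    rewrite Cmod_mult, <- RtoC_mult, Cmod_Rpos, Cmod_pow by lra.
    pose proof (pow_le (Cmod w) 3 H). nra.
Qed.

(** * Two convergent series *)

(** The partial sums increase and stay below [t 0]. *)
Lemma ex_series_telescope (a t : nat -> R) :
  (forall k, 0 <= a k <= t k - t (S k)) -> (forall k, 0 <= t k) -> ex_series a.
Proof.
  intros H Ht.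
  assert (B : forall n, rsum a n <= t 0%nat - t n).
  { induction n; simpl; [lra|]. specialize (H n). lra. }
  destruct (ex_finite_lim_seq_incr (rsum a) (t 0%nat)) as [l Hl].
  - intros n. simpl. specialize (H n). lra.
  - intros n. specialize (B n). specialize (Ht n). lra.
  - exists l. now apply is_series_rsum.
Qed.

Lemma INR_S_pos n : 0 < INR (S n).
Proof. apply lt_0_INR. lia. Qed.

Lemma ex_series_inv_32 : ex_series (fun k => / (INR (S k) * sqrt (INR (S k)))).
Proof.
  apply ex_series_incr_1.
  (* [2 / sqrt x] has differences comparable to [/ (x sqrt x)] *)
  apply ex_series_telescope with (t := fun k => 2 / sqrt (INR (S k))).
  2:{ intros k. apply Rle_mult_inv_pos; [lra|]. apply sqrt_lt_R0, INR_S_pos. }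
  intros k. pose proof (INR_S_pos k) as H1. pose proof (INR_S_pos (S k)) as H2.
  set (x := sqrt (INR (S (S k)))). set (y := sqrt (INR (S k))).
  assert (Hx : x * x = INR (S (S k))) by (apply sqrt_sqrt; lra).
  assert (Hy : y * y = INR (S k)) by (apply sqrt_sqrt; lra).
  assert (0 < x) by now apply sqrt_lt_R0. assert (0 < y) by now apply sqrt_lt_R0.
  rewrite S_INR in Hx. rewrite (S_INR (S k)).
  rewrite <- Hy in *. split.
  - left. apply Rinv_0_lt_compat. nra.
  - replace (y * y + 1) with (x * x) by lra.
    assert (y < x) by nra.
    replace (2 / y - 2 / x) with (2 / (x * y * (x + y))).
    + apply Rmult_le_reg_r with (x * x * x); [nra|]. rewrite Rinv_l by nra.
      apply Rmult_le_reg_r with (x * y * (x + y)); [apply Rmult_lt_0_compat; nra|].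
      replace (2 / (x * y * (x + y)) * (x * x * x) * (x * y * (x + y))) with (2 * (x * x * x))
        by (field; repeat split; nra).
      assert (x * y * (x + y) <= x * x * (x + x)) by (apply Rmult_le_compat; nra). lra.
    + replace (2 / (x * y * (x + y))) with (2 * 1 / (x * y * (x + y))) by (f_equal; ring).
      replace 1 with (x * x - y * y) at 1 by lra. field. repeat split; nra.
Qed.

Lemma ex_series_inv_sq : ex_series (fun k => / INR (S k) ^ 2).
Proof.
  apply (@ex_series_le R_AbsRing R_CompleteNormedModule _
    (fun k => / (INR (S k) * sqrt (INR (S k))))); [|apply ex_series_inv_32].
  intros k. change (norm (/ INR (S k) ^ 2)) with (Rabs (/ INR (S k) ^ 2)).
  pose proof (INR_S_pos k) as H. assert (1 <= INR (S k)) by (change 1 with (INR 1); apply le_INR; lia).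
  rewrite Rabs_pos_eq by (left; apply Rinv_0_lt_compat, pow_lt; lra).
  apply Rinv_le_contravar.
  - apply Rmult_lt_0_compat; auto. now apply sqrt_lt_R0.
  - replace (INR (S k) ^ 2) with (INR (S k) * INR (S k)) by ring. apply Rmult_le_compat_l; [lra|].
    pose proof (sqrt_sqrt (INR (S k)) (Rlt_le _ _ H)). pose proof (sqrt_lt_R0 _ H).
    generalize dependent (sqrt (INR (S k))). generalize dependent (INR (S k)).
    intros x Hx1 Hx2 s Hs1 Hs2. nra.
Qed.

(** * Differentiation under the integral sign *)

(** The hypothesis is an explicit form of differentiability that survives integration over a
    parameter. *)
Lemma Cderiv_quadratic (G : R -> C) (s : R) (l : C) (K : R) :
  (forall h, Rabs h <= 1 -> Cmod (G (s + h) - G s - h * l) <= K * h ^ 2) -> Cderiv G s l.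
Proof.
  intros H.
  assert (HK : 0 <= K).
  { specialize (H 1). rewrite Rabs_R1 in H. specialize (H (Rle_refl 1)).
    pose proof (Cmod_ge_0 (G (s + 1) - G s - 1 * l)). lra. }
  assert (Gen : forall p : C -> R, (forall a b, p (a - b)%C = p a - p b) ->
    (forall (h : R) a, p (h * a)%C = h * p a) -> (forall a, Rabs (p a) <= Cmod a) ->
    is_derive (fun x => p (G x)) s (p l)).
  { intros p P1 P2 P3. apply is_derive_Reals. intros eps Heps.
    assert (Hd : 0 < Rmin 1 (eps / (K + 1))) by (apply Rmin_pos; [lra | apply Rdiv_lt_0_compat; lra]).
    exists (mkposreal _ Hd). simpl. intros h Hh Hh'.
    assert (Hh1 : Rabs h <= 1) by (pose proof (Rmin_l 1 (eps / (K + 1))); lra).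
    assert (Hh2 : Rabs h < eps / (K + 1)) by (pose proof (Rmin_r 1 (eps / (K + 1))); lra).
    specialize (H h Hh1). pose proof (Rabs_pos_lt h Hh) as Hp.
    replace ((p (G (s + h)) - p (G s)) / h - p l)
      with ((p (G (s + h)%R - G s - h * l)%C) / h) by (rewrite !P1, P2; field; exact Hh).
    unfold Rdiv. rewrite Rabs_mult, Rabs_inv.
    apply Rle_lt_trans with (K * h ^ 2 * / Rabs h).
    - apply Rmult_le_compat_r; [left; now apply Rinv_0_lt_compat|].
      eapply Rle_trans; [apply P3 | exact H].
    - rewrite <- (pow2_abs h). replace (K * Rabs h ^ 2 * / Rabs h) with (K * Rabs h) by (field; lra).
      apply Rle_lt_trans with ((K + 1) * Rabs h); [nra|].
      apply (Rmult_lt_compat_l (K + 1)) in Hh2; [|lra].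
      replace ((K + 1) * (eps / (K + 1))) with eps in Hh2 by (field; lra). exact Hh2. }
  split; apply Gen.
  - apply re_minus.
  - apply re_scal_l.
  - apply re_le_Cmod.
  - apply im_minus.
  - apply im_scal_l.
  - apply im_le_Cmod.
Qed.

Lemma Cderiv_MVT_abs (F f : R -> C) M a b :
  (forall t, Rmin a b <= t <= Rmax a b -> Cderiv F t (f t)) ->
  (forall t, Rmin a b <= t <= Rmax a b -> Ccont f t) ->
  (forall t, Rmin a b <= t <= Rmax a b -> Cmod (f t) <= M) ->
  Cmod (F b - F a) <= Rabs (b - a) * M.
Proof.
  intros H1 H2 H3. destruct (Rle_dec a b) as [L|L].
  - rewrite Rmin_left, Rmax_right in * by lra. rewrite Rabs_pos_eq by lra.
    apply (Cderiv_MVT F f); auto. intros; apply H3; lra.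
  - rewrite Rmin_right, Rmax_left in * by lra. rewrite Rabs_minus_sym, Rabs_pos_eq by lra.
    rewrite Cmod_minus_sym. apply (Cderiv_MVT F f); auto; try lra. intros; apply H3; lra.
Qed.

(** The mean value inequality applied to [f], then to [W]. *)
Lemma Ctaylor_quadratic (W f f2 : R -> C) (s h K : R) :
  (forall r, Rabs (r - s) <= Rabs h -> Cderiv W r (f r)) ->
  (forall r, Rabs (r - s) <= Rabs h -> Cderiv f r (f2 r)) ->
  (forall r, Rabs (r - s) <= Rabs h -> Ccont f2 r) ->
  (forall r, Rabs (r - s) <= Rabs h -> Cmod (f2 r) <= K) ->
  Cmod (W (s + h) - W s - h * f s) <= K * h ^ 2.
Proof.
  intros H1 H2 H3 H4.
  assert (Hin : forall t r, Rabs (t - s) <= Rabs h -> Rmin s t <= r <= Rmax s t -> Rabs (r - s) <= Rabs h).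
  { intros t r Ht Hr. revert Ht Hr. unfold Rmin, Rmax. destruct (Rle_dec s t);
    unfold Rabs; destruct (Rcase_abs (t - s)), (Rcase_abs (r - s)), (Rcase_abs h); lra. }
  assert (HK : 0 <= K).
  { eapply Rle_trans; [apply Cmod_ge_0 | apply (H4 s)]. rewrite Rminus_diag, Rabs_R0. apply Rabs_pos. }
  set (V := fun r : R => (W r - r * f s)%C).
  replace (W (s + h)%R - W s - h * f s)%C with (V (s + h)%R - V s)%C
    by (unfold V; rewrite RtoC_plus; ring).
  assert (Hh : Rabs (s + h - s) <= Rabs h) by (replace (s + h - s) with h by ring; lra).
  replace (K * h ^ 2) with (Rabs (s + h - s) * (Rabs h * K)).
  2:{ replace (s + h - s) with h by ring. rewrite <- (pow2_abs h). ring. }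
  apply (Cderiv_MVT_abs V (fun r => f r - f s)%C).
  - intros t Ht. apply Hin in Ht; auto. unfold V. eapply Cderiv_val.
    + apply Cderiv_minus; [now apply H1 | cder].
    + cbv beta. ring.
  - intros t Ht. apply Hin in Ht; auto. apply Ccont_minus; [|apply Ccont_const].
    eapply Cderiv_Ccont, H2; auto.
  - intros t Ht. apply Hin in Ht; auto.
    apply Rle_trans with (Rabs (t - s) * K).
    + apply (Cderiv_MVT_abs f f2).
      * intros r Hr. apply H2. eapply Hin; eauto.
      * intros r Hr. apply H3. eapply Hin; eauto.
      * intros r Hr. apply H4. eapply Hin; eauto.
    + apply Rmult_le_compat_r; auto.
Qed.

(** A bound on the second derivative that is uniform in [u] makes the quadratic error of the
    difference quotient uniform, so that it can be integrated. *)
Lemma Cderiv_CInt_param (W f f2 : R -> R -> C) (s K : R) :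
  (forall u r, 0 <= u <= 1 -> Rabs (r - s) <= 1 ->
     Cderiv (W u) r (f u r) /\ Cderiv (f u) r (f2 u r) /\ Ccont (f2 u) r /\ Cmod (f2 u r) <= K) ->
  (forall u r, 0 <= u <= 1 -> Ccont (fun v => W v r) u) ->
  (forall u, 0 <= u <= 1 -> Ccont (fun v => f v s) u) ->
  Cderiv (fun r => CInt (fun u => W u r) 0 1) s (CInt (fun u => f u s) 0 1).
Proof.
  intros H1 H2 H3.
  assert (EW : forall r, Cexint (fun u => W u r) 0 1).
  { intros r. apply Cexint_cont. rewrite Rmin_left, Rmax_right by lra. intros; now apply H2. }
  assert (Ef : Cexint (fun u => f u s) 0 1).
  { apply Cexint_cont. rewrite Rmin_left, Rmax_right by lra. intros; now apply H3. }
  apply (Cderiv_quadratic _ _ _ K). intros h Hh.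
  rewrite <- CInt_scal, <- CInt_minus, <- CInt_minus by auto using Cexint_scal, Cexint_minus.
  replace (K * h ^ 2) with ((1 - 0) * (K * h ^ 2)) by ring.
  apply CInt_norm_le_const; [lra| |].
  - auto using Cexint_scal, Cexint_minus.
  - intros u Hu. apply Ctaylor_quadratic with (f2 := f2 u); intros r Hr; apply H1; lra.
Qed.

(** * The Euler-Maclaurin error of [w log w] *)

(** The Bernoulli polynomial of degree 3. It vanishes at both ends of [[0, 1]], whence the first
    derivative alone appears in the correction of the trapezoidal rule below. *)
Definition B3 (u : R) : R := u ^ 3 - 3 / 2 * u ^ 2 + u / 2.

Lemma B3_C (u : R) : RtoC (B3 u) = (u ^ 3 - 3 / 2 * u ^ 2 + u / 2)%C.
Proof.
  unfold B3. now rewrite RtoC_plus, RtoC_minus, RtoC_mult, !RtoC_div, !RtoC_pow by lra.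
Qed.

Lemma B3_bound u : 0 <= u <= 1 -> Rabs (B3 u) <= 1.
Proof. intros H. unfold B3. apply Rabs_le. split; nra. Qed.

Ltac cnum := cbn [INR Cpow]; rewrite ?RtoC_plus.

Lemma Cderiv_B3 u : Cderiv (fun x => RtoC (B3 x)) u (3 * u ^ 2 - 3 * u + 1 / 2)%C.
Proof.
  eapply Cderiv_ext; [intros x; symmetry; apply B3_C|].
  eapply Cderiv_val; [cder|]. cbv beta. cnum. field.
Qed.

Definition wlogw (w : C) : C := (w * Clog w)%C.

Definition wlogw_int (w : C) : C := (w ^ 2 / 2 * Clog w - w ^ 2 / 4)%C.

(** The error of the corrected trapezoidal rule for [wlogw] on the segment from [z] to [z + 1];
    [wlogw_int] is a primitive of [wlogw]. *)
Definition em_delta (z : C) : C :=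
  (wlogw_int (z + 1) - wlogw_int z - (wlogw z + wlogw (z + 1)) / 2 + (Clog (z + 1) - Clog z) / 12)%C.

Lemma slit_shift (z : C) (u : R) : slit_plane z -> 0 <= u -> slit_plane (z + u).
Proof.
  intros [H|H] Hu; [left | right].
  - rewrite re_plus, re_RtoC. lra.
  - rewrite im_plus, im_RtoC. lra.
Qed.

(** The Euler-Maclaurin formula on one segment; [- / w ^ 2] is the third derivative of [w log
    w]. *)
Lemma em_delta_int z :
  slit_plane z -> em_delta z = CInt (fun u => B3 u / (6 * (z + u) ^ 2))%C 0 1.
Proof.
  intros Hz.
  assert (Hs : forall u : R, 0 <= u -> slit_plane (z + u)) by (intros; now apply slit_shift).
  assert (Hn : forall u : R, 0 <= u -> (z + u)%C <> 0) by (intros; now apply slit_neq_0, Hs).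
  (* repeated integration by parts, differentiating [B3] down to a constant *)
  set (A := fun u : R => (- (1 / 6) * ((u ^ 3 - 3 / 2 * u ^ 2 + u / 2) / (z + u)
    - (3 * u ^ 2 - 3 * u + 1 / 2) * (Clog (z + u) + 1) + (6 * u - 3) * wlogw (z + u)
    - 6 * wlogw_int (z + u)))%C).
  rewrite (CInt_FTC A).
  - unfold A, em_delta, wlogw. replace (z + 0)%C with z by ring.
    specialize (Hn 0 (Rle_refl 0)) as H0. specialize (Hn 1 Rle_0_1) as H1.
    replace (z + 0)%C with z in H0 by ring. field. now split.
  - lra.
  - intros u [Hu _]. unfold A, wlogw, wlogw_int. eapply Cderiv_val.
    + cder; auto.
    + cbv beta. rewrite B3_C. cnum. field. now apply Hn.
  - intros u [Hu _].
    apply (Ccont_ext (fun v => B3 v * / (6 * (z + v) ^ 2))%C); [reflexivity|].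
    apply Ccont_mult; [eapply Cderiv_Ccont, Cderiv_B3|].
    ccont. apply Cmult_neq_0; [apply RtoC_neq; lra | now apply Cpow_nz, Hn].
Qed.

(** * Laplace representation of the Euler-Maclaurin error *)

Definition B3_laplace (t : C) : C := CInt (fun u => B3 u * Cexp (- (u * t)))%C 0 1.

Lemma is_lim_seq_inv_INR (K : R) : is_lim_seq (fun n => K / INR n) 0.
Proof.
  replace (Finite 0) with (Rbar_mult K 0) by (simpl; f_equal; ring).
  apply is_lim_seq_scal_l.
  replace (Finite 0) with (Rbar_inv p_infty) by reflexivity.
  apply is_lim_seq_inv; [apply is_lim_seq_INR | discriminate].
Qed.

Lemma exp_decay (c x : R) : 0 < c -> 0 < x -> exp (- (c * x)) <= 2 / (c * x) ^ 2.
Proof.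
  intros Hc Hx. assert (H : 0 < c * x) by now apply Rmult_lt_0_compat.
  pose proof (pow_le_fact_exp (c * x) 2 (Rlt_le _ _ H)) as K.
  change (INR (fact 2)) with (1 + 1) in K. rewrite exp_Ropp.
  assert (H2 : 0 < (c * x) ^ 2) by now apply pow_lt.
  replace (2 / (c * x) ^ 2) with (/ ((c * x) ^ 2 / (1 + 1))) by (field; nra).
  apply Rinv_le_contravar; lra.
Qed.

Lemma Ccont_B3_laplace (m : C) (s : R) : Ccont (fun r => B3_laplace (m * r)) s.
Proof.
  set (W := fun u s : R => (B3 u * Cexp (- (u * (m * s))))%C).
  set (f := fun u s : R => (B3 u * (- (u * m)) * Cexp (- (u * (m * s))))%C).
  set (f2 := fun u s : R => (B3 u * (u * u * m ^ 2) * Cexp (- (u * (m * s))))%C).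
  eapply Cderiv_Ccont.
  apply (Cderiv_CInt_param W f f2 s (1 * Cmod (m ^ 2) * exp (Cmod m * (Rabs s + 1)))).
  - intros u r Hu Hr. split; [|split; [|split]].
    + eapply Cderiv_val; [unfold W; cder|]. unfold f. cbv beta. ring.
    + eapply Cderiv_val; [unfold f; cder|]. unfold f2. cbv beta. ring.
    + unfold f2. eapply Cderiv_Ccont. cder.
    + unfold f2. rewrite 2!Cmod_mult. rewrite Cmod_Cexp, (Cmod_R (B3 u)).
      pose proof (Cmod_ge_0 m). pose proof (Rabs_pos (B3 u)). pose proof (B3_bound u Hu).
      apply Rmult_le_compat; [| left; apply exp_pos | |].
      * apply Rmult_le_pos; auto using Cmod_ge_0.
      * apply Rmult_le_compat; auto using Cmod_ge_0.
        assert (Huu : 0 <= u * u <= 1) by (clear - Hu; nra).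
        rewrite <- RtoC_mult, Cmod_scalR by lra. pose proof (Cmod_ge_0 (m ^ 2)).
        rewrite <- (Rmult_1_l (Cmod (m ^ 2))) at 2. apply Rmult_le_compat_r; lra.
      * apply exp_mono. eapply Rle_trans; [apply Re_le_Cmod|].
        rewrite Cmod_opp, !Cmod_mult, !Cmod_R, (Rabs_pos_eq u) by lra.
        assert (Rabs r <= Rabs s + 1).
        { replace r with (s + (r - s)) by ring. eapply Rle_trans; [apply Rabs_triang|]. lra. }
        pose proof (Rabs_pos r).
        apply Rle_trans with (1 * (Cmod m * Rabs r)).
        -- apply Rmult_le_compat_r; [now apply Rmult_le_pos | lra].
        -- rewrite Rmult_1_l. now apply Rmult_le_compat_l.
  - intros u r Hu. unfold W. apply Ccont_mult; [eapply Cderiv_Ccont, Cderiv_B3 | ccont].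
  - intros u Hu. unfold f. apply Ccont_mult; [|ccont].
    apply Ccont_mult; [eapply Cderiv_Ccont, Cderiv_B3 | ccont].
Qed.

(** The integrand that arises from [em_delta_int] on writing [/ w ^ 2] as the integral over [s
    >= 0] of [m ^ 2 s exp (- w m s)]. The direction [m] of the ray is free. *)
Definition lap_ker (m z : C) (s : R) : C :=
  (m * m * s / 6 * B3_laplace (m * s) * Cexp (- (z * m * s)))%C.

Lemma Re_mult_shift (z m : C) (u : R) :
  0 <= Re m -> 0 <= u -> Re (z * m) <= Re ((z + u) * m).
Proof.
  intros Hm Hu. replace ((z + u) * m)%C with (z * m + u * m)%C by ring.
  rewrite re_plus, re_scal_l. nra.
Qed.

(** The last factor comes from integrating [w ^ 2 m ^ 2 s exp (- w m s)] up to [T], with [w = z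
    + u]. The order of integration is exchanged by differentiating in [T] under the integral
    over [u]. *)
Lemma lap_ker_primitive (m z : C) (T : R) :
  0 <= T -> slit_plane z ->
  CInt (lap_ker m z) 0 T =
  CInt (fun u => B3 u / (6 * (z + u) ^ 2) *
     (1 - (1 + (z + u) * m * T) * Cexp (- ((z + u) * m * T))))%C 0 1.
Proof.
  intros HT Hz.
  assert (Hn : forall u : R, 0 <= u -> (z + u)%C <> 0) by (intros; now apply slit_neq_0, slit_shift).
  set (W := fun u s : R => (B3 u / (6 * (z + u) ^ 2) *
     (1 - (1 + (z + u) * m * s) * Cexp (- ((z + u) * m * s))))%C).
  set (f := fun u s : R => (B3 u * (m * m * s / 6) * Cexp (- ((z + u) * m * s)))%C).
  set (f2 := fun u s : R => (B3 u * (m * m / 6) * (1 - (z + u) * m * s) * Cexp (- ((z + u) * m * s)))%C).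
  assert (DW : forall s, Cderiv (fun r => CInt (fun u => W u r) 0 1) s (lap_ker m z s)).
  { intros s.
    assert (E : lap_ker m z s = CInt (fun u => f u s) 0 1).
    { unfold lap_ker, B3_laplace, f.
      replace (m * m * s / 6 * CInt (fun u => B3 u * Cexp (- (u * (m * s)))) 0 1 * Cexp (- (z * m * s)))%C
        with ((m * m * s / 6 * Cexp (- (z * m * s))) * CInt (fun u => B3 u * Cexp (- (u * (m * s)))) 0 1)%C by ring.
      rewrite <- CInt_scal.
      - apply CInt_ext; [lra|]. intros u _.
        replace (- ((z + u) * m * s))%C with (- (z * m * s) + - (u * (m * s)))%C by ring.
        rewrite Cexp_plus. ring.
      - apply Cexint_cont. intros u _. apply Ccont_mult; [eapply Cderiv_Ccont, Cderiv_B3 | ccont]. }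
    rewrite E.
    (* a bound for all the exponents at once *)
    set (L := (Cmod z + 1) * Cmod m * (Rabs s + 1)).
    assert (Lb : forall u r, 0 <= u <= 1 -> Rabs (r - s) <= 1 -> Cmod ((z + u) * m * r) <= L).
    { intros u r Hu Hr. rewrite !Cmod_mult, Cmod_R. unfold L.
      apply Rmult_le_compat; [|apply Rabs_pos| |].
      - apply Rmult_le_pos; apply Cmod_ge_0.
      - apply Rmult_le_compat_r; [apply Cmod_ge_0|].
        eapply Rle_trans; [apply Cmod_triangle|]. rewrite Cmod_Rpos; lra.
      - replace r with (s + (r - s)) by ring. eapply Rle_trans; [apply Rabs_triang|]. lra. }
    apply (Cderiv_CInt_param W f f2 s (1 * Cmod (m * m / 6) * (1 + L) * exp L)).
    - intros u r Hu Hr. specialize (Hn u (proj1 Hu)). specialize (Lb u r Hu Hr).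
      split; [|split; [|split]].
      + eapply Cderiv_val; [unfold W; cder|]. unfold f. cbv beta. field. exact Hn.
      + eapply Cderiv_val; [unfold f; cder|]. unfold f2. cbv beta. field.
      + unfold f2. eapply Cderiv_Ccont. cder.
      + unfold f2. rewrite 3!Cmod_mult. rewrite Cmod_Cexp, (Cmod_R (B3 u)).
        pose proof (Cmod_ge_0 (m * m / 6)). pose proof (Rabs_pos (B3 u)).
        pose proof (B3_bound u Hu).
        pose proof (Cmod_ge_0 (1 - (z + u) * m * r)).
        assert (Cmod (1 - (z + u) * m * r) <= 1 + L).
        { eapply Rle_trans; [apply Cmod_triangle'|]. rewrite Cmod_1. lra. }
        apply Rmult_le_compat; [| left; apply exp_pos | |].
        * repeat apply Rmult_le_pos; auto.
        * apply Rmult_le_compat; auto; [now apply Rmult_le_pos|].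
          apply Rmult_le_compat_r; auto.
        * apply exp_mono. eapply Rle_trans; [apply Re_le_Cmod|]. now rewrite Cmod_opp.
    - intros u r Hu. unfold W. specialize (Hn u (proj1 Hu)).
      apply Ccont_mult.
      + apply (Ccont_ext (fun v => B3 v * / (6 * (z + v) ^ 2))%C); [reflexivity|].
        apply Ccont_mult; [eapply Cderiv_Ccont, Cderiv_B3|].
        ccont. apply Cmult_neq_0; [apply RtoC_neq; lra | now apply Cpow_nz].
      + ccont.
    - intros u Hu. unfold f. apply Ccont_mult; [|ccont].
      apply Ccont_mult; [eapply Cderiv_Ccont, Cderiv_B3 | ccont]. }
  rewrite (CInt_FTC (fun r => CInt (fun u => W u r) 0 1)); auto.
  - assert (E0 : CInt (fun u => W u 0) 0 1 = 0).
    { rewrite (CInt_ext _ (fun _ => RtoC 0)); [|lra|].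
      - rewrite (CInt_RtoC (fun _ => 0)).
        f_equal. rewrite (@RInt_const R_CompleteNormedModule). apply Rmult_0_r.
      - intros u Hu. unfold W. replace (- ((z + u) * m * 0))%C with (RtoC 0) by ring.
        rewrite Cexp_0. ring. }
    rewrite E0. unfold W. ring.
  - intros s _. unfold lap_ker. apply Ccont_mult; [|ccont].
    apply Ccont_mult; [ccont | apply Ccont_B3_laplace].
Qed.

(** As [Re m >= 0], the exponentials decay at least like [exp (- Re (z m) s)] for all translates
    [z + u] at once. *)
Lemma lap_ker_limit (m z : C) :
  slit_plane z -> 0 <= Re m -> 0 < Re (z * m) ->
  Clim (fun n => CInt (lap_ker m z) 0 (INR n)) (em_delta z).
Proof.
  intros Hz Hm Hc. set (c := Re (z * m)) in *.
  set (K := (Cmod z + 1) * Cmod m).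
  assert (HK : 0 <= K) by (apply Rmult_le_pos; [pose proof (Cmod_ge_0 z); lra | apply Cmod_ge_0]).
  assert (Hn : forall u : R, 0 <= u -> (z + u)%C <> 0) by (intros; now apply slit_neq_0, slit_shift).
  assert (Hm0 : 0 < Cmod m).
  { apply Cmod_gt_0. intros E. unfold c in Hc. rewrite E, Cmult_0_r in Hc. simpl in Hc. lra. }
  (* all translates [z + u] stay at distance [d] from the origin *)
  set (d := c / Cmod m). assert (Hd : 0 < d) by now apply Rdiv_lt_0_compat.
  assert (Hzu : forall u, 0 <= u -> d <= Cmod (z + u)).
  { intros u Hu. unfold d. apply Rle_div_l; [exact Hm0|]. rewrite <- Cmod_mult.
    eapply Rle_trans; [apply (Re_mult_shift z m u Hm Hu) | apply Re_le_Cmod]. }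
  apply (Clim_squeeze _ _ (fun n => (/ d ^ 2 * ((1 + K) * (2 / c ^ 2))) / INR n)); [|apply is_lim_seq_inv_INR].
  exists 1%nat. intros n Hn1.
  assert (Hn' : 1 <= INR n) by (change 1 with (INR 1); now apply le_INR).
  assert (Ca : forall u, 0 <= u <= 1 -> Ccont (fun v => B3 v / (6 * (z + v) ^ 2))%C u).
  { intros u [Hu _].
    apply (Ccont_ext (fun v => B3 v * / (6 * (z + v) ^ 2))%C); [reflexivity|].
    apply Ccont_mult; [eapply Cderiv_Ccont, Cderiv_B3|].
    ccont. apply Cmult_neq_0; [apply RtoC_neq; lra | now apply Cpow_nz, Hn]. }
  rewrite lap_ker_primitive by (auto; lra). rewrite em_delta_int by exact Hz.
  rewrite <- CInt_minus.
  2:{ apply Cexint_cont. rewrite Rmin_left, Rmax_right by lra. intros u Hu.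
      apply Ccont_mult; [now apply Ca | ccont]. }
  2:{ apply Cexint_cont. rewrite Rmin_left, Rmax_right by lra. exact Ca. }
  replace (/ d ^ 2 * ((1 + K) * (2 / c ^ 2)) / INR n) with
    ((1 - 0) * (/ d ^ 2 * ((1 + K) * (2 / c ^ 2) * / INR n))) by (unfold Rdiv; ring).
  apply CInt_norm_le_const; [lra| |].
  - apply Cexint_cont. rewrite Rmin_left, Rmax_right by lra. intros u Hu.
    apply Ccont_minus; [apply Ccont_mult; [now apply Ca | ccont] | now apply Ca].
  - intros u Hu.
    set (w := ((z + u) * m)%C).
    replace (B3 u / (6 * (z + u) ^ 2) * (1 - (1 + w * INR n) * Cexp (- (w * INR n))) - B3 u / (6 * (z + u) ^ 2))%C
      with (- (B3 u / (6 * (z + u) ^ 2) * ((1 + w * INR n) * Cexp (- (w * INR n)))))%C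
      by (field; apply Hn; lra).
    rewrite Cmod_opp, !Cmod_mult, Cmod_Cexp.
    specialize (Hzu u (Rlt_le _ _ (proj1 Hu))).
    apply Rmult_le_compat.
    + apply Cmod_ge_0.
    + apply Rmult_le_pos; [apply Cmod_ge_0 | left; apply exp_pos].
    + assert (N6 : (6 * (z + u) ^ 2)%C <> 0).
      { apply Cmult_neq_0; [apply RtoC_neq; lra | apply Cpow_nz, Hn; lra]. }
      rewrite Cmod_div, Cmod_mult, Cmod_pow, (Cmod_R (B3 u)), (Cmod_Rpos 6) by (exact N6 || lra).
      pose proof (B3_bound u ltac:(lra)).
      assert (0 < d ^ 2) by now apply pow_lt.
      assert (d ^ 2 <= Cmod (z + u) ^ 2) by (apply pow_incr; lra).
      apply Rle_div_l; [lra|].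
      apply Rle_trans with (/ d ^ 2 * (6 * d ^ 2)); [|apply Rmult_le_compat_l; [left; now apply Rinv_0_lt_compat | lra]].
      replace (/ d ^ 2 * (6 * d ^ 2)) with 6 by (field; lra). lra.
    + assert (A : Cmod (1 + w * INR n) <= (1 + K) * INR n).
      { eapply Rle_trans; [apply Cmod_triangle|]. rewrite Cmod_1, Cmod_mult, Cmod_Rpos by lra.
        assert (Cmod w <= K).
        { unfold w, K. rewrite Cmod_mult. apply Rmult_le_compat_r; [lra|].
          eapply Rle_trans; [apply Cmod_triangle|]. rewrite Cmod_Rpos; lra. }
        nra. }
      assert (B : exp (Re (- (w * INR n))) <= 2 / (c * INR n) ^ 2).
      { eapply Rle_trans; [|apply exp_decay; lra]. apply exp_mono.
        rewrite re_opp, re_scal_r. apply Ropp_le_contravar.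
        apply Rmult_le_compat_r; [lra|]. apply Re_mult_shift; lra. }
      replace ((1 + K) * (2 / c ^ 2) * / INR n) with ((1 + K) * INR n * (2 / (c * INR n) ^ 2))
        by (field; lra).
      apply Rmult_le_compat; auto using Cmod_ge_0. left; apply exp_pos.
Qed.

(** * Partial fractions of the hyperbolic cotangent *)

(** The zeros of [exp (i t) - 1] on the positive axis. The poles of [coth (t / 2)] are [0] and
    these numbers times plus or minus [i]. *)
Definition freq (k : nat) : R := 2 * PI * INR (S k).

Lemma freq_pos k : 0 < freq k.
Proof.
  unfold freq. pose proof PI_RGT_0. pose proof (INR_S_pos k).
  apply Rmult_lt_0_compat; lra.
Qed.

Lemma sin_cos_freq k : sin (freq k) = 0 /\ cos (freq k) = 1.
Proof.
  unfold freq. replace (2 * PI * INR (S k)) with (0 + 2 * INR (S k) * PI) by ring.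
  rewrite sin_period, cos_period. split; [apply sin_0 | apply cos_0].
Qed.

Definition dirichlet (n : nat) (u : R) : R := 1 + rsum (fun k => 2 * cos (freq k * u)) n.

(** The unnormalised kernel, of integral [n] over [[0, 1]]. *)
Definition fejer (n : nat) (u : R) : R := rsum (fun j => dirichlet j u) n.

Lemma dirichlet_sin n u : dirichlet n u * sin (PI * u) = sin ((2 * INR n + 1) * (PI * u)).
Proof.
  induction n as [|n IH].
  - unfold dirichlet; simpl. replace ((2 * 0 + 1) * (PI * u)) with (PI * u) by ring. ring.
  - replace (dirichlet (S n) u) with (dirichlet n u + 2 * cos (freq n * u))
      by (unfold dirichlet; simpl; ring).
    rewrite Rmult_plus_distr_r, IH, S_INR. unfold freq. rewrite S_INR.
    set (x := PI * u).
    replace (2 * PI * (INR n + 1) * u) with (2 * (INR n + 1) * x) by (unfold x; ring).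
    replace ((2 * INR n + 1) * x) with (2 * (INR n + 1) * x - x) by ring.
    replace ((2 * (INR n + 1) + 1) * x) with (2 * (INR n + 1) * x + x) by ring.
    rewrite sin_plus, sin_minus. ring.
Qed.

Lemma fejer_sin n u : fejer n u * (sin (PI * u)) ^ 2 = sin (INR n * (PI * u)) ^ 2.
Proof.
  induction n as [|n IH].
  - unfold fejer; simpl. rewrite !Rmult_0_l, sin_0. ring.
  - replace (fejer (S n) u) with (fejer n u + dirichlet n u) by reflexivity.
    rewrite Rmult_plus_distr_r, IH.
    replace (dirichlet n u * sin (PI * u) ^ 2) with (dirichlet n u * sin (PI * u) * sin (PI * u)) by ring.
    rewrite dirichlet_sin, S_INR. set (x := PI * u).
    replace ((2 * INR n + 1) * x) with (INR n * x + (INR n * x + x)) by ring.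
    replace ((INR n + 1) * x) with (INR n * x + x) by ring.
    rewrite !sin_plus, !cos_plus.
    pose proof (sin2_cos2 (INR n * x)) as H1. pose proof (sin2_cos2 x) as H2. unfold Rsqr in *.
    set (a := sin (INR n * x)) in *. set (b := cos (INR n * x)) in *.
    set (c := sin x) in *. set (d := cos x) in *.
    replace (a ^ 2) with (a ^ 2 * (c * c + d * d)) by (rewrite H2; ring). ring.
Qed.

Lemma sin_PI_ge u : 0 <= u <= 1 -> u * (1 - u) <= sin (PI * u).
Proof.
  (* [x - x ^ 3 / 6] is at least [x / 3] for [x <= 2], and [PI] is at least [3] *)
  assert (K : forall v, 0 <= v <= / 2 -> v <= sin (PI * v)).
  { intros v Hv. pose proof PI_4. pose proof PI2_3_2.
    assert (P : 0 <= PI * v <= 2) by nra.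
    set (x := PI * v) in *.
    destruct (sin_bound x 0) as [H1 _]; [lra | lra |].
    replace (sin_approx x (2 * 0 + 1)) with (x - x ^ 3 / 6) in H1
      by (unfold sin_approx, sin_term; simpl; field).
    assert (v <= x / 3) by (unfold x; nra).
    assert (x * (x * x) <= x * 4) by (apply Rmult_le_compat_l; nra).
    apply Rle_trans with (x / 3); [assumption|]. apply Rle_trans with (x - x ^ 3 / 6); [|exact H1].
    replace (x ^ 3) with (x * (x * x)) by ring. lra. }
  intros Hu. destruct (Rle_dec u (/ 2)) as [L|L].
  - specialize (K u ltac:(lra)). nra.
  - specialize (K (1 - u) ltac:(lra)).
    replace (PI * (1 - u)) with (PI - PI * u) in K by ring. rewrite sin_PI_x in K. nra.
Qed.

Lemma fejer_pos n u : 0 < u < 1 -> 0 <= fejer n u.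
Proof.
  intros Hu. pose proof (fejer_sin n u) as H. pose proof (sin_PI_ge u ltac:(lra)) as Hs.
  pose proof (pow2_ge_0 (sin (INR n * (PI * u)))). rewrite <- H in H0.
  assert (0 < sin (PI * u)) by nra. assert (0 < sin (PI * u) ^ 2) by now apply pow_lt.
  apply Rmult_le_reg_r with (sin (PI * u) ^ 2); lra.
Qed.

Lemma Cderiv_cos (a : R) u :
  Cderiv (fun x => RtoC (cos (a * x))) u (RtoC (- (a * sin (a * u)))).
Proof. apply Cderiv_RtoC. auto_derive; [easy|]. ring. Qed.

Lemma Cderiv_sin (a : R) u :
  Cderiv (fun x => RtoC (sin (a * x))) u (RtoC (a * cos (a * u))).
Proof. apply Cderiv_RtoC. auto_derive; [easy|]. ring. Qed.

(** The left factor on the right is the product of the distances from [t] to [i a] and [- i a],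
    each at least [a |Re t| / |t|], the distance of these points from the line through [0] and
    [t]. *)
Lemma sq_plus_sq_lower (a : R) (t : C) :
  a ^ 2 * Re t ^ 2 <= Cmod (t ^ 2 + a ^ 2) * Cmod t ^ 2.
Proof.
  (* the distance from [b] to the line through [0] and [i t] *)
  assert (Gen : forall b : R, (b * Re t) ^ 2 <= Cmod (b + Ci * t) ^ 2 * Cmod t ^ 2).
  { intros b. rewrite !Cmod2_alt. destruct t as [x y]. unfold Re, Im; simpl.
    pose proof (pow2_ge_0 (b * y - (x ^ 2 + y ^ 2))). nra. }
  pose proof (Gen a) as G1. pose proof (Gen (- a)) as G2.
  apply Rsqr_incr_0_var; [|apply Rmult_le_pos; [apply Cmod_ge_0 | apply pow2_ge_0]].
  unfold Rsqr.
  replace (t ^ 2 + a ^ 2)%C with (- ((a + Ci * t) * (RtoC (- a) + Ci * t)))%C.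
  2:{ destruct t; apply C_eq; simpl; ring. }
  rewrite Cmod_opp, Cmod_mult.
  replace (a ^ 2 * Re t ^ 2 * (a ^ 2 * Re t ^ 2)) with ((a * Re t) ^ 2 * (- a * Re t) ^ 2) by ring.
  replace (Cmod (a + Ci * t) * Cmod ((- a)%R + Ci * t) * Cmod t ^ 2 *
   (Cmod (a + Ci * t) * Cmod ((- a)%R + Ci * t) * Cmod t ^ 2))
   with ((Cmod (a + Ci * t) ^ 2 * Cmod t ^ 2) * (Cmod ((- a)%R + Ci * t) ^ 2 * Cmod t ^ 2)) by ring.
  apply Rmult_le_compat; auto using pow2_ge_0.
Qed.

Lemma sq_plus_sq_neq_0 (a : R) (t : C) : a <> 0 -> Re t <> 0 -> (t ^ 2 + a ^ 2)%C <> 0.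
Proof.
  intros Ha Ht E. pose proof (sq_plus_sq_lower a t) as H. rewrite E, Cmod_0 in H.
  assert (0 < a ^ 2) by now apply pow2_gt_0. assert (0 < Re t ^ 2) by now apply pow2_gt_0. nra.
Qed.

(** Removing the chord from [exp (- u t)] makes its periodic extension Lipschitz, so that the
    Fejer means at the end point of the period converge with an explicit rate. *)
Definition chord_gap (t : C) (u : R) : C := (Cexp (- (u * t)) - 1 - (Cexp (- t) - 1) * u)%C.

Lemma Cderiv_chord_gap t u :
  Cderiv (chord_gap t) u (- t * Cexp (- (u * t)) - (Cexp (- t) - 1))%C.
Proof. unfold chord_gap. eapply Cderiv_val; [cder|]. cbv beta. ring. Qed.

(** The Fourier coefficients of [exp (- u t)] are the partial fractions; those of the linear
    part vanish apart from the mean. *)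
Lemma chord_gap_dirichlet (t : C) n :
  Re t <> 0 ->
  CInt (fun u => chord_gap t u * dirichlet n u)%C 0 1 =
  ((1 - Cexp (- t)) * (1 / t + csum (fun k => 2 * t / (t ^ 2 + freq k ^ 2)) n)
   - (1 + Cexp (- t)) / 2)%C.
Proof.
  intros Ht. assert (Ht0 : t <> 0) by (intros ->; simpl in Ht; lra).
  assert (Cc : forall u, Ccont (chord_gap t) u) by (intros; eapply Cderiv_Ccont, Cderiv_chord_gap).
  assert (Ck : forall a u, Ccont (fun u => RtoC (cos (a * u))) u)
    by (intros; eapply Cderiv_Ccont, Cderiv_cos).
  induction n as [|n IH].
  - rewrite (CInt_ext _ (chord_gap t)); [|lra|].
    2:{ intros u _. replace (dirichlet 0 u) with 1 by (unfold dirichlet; simpl; ring). ring. }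
    set (A := fun u : R => (- Cexp (- (u * t)) / t - u - (Cexp (- t) - 1) * u ^ 2 / 2)%C).
    rewrite (CInt_FTC A); [|lra| |auto].
    + unfold A. replace (- (0 * t))%C with (RtoC 0) by ring. replace (- (1 * t))%C with (- t)%C by ring.
      rewrite Cexp_0. simpl. field. exact Ht0.
    + intros u _. unfold A, chord_gap. eapply Cderiv_val; [cder|]. cbv beta. cnum. field. exact Ht0.
  - rewrite (CInt_ext _ (fun u => chord_gap t u * dirichlet n u + chord_gap t u * (2 * cos (freq n * u))%R)%C);
      [|lra|].
    2:{ intros u _. replace (dirichlet (S n) u) with (dirichlet n u + 2 * cos (freq n * u))
        by (unfold dirichlet; simpl; ring). rewrite RtoC_plus. ring. }
    rewrite CInt_plus, IH.
    + cbn [csum]. set (a := freq n). pose proof (freq_pos n) as Ha. fold a in Ha.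
      pose proof (sq_plus_sq_neq_0 a t ltac:(lra) Ht) as Hq.
      assert (Ha0 : RtoC a <> 0) by (apply RtoC_neq; lra).
      set (A := fun u : R => (2 * (- t * cos (a * u) + a * sin (a * u)) * Cexp (- (u * t)) / (t ^ 2 + a ^ 2)
         - 2 * sin (a * u) / a
         - (Cexp (- t) - 1) * (2 * u * sin (a * u) / a + 2 * cos (a * u) / a ^ 2))%C).
      rewrite (CInt_FTC A); [|lra| |].
      * unfold A. destruct (sin_cos_freq n) as [S1 C1]. fold a in S1, C1.
        rewrite Rmult_1_r, Rmult_0_r, S1, C1, sin_0, cos_0.
        replace (- (0 * t))%C with (RtoC 0) by ring. replace (- (1 * t))%C with (- t)%C by ring.
        rewrite Cexp_0. field. repeat split; auto.
      * intros u _. unfold A, chord_gap. eapply Cderiv_val.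
        -- cder; [apply Cderiv_cos | apply Cderiv_sin | apply Cderiv_sin | apply Cderiv_sin | apply Cderiv_cos].
        -- cbv beta. rewrite RtoC_opp, !RtoC_mult. field. repeat split; auto.
      * intros u _. apply Ccont_mult; [apply Cc|]. apply Ccont_RtoC.
        apply (@ex_derive_continuous R_AbsRing R_NormedModule). auto_derive. easy.
    + apply Cexint_cont. intros u _. apply Ccont_mult; [apply Cc|]. apply Ccont_RtoC.
      unfold dirichlet. apply (@ex_derive_continuous R_AbsRing R_NormedModule).
      clear. induction n as [|n IH]; simpl.
      * auto_derive. easy.
      * apply ex_derive_ext with (f := fun x => (1 + rsum (fun k => 2 * cos (freq k * x)) n) + 2 * cos (freq n * x)).
        { intros; apply Rplus_assoc. }
        apply (@ex_derive_plus R_AbsRing R_NormedModule); [exact IH | auto_derive; easy].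
    + apply Cexint_cont. intros u _. apply Ccont_mult; [apply Cc|]. apply Ccont_RtoC.
      apply (@ex_derive_continuous R_AbsRing R_NormedModule). auto_derive. easy.
Qed.

Lemma RInt_fejer n : is_RInt (fejer n) 0 1 (INR n).
Proof.
  assert (D : forall j, is_RInt (dirichlet j) 0 1 1).
  { intros j. induction j as [|j IH].
    - apply is_RInt_ext with (fun _ => 1); [intros; unfold dirichlet; simpl; ring|].
      replace 1 with (scal (1 - 0) 1) at 2 by (unfold scal; simpl; unfold mult; simpl; ring).
      apply (@is_RInt_const R_NormedModule).
    - apply is_RInt_ext with (fun u => plus (dirichlet j u) (2 * cos (freq j * u))).
      { intros u _. unfold dirichlet, plus; simpl. ring. }
      replace 1 with (plus 1 (2 * sin (freq j * 1) / freq j - 2 * sin (freq j * 0) / freq j)) at 2.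
      2:{ unfold plus; simpl. destruct (sin_cos_freq j) as [S1 _].
          rewrite Rmult_1_r, Rmult_0_r, S1, sin_0. field. pose proof (freq_pos j); lra. }
      apply (@is_RInt_plus R_NormedModule); [exact IH|]. pose proof (freq_pos j).
      apply (is_RInt_derive (fun u => 2 * sin (freq j * u) / freq j)).
      + intros u _. auto_derive; [easy|]. field. lra.
      + intros u _. apply (@ex_derive_continuous R_AbsRing R_NormedModule). auto_derive. easy. }
  induction n as [|n IH].
  - apply is_RInt_ext with (fun _ => 0); [intros; unfold fejer; reflexivity|].
    replace (INR 0) with (scal (1 - 0) 0) by (unfold scal; simpl; unfold mult; simpl; ring).
    apply (@is_RInt_const R_NormedModule).
  - rewrite S_INR. apply is_RInt_ext with (fun u => plus (fejer n u) (dirichlet n u)).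
    { reflexivity. }
    now apply (@is_RInt_plus R_NormedModule).
Qed.

(** A Lipschitz function that vanishes at both ends is dominated by [u (1 - u)], hence by [sin
    (PI u)]. *)
Lemma chord_gap_bound (t : C) :
  exists L, 0 <= L /\ forall u, 0 <= u <= 1 -> Cmod (chord_gap t u) <= L * sin (PI * u).
Proof.
  set (L := Cmod t * exp (Cmod t) + Cmod (Cexp (- t) - 1)).
  assert (HL : 0 <= L).
  { pose proof (Cmod_ge_0 t). pose proof (exp_pos (Cmod t)). pose proof (Cmod_ge_0 (Cexp (- t) - 1)).
    unfold L. nra. }
  assert (Lip : forall a b, 0 <= a <= b -> b <= 1 -> Cmod (chord_gap t b - chord_gap t a) <= (b - a) * L).
  { intros a b Hab Hb.
    apply (Cderiv_MVT (chord_gap t) (fun u => - t * Cexp (- (u * t)) - (Cexp (- t) - 1))%C); [lra| | |].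
    - intros u _. apply Cderiv_chord_gap.
    - intros u _. ccont.
    - intros u Hu. eapply Rle_trans; [apply Cmod_triangle'|]. unfold L.
      apply Rplus_le_compat_r. rewrite Cmod_mult, Cmod_opp, Cmod_Cexp.
      apply Rmult_le_compat_l; [apply Cmod_ge_0|]. apply exp_mono.
      eapply Rle_trans; [apply Re_le_Cmod|]. rewrite Cmod_opp, Cmod_scalR by lra.
      pose proof (Cmod_ge_0 t). nra. }
  assert (G0 : chord_gap t 0 = 0).
  { unfold chord_gap. replace (- (0 * t))%C with (RtoC 0) by ring. rewrite Cexp_0. ring. }
  assert (G1 : chord_gap t 1 = 0).
  { unfold chord_gap. replace (- (1 * t))%C with (- t)%C by ring. ring. }
  exists (2 * L). split; [lra|]. intros u Hu. pose proof (sin_PI_ge u Hu) as Hs.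
  destruct (Rle_dec u (/ 2)) as [C|C].
  - pose proof (Lip 0 u ltac:(lra) ltac:(lra)) as H. rewrite G0 in H.
    replace (chord_gap t u - 0)%C with (chord_gap t u) in H by ring.
    assert (u <= 2 * sin (PI * u)) by nra. nra.
  - pose proof (Lip u 1 ltac:(lra) ltac:(lra)) as H. rewrite G1 in H.
    replace (0 - chord_gap t u)%C with (- chord_gap t u)%C in H by ring. rewrite Cmod_opp in H.
    assert (1 - u <= 2 * sin (PI * u)) by nra. nra.
Qed.

Lemma continuous_fejer n u : continuous (fejer n) u.
Proof.
  assert (D : forall j, continuous (dirichlet j) u).
  { intros j. induction j as [|j IH].
    - apply continuous_ext with (fun _ => 1); [intros; unfold dirichlet; simpl; ring|].
      apply continuous_const.
    - apply continuous_ext with (fun u => plus (dirichlet j u) (2 * cos (freq j * u))).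
      { intros v. unfold dirichlet, plus; simpl. ring. }
      apply (@continuous_plus R_UniformSpace R_AbsRing R_NormedModule); [exact IH|].
      apply (@ex_derive_continuous R_AbsRing R_NormedModule). auto_derive. easy. }
  induction n as [|n IH].
  - apply continuous_const.
  - apply (continuous_ext (fun u => plus (fejer n u) (dirichlet n u))); [reflexivity|].
    now apply (@continuous_plus R_UniformSpace R_AbsRing R_NormedModule).
Qed.

(** The kernel [F] has mass [n], and [F y ^ 2 <= 1] for [y = sin (PI u)]. The inequality [y <= e
    + y ^ 2 / (4 e)] splits the integral of [F y] between these two estimates. *)
Lemma chord_gap_fejer (t : C) :
  exists L, 0 <= L /\ forall n e, 0 < e ->
    Cmod (CInt (fun u => chord_gap t u * fejer n u)%C 0 1) <= L * (e * INR n + / (4 * e)).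
Proof.
  destruct (chord_gap_bound t) as [L [HL H]]. exists L. split; [exact HL|]. intros n e He.
  assert (R1 : is_RInt (fun u => plus (scal (L * e) (fejer n u)) (L / (4 * e))) 0 1
            (plus (scal (L * e) (INR n)) (scal (1 - 0) (L / (4 * e))))).
  { apply (@is_RInt_plus R_NormedModule).
    - apply (@is_RInt_scal R_NormedModule), RInt_fejer.
    - apply (@is_RInt_const R_NormedModule). }
  replace (L * (e * INR n + / (4 * e))) with (plus (scal (L * e) (INR n)) (scal (1 - 0) (L / (4 * e)))).
  2:{ unfold plus, scal; simpl; unfold mult; simpl. field. lra. }
  rewrite <- (is_RInt_unique _ _ _ _ R1). apply CInt_norm_le; [lra| |eexists; exact R1|].
  - apply Cexint_cont. intros u _. apply Ccont_mult.
    + eapply Cderiv_Ccont, Cderiv_chord_gap.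
    + apply Ccont_RtoC, continuous_fejer.
  - intros u Hu. pose proof (fejer_pos n u Hu) as Fp. specialize (H u ltac:(lra)).
    rewrite Cmod_mult, (Cmod_Rpos (fejer n u)) by exact Fp.
    unfold plus, scal; simpl; unfold mult; simpl.
    set (y := sin (PI * u)) in *. set (F := fejer n u) in *.
    assert (Fy : F * y ^ 2 <= 1).
    { unfold F, y. rewrite fejer_sin. pose proof (sin2_cos2 (INR n * (PI * u))) as S.
      unfold Rsqr in S. pose proof (Rle_0_sqr (cos (INR n * (PI * u)))) as Q. unfold Rsqr in Q. nra. }
    assert (Y : y <= e + y ^ 2 / (4 * e)).
    { apply Rmult_le_reg_r with (4 * e); [lra|].
      replace ((e + y ^ 2 / (4 * e)) * (4 * e)) with (4 * e * e + y ^ 2) by (field; lra).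
      pose proof (pow2_ge_0 (y - 2 * e)). nra. }
    apply Rle_trans with (L * y * F); [now apply Rmult_le_compat_r|].
    replace (L * e * F + L / (4 * e)) with (L * (e * F + 1 / (4 * e))) by (field; lra).
    rewrite Rmult_assoc. apply Rmult_le_compat_l; [exact HL|].
    apply Rle_trans with ((e + y ^ 2 / (4 * e)) * F); [now apply Rmult_le_compat_r|].
    replace ((e + y ^ 2 / (4 * e)) * F) with (e * F + F * y ^ 2 / (4 * e)) by (field; lra).
    apply Rplus_le_compat_l. unfold Rdiv. apply Rmult_le_compat_r; [|exact Fy].
    left. apply Rinv_0_lt_compat. lra.
Qed.

Lemma Clim_cesaro u l : Clim u l -> Clim (fun n => csum u n / INR n)%C l.
Proof.
  assert (Gen : forall (v : nat -> R) (x : R), is_lim_seq v x -> is_lim_seq (fun n => rsum v n / INR n) x).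
  { intros v x Hv. apply is_lim_seq_Reals in Hv. apply Cesaro_1 in Hv. apply is_lim_seq_Reals in Hv.
    eapply is_lim_seq_ext_loc; [|exact Hv]. exists 1%nat. intros n Hn. f_equal.
    destruct n as [|n]; [lia|]. rewrite rsum_sum_n, <- sum_n_Reals. reflexivity. }
  intros [A B]. apply Gen in A, B. apply Clim_ext_loc with
    (fun n => (rsum (fun k => Re (u k)) n / INR n, rsum (fun k => Im (u k)) n / INR n)).
  - exists 1%nat. intros n Hn. assert (INR n <> 0) by (apply not_0_INR; lia).
    apply C_eq; unfold Cdiv; rewrite <- RtoC_inv by assumption;
      rewrite ?re_scal_r, ?im_scal_r, ?Re_csum, ?Im_csum; reflexivity.
  - split; assumption.
Qed.

Lemma ex_series_scalR (c : R) (f : nat -> R) : ex_series f -> ex_series (fun k => c * f k).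
Proof. intros [l H]. exists (c * l). apply (is_series_scal c f l H). Qed.

Lemma freq_ge k : INR (S k) <= freq k.
Proof.
  unfold freq. pose proof PI2_3_2. pose proof (INR_S_pos k). nra.
Qed.

Lemma ex_series_inv_freq_sq : ex_series (fun k => / freq k ^ 2).
Proof.
  apply ex_series_ext with (fun k => / (2 * PI) ^ 2 * / INR (S k) ^ 2).
  - intros k. unfold freq. pose proof (INR_S_pos k). pose proof PI_RGT_0.
    rewrite !Rpow_mult_distr, !Rinv_mult. reflexivity.
  - apply ex_series_scalR, ex_series_inv_sq.
Qed.

Lemma inv_sq_plus_sq_bound (t : C) (a : R) :
  0 < a -> Re t <> 0 -> Cmod (/ (t ^ 2 + a ^ 2)) <= Cmod t ^ 2 / Re t ^ 2 * / a ^ 2.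
Proof.
  intros Ha Ht. pose proof (sq_plus_sq_neq_0 a t ltac:(lra) Ht) as Hn.
  rewrite Cmod_inv by exact Hn. apply Cmod_gt_0 in Hn.
  pose proof (sq_plus_sq_lower a t) as H.
  assert (0 < a ^ 2) by now apply pow_lt. assert (0 < Re t ^ 2) by now apply pow2_gt_0.
  apply Rmult_le_reg_r with (Cmod (t ^ 2 + a ^ 2) * (a ^ 2 * Re t ^ 2));
    [apply Rmult_lt_0_compat; [|apply Rmult_lt_0_compat]; assumption|].
  replace (/ Cmod (t ^ 2 + a ^ 2) * (Cmod (t ^ 2 + a ^ 2) * (a ^ 2 * Re t ^ 2)))
    with (a ^ 2 * Re t ^ 2) by (field; lra).
  replace (Cmod t ^ 2 / Re t ^ 2 * / a ^ 2 * (Cmod (t ^ 2 + a ^ 2) * (a ^ 2 * Re t ^ 2)))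
    with (Cmod (t ^ 2 + a ^ 2) * Cmod t ^ 2) by (field; repeat split; lra). exact H.
Qed.

(** The partial sums of the Fourier series of [chord_gap] at the end point converge by
    comparison, and their Cesaro means tend to [0] by [chord_gap_fejer]; so their limit is [0].
    *)
Theorem coth_partial_fractions (t : C) :
  Re t <> 0 -> exists P : C, csums (fun k => 2 * t / (t ^ 2 + freq k ^ 2))%C P /\
    ((1 - Cexp (- t)) * (1 / t + P) = (1 + Cexp (- t)) / 2)%C.
Proof.
  intros Ht.
  destruct (csums_dominated (fun k => 2 * t / (t ^ 2 + freq k ^ 2))%C
    (fun k => Cmod (2 * t) * (Cmod t ^ 2 / Re t ^ 2) * / freq k ^ 2)) as [P HP].
  - intros k. unfold Cdiv at 1. rewrite Cmod_mult, Rmult_assoc.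
    apply Rmult_le_compat_l; [apply Cmod_ge_0|].
    apply inv_sq_plus_sq_bound; [apply freq_pos | exact Ht].
  - apply ex_series_scalR, ex_series_inv_freq_sq.
  - exists P. split; [exact HP|].
    set (E := fun n => CInt (fun u => chord_gap t u * dirichlet n u)%C 0 1).
    set (l := ((1 - Cexp (- t)) * (1 / t + P) - (1 + Cexp (- t)) / 2)%C).
    assert (HE : Clim E l).
    { eapply Clim_ext; [intros n; symmetry; apply (chord_gap_dirichlet t n Ht)|].
      apply Clim_minus; [|apply Clim_const]. apply Clim_scal.
      apply Clim_plus; [apply Clim_const | exact HP]. }
    assert (Hc : forall j u, Ccont (fun v => chord_gap t v * dirichlet j v)%C u).
    { intros j u. apply Ccont_mult; [eapply Cderiv_Ccont, Cderiv_chord_gap|].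
      apply Ccont_RtoC. apply (continuous_ext (fun v => minus (fejer (S j) v) (fejer j v))).
      - intros v. unfold fejer, minus, plus, opp; simpl. ring.
      - apply (@continuous_minus R_UniformSpace R_AbsRing R_NormedModule); apply continuous_fejer. }
    assert (HF : forall n, csum E n = CInt (fun u => chord_gap t u * fejer n u)%C 0 1).
    { induction n as [|n IH].
      - rewrite (CInt_ext _ (fun _ => RtoC 0)); [|lra | intros; unfold fejer; simpl; ring].
        rewrite (CInt_RtoC (fun _ => 0)), (@RInt_const R_CompleteNormedModule).
        simpl. f_equal. unfold scal; simpl; unfold mult; simpl. ring.
      - cbn [csum]. rewrite IH. unfold E. rewrite <- CInt_plus.
        + apply CInt_ext; [lra|]. intros u _.
          replace (fejer (S n) u) with (fejer n u + dirichlet n u) by reflexivity.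
          rewrite RtoC_plus. ring.
        + apply Cexint_cont. intros u _. apply Ccont_mult; [eapply Cderiv_Ccont, Cderiv_chord_gap|].
          apply Ccont_RtoC, continuous_fejer.
        + apply Cexint_cont. auto. }
    destruct (chord_gap_fejer t) as [L [HL HB]].
    assert (Hl : forall e, 0 < e -> Cmod l <= 2 * L * e).
    { intros e He. apply (Clim_Cmod_le (fun n => csum E n / INR n)%C); [|now apply Clim_cesaro].
      (* from here on [/ (4 e)] is at most [e n] *)
      destruct (INR_unbounded (/ (4 * e * e))) as [N HN]. exists (S N). intros n Hn.
      assert (Hn' : / (4 * e * e) <= INR n).
      { apply Rle_trans with (INR N); [lra|]. apply le_INR. lia. }
      assert (Hp : 0 < / (4 * e * e)) by (apply Rinv_0_lt_compat; nra).
      rewrite Cmod_div, Cmod_Rpos by (try (apply RtoC_neq); lra).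
      apply Rle_div_l; [lra|]. rewrite HF. eapply Rle_trans; [apply (HB n e He)|].
      replace (2 * L * e * INR n) with (L * (e * INR n + e * INR n)) by ring.
      apply Rmult_le_compat_l; [exact HL|]. apply Rplus_le_compat_l.
      replace (/ (4 * e)) with (e * / (4 * e * e)) by (field; lra).
      apply Rmult_le_compat_l; lra. }
    assert (Z : Cmod l = 0).
    { pose proof (Cmod_ge_0 l). destruct (Req_dec (Cmod l) 0) as [|Hne]; [assumption|].
      specialize (Hl (Cmod l / (4 * (L + 1)))).
      assert (Hp : 0 < Cmod l / (4 * (L + 1))) by (apply Rdiv_lt_0_compat; lra).
      specialize (Hl Hp).
      replace (2 * L * (Cmod l / (4 * (L + 1)))) with (Cmod l * (L / (2 * (L + 1)))) in Hl by (field; lra).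
      assert (L / (2 * (L + 1)) < 1) by (apply Rlt_div_l; lra). nra. }
    apply Cmod_eq_0 in Z. unfold l in Z.
    replace ((1 - Cexp (- t)) * (1 / t + P))%C with
      ((1 - Cexp (- t)) * (1 / t + P) - (1 + Cexp (- t)) / 2 + (1 + Cexp (- t)) / 2)%C by ring.
    rewrite Z. ring.
Qed.

(** * Bernoulli numbers as sums of inverse even powers *)

Definition freq_zeta (k : nat) : R := Series (fun n => / freq n ^ (2 * k)).

Lemma freq_ge_1 n : 1 <= freq n.
Proof.
  eapply Rle_trans; [|apply freq_ge]. change 1 with (INR 1). apply le_INR. lia.
Qed.

Lemma inv_freq_pow_pos n k : 0 < / freq n ^ k.
Proof. apply Rinv_0_lt_compat, pow_lt, freq_pos. Qed.

Lemma ex_series_le_pos (a b : nat -> R) :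
  (forall n, 0 <= a n <= b n) -> ex_series b -> ex_series a.
Proof.
  intros H. apply (@ex_series_le R_AbsRing R_CompleteNormedModule a b).
  intros n. change (norm (a n)) with (Rabs (a n)). rewrite Rabs_pos_eq; apply H.
Qed.

Lemma inv_freq_pow_le n j k : (j <= k)%nat -> / freq n ^ k <= / freq n ^ j.
Proof.
  intros H. apply Rinv_le_contravar; [apply pow_lt, freq_pos|].
  apply Rle_pow; [apply freq_ge_1 | exact H].
Qed.

Lemma ex_freq_zeta k : (1 <= k)%nat -> ex_series (fun n => / freq n ^ (2 * k)).
Proof.
  intros Hk. apply ex_series_le_pos with (fun n => / freq n ^ 2); [|apply ex_series_inv_freq_sq].
  intros n. split; [left; apply inv_freq_pow_pos | apply inv_freq_pow_le; lia].
Qed.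

Lemma is_freq_zeta k : (1 <= k)%nat -> is_series (fun n => / freq n ^ (2 * k)) (freq_zeta k).
Proof. intros Hk. apply Series_correct. now apply ex_freq_zeta. Qed.

Lemma freq_zeta_pos k : (1 <= k)%nat -> 0 < freq_zeta k.
Proof.
  intros Hk. apply Rlt_le_trans with (rsum (fun n => / freq n ^ (2 * k)) 1).
  - simpl rsum. rewrite Rplus_0_l. apply inv_freq_pow_pos.
  - apply rsum_le_series; [intros; left; apply inv_freq_pow_pos | now apply is_freq_zeta].
Qed.

Lemma freq_zeta_le k : (1 <= k)%nat -> freq_zeta k <= freq_zeta 1.
Proof.
  intros Hk. apply Series_le; [|apply ex_freq_zeta; lia].
  intros n. split; [left; apply inv_freq_pow_pos | apply inv_freq_pow_le; lia].
Qed.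

(** The Taylor coefficients of [x / (exp x - 1)] as the partial fractions give them. *)
Definition bern_coef (n : nat) : R :=
  match n with
  | O => 1
  | 1%nat => - / 2
  | _ => if Nat.even n then 2 * (-1) ^ (n / 2 - 1) * freq_zeta (n / 2) else 0
  end.

Lemma bern_coef_even k : bern_coef (2 * k + 2) = 2 * (-1) ^ k * freq_zeta (k + 1).
Proof.
  replace (2 * k + 2)%nat with (S (S (k * 2))) by lia. cbn [bern_coef].
  replace (Nat.even (S (S (k * 2)))) with true.
  2:{ symmetry. apply Nat.even_spec. exists (k + 1)%nat. lia. }
  replace (S (S (k * 2)) / 2)%nat with (k + 1)%nat.
  - do 3 f_equal. lia.
  - replace (S (S (k * 2))) with ((k + 1) * 2)%nat by lia. now rewrite Nat.div_mul by lia.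
Qed.

Lemma bern_coef_odd k : bern_coef (2 * k + 3) = 0.
Proof.
  replace (2 * k + 3)%nat with (S (S (S (k * 2)))) by lia. cbn [bern_coef].
  replace (Nat.even (S (S (S (k * 2))))) with false; [reflexivity|].
  symmetry. apply Bool.not_true_iff_false. intros H. apply Nat.even_spec in H. destruct H; lia.
Qed.

Lemma even_odd_cases n : (exists k, n = 2 * k)%nat \/ (exists k, n = 2 * k + 1)%nat.
Proof. destruct (Nat.Even_or_Odd n) as [[k H]|[k H]]; [left | right]; now exists k. Qed.

Lemma ex_frac_tail (M : nat) (t : C) :
  Re t <> 0 -> exists l, csums (fun n => / (freq n ^ (2 * M) * (t ^ 2 + freq n ^ 2)))%C l.
Proof.
  intros Ht. apply csums_dominated with (fun k => (Cmod t ^ 2 / Re t ^ 2) * / freq k ^ 2).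
  2:{ apply ex_series_scalR, ex_series_inv_freq_sq. }
  intros k. pose proof (freq_pos k) as Ha.
  assert (Hq := sq_plus_sq_neq_0 (freq k) t ltac:(lra) Ht).
  assert (Hp : RtoC (freq k ^ (2 * M)) <> 0) by (apply RtoC_neq, pow_nonzero; lra).
  rewrite <- RtoC_pow, Cmod_inv, Cmod_mult by (now apply Cmult_neq_0).
  rewrite Rinv_mult, Cmod_Rpos by (left; apply pow_lt, Ha).
  rewrite <- (Rmult_1_l (_ * / freq k ^ 2)). apply Rmult_le_compat.
  - left; apply inv_freq_pow_pos.
  - left. apply Rinv_0_lt_compat, Cmod_gt_0, Hq.
  - pose proof (inv_freq_pow_le k 0 (2 * M) ltac:(lia)) as H. simpl (freq k ^ 0) in H. lra.
  - rewrite <- Cmod_inv by exact Hq. now apply inv_sq_plus_sq_bound.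
Qed.

Definition CSeries (f : nat -> C) : C := CLim_seq (csum f).

Lemma CSeries_correct f : (exists l, csums f l) -> csums f (CSeries f).
Proof. intros [l H]. unfold CSeries. now rewrite (CLim_seq_Clim _ _ H). Qed.

(** What is left, summed over the frequencies [a], when [/ (t ^ 2 + a ^ 2)] has been expanded
    [M] times in powers of [t ^ 2 / a ^ 2], up to a sign and a power of [t]. *)
Definition frac_tail (M : nat) (t : C) : C :=
  CSeries (fun n => / (freq n ^ (2 * M) * (t ^ 2 + freq n ^ 2)))%C.

Lemma is_frac_tail M t : Re t <> 0 ->
  csums (fun n => / (freq n ^ (2 * M) * (t ^ 2 + freq n ^ 2)))%C (frac_tail M t).
Proof. intros Ht. now apply CSeries_correct, ex_frac_tail. Qed.

(** One step of the geometric expansion: [/ (t ^ 2 + a ^ 2)] equals [/ a ^ 2 - t ^ 2 / (a ^ 2 (t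
    ^ 2 + a ^ 2))]. *)
Lemma frac_tail_step M t : Re t <> 0 ->
  (frac_tail M t = freq_zeta (S M) - t ^ 2 * frac_tail (S M) t)%C.
Proof.
  intros Ht. apply (csums_unique (fun n => / (freq n ^ (2 * M) * (t ^ 2 + freq n ^ 2)))%C).
  - now apply is_frac_tail.
  - apply csums_ext with (fun n => RtoC (/ freq n ^ (2 * S M))
      + - t ^ 2 * / (freq n ^ (2 * S M) * (t ^ 2 + freq n ^ 2)))%C.
    + intros n. pose proof (freq_pos n) as Ha.
      assert (Hq := sq_plus_sq_neq_0 (freq n) t ltac:(lra) Ht).
      assert (Hp : RtoC (freq n) <> 0) by (apply RtoC_neq; lra).
      rewrite RtoC_inv, RtoC_pow by (apply pow_nonzero; lra).
      replace (2 * S M)%nat with (2 * M + 2)%nat by lia. rewrite Cpow_add_r.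
      field. repeat split; auto. now apply Cpow_nz.
    + replace (freq_zeta (S M) - t ^ 2 * frac_tail (S M) t)%C with
        (freq_zeta (S M) + - t ^ 2 * frac_tail (S M) t)%C by ring.
      apply csums_plus; [|apply csums_scal; now apply is_frac_tail].
      apply csums_RtoC, is_freq_zeta. lia.
Qed.

Lemma frac_tail_bound M t q :
  Re t <> 0 -> 0 < q -> (forall a, 0 < a -> q * a ^ 2 <= Cmod (t ^ 2 + a ^ 2)) ->
  Cmod (frac_tail M t) <= freq_zeta (S M) / q.
Proof.
  intros Ht Hq H.
  apply (csums_le _ (fun n => / q * / freq n ^ (2 * S M)) _ _) with (3 := is_frac_tail M t Ht).
  - intros n. pose proof (freq_pos n) as Ha. specialize (H _ Ha).
    assert (Hn := sq_plus_sq_neq_0 (freq n) t ltac:(lra) Ht).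
    assert (Hp : RtoC (freq n ^ (2 * M)) <> 0) by (apply RtoC_neq, pow_nonzero; lra).
    rewrite <- RtoC_pow, Cmod_inv, Cmod_mult, Cmod_Rpos by
      (now apply Cmult_neq_0 || (left; apply pow_lt, Ha)).
    rewrite <- Rinv_mult. apply Rinv_le_contravar.
    + apply Rmult_lt_0_compat; [exact Hq | apply pow_lt, Ha].
    + replace (2 * S M)%nat with (2 * M + 2)%nat by lia. rewrite pow_add.
      replace (q * (freq n ^ (2 * M) * freq n ^ 2)) with (freq n ^ (2 * M) * (q * freq n ^ 2)) by ring.
      apply Rmult_le_compat_l; [left; apply pow_lt, Ha | exact H].
  - unfold Rdiv. rewrite Rmult_comm. apply (is_series_scal (/ q) (fun n => / freq n ^ (2 * S M)) (freq_zeta (S M))), is_freq_zeta. lia.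
Qed.

Lemma coth_frac_tail t : Re t <> 0 ->
  ((1 - Cexp (- t)) * (1 / t + 2 * t * frac_tail 0 t) = (1 + Cexp (- t)) / 2)%C.
Proof.
  intros Ht. destruct (coth_partial_fractions t Ht) as [P [HP E]].
  replace (2 * t * frac_tail 0 t)%C with P; [exact E|].
  apply (csums_unique (fun k => 2 * t / (t ^ 2 + freq k ^ 2))%C); [exact HP|].
  apply csums_ext with (fun n => 2 * t * / (freq n ^ (2 * 0) * (t ^ 2 + freq n ^ 2)))%C.
  - intros n. cbn [Nat.mul Cpow]. now rewrite Cmult_1_l.
  - now apply csums_scal, is_frac_tail.
Qed.

(** The partial fraction form of [x / (exp x - 1)]; see [bern_gf_real_exp]. *)
Definition bern_gf (x : C) : C := (1 - x / 2 + 2 * x ^ 2 * frac_tail 0 x)%C.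

Lemma bern_gf_expansion (x : C) M : Re x <> 0 ->
  bern_gf x = (csum (fun j => bern_coef j * x ^ j) (2 * M + 2)
            + 2 * (-1) ^ M * x ^ (2 * M + 2) * frac_tail M x)%C.
Proof.
  intros Hx. induction M as [|M IH].
  - unfold bern_gf. simpl. rewrite RtoC_opp, RtoC_inv by lra. field.
  - rewrite IH, (frac_tail_step M x Hx). replace (2 * S M + 2)%nat with (S (S (2 * M + 2))) by lia.
    cbn [csum]. rewrite bern_coef_even. replace (S (2 * M + 2)) with (2 * M + 3)%nat by lia.
    rewrite bern_coef_odd. replace (M + 1)%nat with (S M) by lia.
    rewrite !RtoC_mult, RtoC_pow.
    replace (2 * M + 3)%nat with (S (2 * M + 2)) by lia. cbn [Cpow]. ring.
Qed.

(** On the real axis [frac_tail M] is at most [freq_zeta (S M)], hence bounded in [M]. *)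
Lemma csum_bern_coef_error (x : R) n :
  Rabs x < 1 -> x <> 0 -> (2 <= n)%nat ->
  Cmod (csum (fun j => bern_coef j * x ^ j)%C n - bern_gf x) <= 2 * freq_zeta 1 * Rabs x ^ n.
Proof.
  intros Hx1 Hx Hn. pose proof (freq_zeta_pos 1 (le_n 1)) as Hz.
  assert (T : forall M, Cmod (frac_tail M x) <= freq_zeta 1).
  { intros M. eapply Rle_trans; [apply (frac_tail_bound M x 1); [exact Hx | lra |]|].
    - intros a Ha. rewrite <- !RtoC_pow, <- RtoC_plus, Cmod_Rpos; pose proof (pow2_ge_0 x);
        pose proof (pow2_ge_0 a); lra.
    - unfold Rdiv. rewrite Rinv_1, Rmult_1_r. apply freq_zeta_le. lia. }
  assert (Pr : forall M k, (k <= 2 * M + 2)%nat ->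
      Cmod (2 * (-1) ^ M * x ^ (2 * M + 2) * frac_tail M x) <= 2 * freq_zeta 1 * Rabs x ^ k).
  { intros M k Hk. rewrite !Cmod_mult, !Cmod_pow, !Cmod_R.
    rewrite (Rabs_pos_eq 2), (Rabs_left (-1)) by lra.
    replace (- -1) with 1 by ring. rewrite pow1.
    assert (Rabs x ^ (2 * M + 2) <= Rabs x ^ k).
    { assert (E : (2 * M + 2 = k + (2 * M + 2 - k))%nat) by lia. rewrite E, pow_add.
      rewrite <- (Rmult_1_r (Rabs x ^ k)) at 2. apply Rmult_le_compat_l; [apply pow_le, Rabs_pos|].
      rewrite <- (pow1 (2 * M + 2 - k)). apply pow_incr. split; [apply Rabs_pos | lra]. }
    specialize (T M). pose proof (Cmod_ge_0 (frac_tail M x)).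
    assert (0 <= Rabs x ^ (2 * M + 2)) by apply pow_le, Rabs_pos.
    replace (2 * 1 * Rabs x ^ (2 * M + 2) * Cmod (frac_tail M x))
      with (2 * (Cmod (frac_tail M x) * Rabs x ^ (2 * M + 2))) by ring.
    rewrite Rmult_assoc. apply Rmult_le_compat_l; [lra|]. now apply Rmult_le_compat. }
  (* odd coefficients beyond the first vanish, so an odd number of terms can be completed to an
     even one *)
  destruct (even_odd_cases n) as [[k Hk]|[k Hk]].
  - destruct k as [|M]; [lia|]. replace (2 * S M)%nat with (2 * M + 2)%nat in Hk by lia. subst n.
    rewrite (bern_gf_expansion x M Hx).
    replace (_ - _)%C with (- (2 * (-1) ^ M * x ^ (2 * M + 2) * frac_tail M x))%C by ring.
    rewrite Cmod_opp. now apply Pr.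
  - destruct k as [|M]; [lia|].
    rewrite (bern_gf_expansion x (S M) Hx).
    replace (2 * S M + 2)%nat with (S n) by lia. cbn [csum].
    assert (E : bern_coef n = 0) by (replace n with (2 * M + 3)%nat by lia; apply bern_coef_odd).
    rewrite E.
    replace (csum (fun j => bern_coef j * x ^ j) n
      - (csum (fun j => bern_coef j * x ^ j) n + 0 * x ^ n + 2 * (-1) ^ S M * x ^ S n * frac_tail (S M) x))%C
      with (- (2 * (-1) ^ S M * x ^ S n * frac_tail (S M) x))%C by ring.
    rewrite Cmod_opp. replace (S n) with (2 * S M + 2)%nat by lia. apply Pr. lia.
Qed.

Lemma bern_gf_0_series : is_pseries bern_coef 0 1.
Proof. apply (is_pseries_0 bern_coef). Qed.

(** The expansions of [frac_tail] hold off the imaginary axis, so the value at [0] is set apart.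
    *)
Definition bern_gf_real (x : R) : R := if Req_EM_T x 0 then 1 else Re (bern_gf x).

Lemma is_pseries_bern_coef x : Rabs x < 1 -> is_pseries bern_coef x (bern_gf_real x).
Proof.
  intros Hx. unfold bern_gf_real. destruct (Req_EM_T x 0) as [->|Hx0]; [apply bern_gf_0_series|].
  apply is_pseries_R, is_series_rsum.
  assert (L : Clim (csum (fun j => bern_coef j * x ^ j)%C) (bern_gf x)).
  { apply Clim_squeeze with (fun n => 2 * freq_zeta 1 * Rabs x ^ n).
    - exists 2%nat. intros n Hn. now apply csum_bern_coef_error.
    - replace (Finite 0) with (Rbar_mult (2 * freq_zeta 1) 0) by (simpl; f_equal; ring).
      apply is_lim_seq_scal_l, is_lim_seq_geom. now rewrite Rabs_Rabsolu. }
  destruct L as [L _]. eapply is_lim_seq_ext; [|exact L]. intros n. simpl. rewrite Re_csum.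
  apply rsum_ext. intros k _. now rewrite <- RtoC_pow, <- RtoC_mult.
Qed.

Lemma bern_gf_real_exp x : bern_gf_real x * (exp x - 1) = x.
Proof.
  unfold bern_gf_real. destruct (Req_EM_T x 0) as [->|Hx]; [rewrite exp_0; ring|].
  assert (E : (bern_gf x * RtoC (exp x - 1))%C = RtoC x).
  { pose proof (coth_frac_tail x Hx) as H. unfold bern_gf. rewrite RtoC_minus, <- Cexp_RtoC.
    rewrite Cexp_opp in H. pose proof (Cexp_neq_0 x) as Hn. apply RtoC_neq in Hx.
    set (y := Cexp x) in *. set (s := frac_tail 0 x) in *.
    replace ((1 - x / 2 + 2 * x ^ 2 * s) * (y - 1))%C with
      (x * y * ((1 - / y) * (1 / x + 2 * x * s)) - x / 2 * (y - 1))%C by (field; auto).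
    rewrite H. field. auto. }
  rewrite <- re_scal_r, E. reflexivity.
Qed.

Lemma CV_radius_ge (a : nat -> R) (r : R) : 0 < r -> ex_pseries a r -> Rbar_le r (CV_radius a).
Proof.
  intros Hr H. apply Rbar_not_lt_le. intros K.
  assert (K' : Rbar_lt (CV_radius a) (Rabs r)) by (rewrite Rabs_pos_eq by lra; exact K).
  apply (CV_disk_outside a r K').
  apply (ex_series_lim_0 (fun n => a n * r ^ n)). now apply ex_pseries_R.
Qed.

Definition expm1_coef (n : nat) : R := match n with O => 0 | _ => / INR (fact n) end.

Lemma is_pseries_expm1 x : is_pseries expm1_coef x (exp x - 1).
Proof.
  apply is_pseries_R, is_series_rsum, is_lim_seq_incr_1.
  pose proof (is_exp_Reals x) as H. apply is_pseries_R, is_series_rsum, is_lim_seq_incr_1 in H.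
  apply is_lim_seq_ext with (fun n => rsum (fun k => / INR (fact k) * x ^ k) (S n) - 1).
  - intros n. rewrite !rsum_Sl. simpl. replace (/ 1 * 1) with 1 by field.
    rewrite Rmult_0_l. ring.
  - apply is_lim_seq_minus'; [exact H | apply is_lim_seq_const].
Qed.

(** The Cauchy product of the expansions of [x / (exp x - 1)] and of [exp x - 1] sums to [x]
    near [0], and a power series is determined by its sum. *)
Lemma PS_mult_bern_coef n : PS_mult bern_coef expm1_coef n = if (n =? 1)%nat then 1 else 0.
Proof.
  set (e := fun n => if (n =? 1)%nat then 1 else 0). change (PS_mult bern_coef expm1_coef n = e n).
  assert (He : forall x : R, is_pseries e x x).
  { intros x. apply is_pseries_R, is_series_rsum.
    apply is_lim_seq_ext_loc with (fun _ => x); [|apply is_lim_seq_const].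
    exists 2%nat. intros m Hm. induction Hm as [|m Hm IH].
    - unfold e; simpl. ring.
    - cbn [rsum]. rewrite <- IH. unfold e. replace (m =? 1)%nat with false; [ring|].
      symmetry. apply Nat.eqb_neq. lia. }
  assert (Hc : Rbar_le (/ 2) (CV_radius bern_coef)).
  { apply CV_radius_ge; [lra|]. eexists. apply is_pseries_bern_coef. rewrite Rabs_pos_eq; lra. }
  assert (Hd : Rbar_le (/ 2) (CV_radius expm1_coef)).
  { apply CV_radius_ge; [lra|]. eexists. apply is_pseries_expm1. }
  assert (HM : forall x : R, Rabs x < / 2 -> is_pseries (PS_mult bern_coef expm1_coef) x x).
  { intros x Hx. rewrite <- (bern_gf_real_exp x) at 2. apply is_pseries_mult.
    - apply is_pseries_bern_coef. lra.
    - apply is_pseries_expm1.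
    - eapply Rbar_lt_le_trans; [|exact Hc]. exact Hx.
    - eapply Rbar_lt_le_trans; [|exact Hd]. exact Hx. }
  apply PSeries_ext_recip.
  - apply Rbar_lt_le_trans with (/ 4); [simpl; lra|]. apply CV_radius_ge; [lra|].
    eexists. apply HM. rewrite Rabs_pos_eq; lra.
  - apply Rbar_lt_le_trans with (/ 4); [simpl; lra|]. apply CV_radius_ge; [lra|].
    eexists. apply He.
  - assert (H2 : 0 < / 2) by lra. exists (mkposreal _ H2). intros x Hx.
    assert (Hx' : Rabs x < / 2).
    { revert Hx. unfold ball; simpl; unfold AbsRing_ball, abs, minus, plus, opp; simpl.
      now rewrite Ropp_0, Rplus_0_r. }
    rewrite (is_pseries_unique _ _ _ (HM x Hx')). now rewrite (is_pseries_unique _ _ _ (He x)).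
Qed.

(** Coefficient by coefficient, [PS_mult_bern_coef] is the recurrence that defines the Bernoulli
    numbers. *)
Lemma bernoulli_bern_coef n : bernoulli n = INR (fact n) * bern_coef n.
Proof.
  induction n as [n IH] using (well_founded_induction Wf_nat.lt_wf).
  destruct n as [|n]; [rewrite bernoulli_0; simpl; ring|].
  rewrite bernoulli_S. pose proof (PS_mult_bern_coef (S (S n))) as H.
  unfold PS_mult in H. simpl (S (S n) =? 1)%nat in H. cbn iota in H.
  rewrite 2!tech5 in H. rewrite Nat.sub_diag in H. replace (S (S n) - S n)%nat with 1%nat in H by lia.
  simpl (expm1_coef 0) in H. replace (expm1_coef 1) with 1 in H by (simpl; field).
  rewrite Rmult_0_r, Rmult_1_r, Rplus_0_r in H.
  replace (bern_coef (S n)) with (- sum_f_R0 (fun k => bern_coef k * expm1_coef (S (S n) - k)) n) by lra.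
  rewrite <- Ropp_mult_distr_r, <- Ropp_mult_distr_l. f_equal.
  rewrite !scal_sum. apply sum_eq. intros i Hi. rewrite IH by lia.
  replace (expm1_coef (S (S n) - i)) with (/ INR (fact (S (S n) - i))).
  2:{ destruct (S (S n) - i)%nat as [|m] eqn:E; [lia | reflexivity]. }
  unfold Binomial.C. rewrite (INR_fact_S (S n)). field.
  repeat split; try apply INR_fact_neq_0. apply not_0_INR; lia.
Qed.

(** Euler's evaluation of the zeta function at even integers; the powers of [2 PI] are inside
    the frequencies. *)
Theorem bernoulli_freq_zeta k :
  bernoulli (2 * k + 2) = 2 * (-1) ^ k * INR (fact (2 * k + 2)) * freq_zeta (k + 1).
Proof. rewrite bernoulli_bern_coef, bern_coef_even. ring. Qed.

(** The coefficient of [x ^ 3] in the Cauchy product. *)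
Lemma freq_zeta_1 : freq_zeta 1 = / 24.
Proof.
  pose proof (PS_mult_bern_coef 3) as H. unfold PS_mult in H. rewrite !tech5 in H.
  change (bern_coef 2) with (bern_coef (2 * 0 + 2)) in H. rewrite bern_coef_even in H. simpl in H. lra.
Qed.

(** * Laplace integrals of powers *)

(** The Taylor polynomial of [exp] collects the boundary terms of [p] integrations by parts. *)
Definition pow_lap_primitive (p : nat) (m z : C) (s : R) : C :=
  (- (INR (fact p) / z ^ S p) * (cexp_poly (S p) (s * (m * z)) * Cexp (- (s * (m * z)))))%C.

Lemma Cderiv_pow_lap_primitive p (m z : C) s :
  z <> 0 -> Cderiv (pow_lap_primitive p m z) s (m * (m * s) ^ p * Cexp (- (z * m * s)))%C.
Proof.
  intros Hz. unfold pow_lap_primitive. eapply Cderiv_val.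
  - apply Cderiv_scal, Cderiv_mult; [apply Cderiv_cexp_poly | cder].
  - cbv beta. unfold cexp_poly. cbn [csum].
    set (y := csum _ p). replace (- (z * m * s))%C with (- (s * (m * z)))%C by ring.
    replace (s * (m * z))%C with ((m * s) * z)%C by ring. rewrite Cpow_mult_l. cbn [Cpow].
    field. repeat split; auto.
    + apply RtoC_neq, INR_fact_neq_0.
    + now apply Cpow_nz.
Qed.

Lemma pow_lap_int p (m z : C) (T : R) :
  0 <= T -> z <> 0 ->
  CInt (fun s => m * (m * s) ^ p * Cexp (- (z * m * s)))%C 0 T =
  (INR (fact p) / z ^ S p * (1 - cexp_poly (S p) (T * (m * z)) * Cexp (- (T * (m * z)))))%C.
Proof.
  intros HT Hz. rewrite (CInt_FTC (pow_lap_primitive p m z)).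
  - unfold pow_lap_primitive. replace (0 * (m * z))%C with (RtoC 0) by ring.
    rewrite cexp_poly_0. replace (- 0)%C with (RtoC 0) by ring. rewrite Cexp_0. ring.
  - exact HT.
  - intros s _. now apply Cderiv_pow_lap_primitive.
  - intros s _. apply Ccont_mult; [|ccont].
    apply Ccont_mult; [ccont|]. destruct p as [|p]; [apply (Ccont_const 1) | ccont].
Qed.

Lemma pow_exp_decay (c : R) j : 0 < c -> is_lim_seq (fun n => INR n ^ j * exp (- (c * INR n))) 0.
Proof.
  (* half of the exponent absorbs the power, the other half leaves decay *)
  intros Hc. set (d := c / 2). assert (Hd : 0 < d) by (unfold d; lra).
  set (K := INR (fact j) / d ^ j * (2 / d ^ 2)).
  apply is_lim_seq_le_le_loc with (fun _ => 0) (fun n => K / INR n);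
    [|apply is_lim_seq_const | apply is_lim_seq_inv_INR].
  exists 1%nat. intros n Hn. assert (Hn' : 1 <= INR n) by (change 1 with (INR 1); now apply le_INR).
  assert (Hj : 0 < INR (fact j)) by apply INR_fact_lt_0. assert (Hdj : 0 < d ^ j) by now apply pow_lt.
  split; [apply Rmult_le_pos; [apply pow_le; lra | left; apply exp_pos]|].
  replace (- (c * INR n)) with (- (d * INR n) + - (d * INR n)) by (unfold d; field).
  rewrite exp_plus.
  assert (A : INR n ^ j * exp (- (d * INR n)) <= INR (fact j) / d ^ j).
  { pose proof (pow_le_fact_exp (d * INR n) j ltac:(nra)) as H. rewrite Rpow_mult_distr in H.
    rewrite exp_Ropp. pose proof (exp_pos (d * INR n)).
    apply Rmult_le_reg_r with (exp (d * INR n) * d ^ j / INR (fact j));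
      [apply Rdiv_lt_0_compat; [now apply Rmult_lt_0_compat | exact Hj]|].
    replace (INR n ^ j * / exp (d * INR n) * (exp (d * INR n) * d ^ j / INR (fact j)))
      with (d ^ j * INR n ^ j / INR (fact j)) by (field; lra).
    replace (INR (fact j) / d ^ j * (exp (d * INR n) * d ^ j / INR (fact j)))
      with (exp (d * INR n)) by (field; lra). exact H. }
  assert (B : exp (- (d * INR n)) <= (2 / d ^ 2) / INR n).
  { eapply Rle_trans; [apply exp_decay; lra|].
    assert (0 < d ^ 2) by now apply pow_lt.
    replace (2 / (d * INR n) ^ 2) with (2 / d ^ 2 / INR n * / INR n) by (field; lra).
    rewrite <- (Rmult_1_r (2 / d ^ 2 / INR n)) at 2. apply Rmult_le_compat_l.
    - apply Rmult_le_pos; [|left; apply Rinv_0_lt_compat; lra].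
      apply Rmult_le_pos; [lra | left; now apply Rinv_0_lt_compat].
    - rewrite <- Rinv_1. apply Rinv_le_contravar; lra. }
  rewrite <- Rmult_assoc. replace (K / INR n) with (INR (fact j) / d ^ j * (2 / d ^ 2 / INR n))
    by (unfold K, Rdiv; ring).
  apply Rmult_le_compat; auto; [|left; apply exp_pos].
  apply Rmult_le_pos; [apply pow_le; lra | left; apply exp_pos].
Qed.

Lemma cexp_poly_decay p (w : C) :
  0 < Re w -> Clim (fun n => cexp_poly p (INR n * w) * Cexp (- (INR n * w)))%C 0.
Proof.
  intros Hw. induction p as [|p IH].
  - unfold cexp_poly; simpl. eapply Clim_ext; [|apply Clim_const]. intros; simpl; ring.
  - apply Clim_ext with (fun n => cexp_poly p (INR n * w) * Cexp (- (INR n * w))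
      + (w ^ p / INR (fact p)) * ((INR n ^ p)%R * Cexp (- (INR n * w))))%C.
    + intros n. unfold cexp_poly. cbn [csum]. rewrite RtoC_pow, Cpow_mult_l. unfold Cdiv. ring.
    + replace (RtoC 0) with (0 + w ^ p / INR (fact p) * 0)%C by ring.
      apply Clim_plus; [exact IH|]. apply Clim_scal.
      apply Clim_squeeze with (fun n => INR n ^ p * exp (- (Re w * INR n))); [|now apply pow_exp_decay].
      exists 0%nat. intros n _.
      replace ((INR n ^ p)%R * Cexp (- (INR n * w)) - 0)%C with ((INR n ^ p)%R * Cexp (- (INR n * w)))%C by ring.
      rewrite Cmod_mult, Cmod_Cexp, Cmod_Rpos by (apply pow_le, pos_INR).
      rewrite re_opp, re_scal_l. right. do 3 f_equal. ring.
Qed.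

Lemma pow_lap_limit p (m z : C) :
  z <> 0 -> 0 < Re (z * m) ->
  Clim (fun n => CInt (fun s => m * (m * s) ^ p * Cexp (- (z * m * s)))%C 0 (INR n))
    (INR (fact p) / z ^ S p)%C.
Proof.
  intros Hz Hc.
  apply Clim_ext with (fun n => INR (fact p) / z ^ S p *
    (1 - cexp_poly (S p) (INR n * (m * z)) * Cexp (- (INR n * (m * z)))))%C.
  - intros n. now rewrite pow_lap_int by (auto using pos_INR).
  - replace (INR (fact p) / z ^ S p)%C with (INR (fact p) / z ^ S p * (1 - 0))%C at 1 by ring.
    apply Clim_scal, Clim_minus; [apply Clim_const|]. apply cexp_poly_decay.
    now rewrite Cmult_comm.
Qed.

(** [pow_lap_int] on the real axis, without its negative boundary term. *)
Lemma RInt_pow_exp_le p (c T : R) :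
  0 < c -> 0 <= T ->
  ex_RInt (fun s => s ^ p * exp (- (c * s))) 0 T /\
  RInt (fun s => s ^ p * exp (- (c * s))) 0 T <= INR (fact p) / c ^ S p.
Proof.
  intros Hc HT. split.
  { apply (@ex_RInt_continuous R_CompleteNormedModule). intros s _.
    apply (@ex_derive_continuous R_AbsRing R_NormedModule). auto_derive. easy. }
  assert (E := pow_lap_int p 1 c T HT (RtoC_neq c ltac:(lra))).
  rewrite (CInt_ext _ (fun s => RtoC (s ^ p * exp (- (c * s))))) in E; [|exact HT|].
  2:{ intros s _. rewrite RtoC_mult, RtoC_pow, <- Cexp_RtoC, RtoC_opp, RtoC_mult.
      rewrite !Cmult_1_l, Cmult_1_r. reflexivity. }
  rewrite CInt_RtoC in E.
  assert (E2 : cexp_poly (S p) (T * (1 * c)) = RtoC (rsum (fun j => (T * c) ^ j / INR (fact j)) (S p))).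
  { unfold cexp_poly. rewrite <- csum_RtoC. apply csum_ext. intros k _.
    rewrite RtoC_div by apply INR_fact_neq_0. rewrite RtoC_pow, RtoC_mult, Cmult_1_l. reflexivity. }
  assert (E3 : Cexp (- (T * (1 * c))) = RtoC (exp (- (T * c)))).
  { now rewrite <- Cexp_RtoC, RtoC_opp, RtoC_mult, Cmult_1_l. }
  rewrite E2, E3, <- RtoC_mult, <- RtoC_pow, <- RtoC_minus, <- RtoC_div, <- RtoC_mult in E
    by (apply pow_nonzero; lra).
  apply RtoC_inj in E. rewrite E.
  rewrite <- (Rmult_1_r (INR (fact p) / c ^ S p)) at 2.
  apply Rmult_le_compat_l.
  - apply Rmult_le_pos; [left; apply INR_fact_lt_0 | left; apply Rinv_0_lt_compat, pow_lt, Hc].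
  - assert (0 <= rsum (fun j => (T * c) ^ j / INR (fact j)) (S p)).
    { apply rsum_ge_0. intros k. apply Rmult_le_pos; [apply pow_le; nra|].
      left. apply Rinv_0_lt_compat, INR_fact_lt_0. }
    pose proof (exp_pos (- (T * c))). nra.
Qed.

(** * The Laplace kernel as a sum over the frequencies *)

(** Four integrations by parts. *)
Lemma B3_laplace_explicit (t : C) : t <> 0 ->
  B3_laplace t = (1 / (2 * t ^ 2) - 3 / t ^ 3 + 6 / t ^ 4
    - Cexp (- t) * (1 / (2 * t ^ 2) + 3 / t ^ 3 + 6 / t ^ 4))%C.
Proof.
  intros Ht.
  (* the derivatives of [B3] over increasing powers of [t] *)
  set (A := fun u : R => (- Cexp (- (u * t)) * ((u ^ 3 - 3 / 2 * u ^ 2 + u / 2) / t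
     + (3 * u ^ 2 - 3 * u + 1 / 2) / t ^ 2 + (6 * u - 3) / t ^ 3 + 6 / t ^ 4))%C).
  unfold B3_laplace. rewrite (CInt_FTC A); [|lra| |].
  - unfold A. replace (- (0 * t))%C with (RtoC 0) by ring. replace (- (1 * t))%C with (- t)%C by ring.
    rewrite Cexp_0. field. exact Ht.
  - intros u _. unfold A. eapply Cderiv_val; [cder|].
    cbv beta. rewrite B3_C. cnum. field. exact Ht.
  - intros u _. apply Ccont_mult; [eapply Cderiv_Ccont, Cderiv_B3 | ccont].
Qed.

(** By [B3_laplace_explicit] the kernel is [coth (t / 2)] up to elementary factors, minus the first
    two terms of its Laurent expansion; these are the pole at [0] and the first step of the
    geometric expansion, since [freq_zeta 1] is [1 / 24]. *)
Lemma B3_laplace_frac_tail t : Re t <> 0 ->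
  (t / 6 * B3_laplace t = (1 - Cexp (- t)) * (2 * t * frac_tail 1 t))%C.
Proof.
  intros Ht. assert (Ht0 : t <> 0) by (intros ->; simpl in Ht; lra).
  rewrite B3_laplace_explicit by exact Ht0.
  pose proof (coth_frac_tail t Ht) as H. rewrite (frac_tail_step 0 t Ht) in H.
  rewrite freq_zeta_1, RtoC_inv in H by lra. set (y := Cexp (- t)) in *. set (f := frac_tail 1 t) in *.
  replace ((1 - y) * (2 * t * f))%C with
    (((1 - y) / t + (1 - y) * t / 12 - (1 - y) * (1 / t + 2 * t * (/ 24 - t ^ 2 * f))) / t ^ 2)%C
    by (field; exact Ht0).
  rewrite H. field. exact Ht0.
Qed.

Lemma barnes_coef_freq_zeta j : (1 <= j)%nat ->
  barnes_coef j = 2 * (-1) ^ j * INR (fact (2 * j - 1)) * freq_zeta (S j).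
Proof.
  intros Hj. unfold barnes_coef. rewrite bernoulli_freq_zeta.
  replace (j + 1)%nat with (S j) by lia.
  set (k := (2 * j - 1)%nat). assert (E : (2 * j = S k)%nat) by (unfold k; lia).
  rewrite E. replace (S k + 2)%nat with (S (S (S k))) by lia.
  replace (S k + 1)%nat with (S (S k)) by lia. clearbody k.
  rewrite !INR_fact_S. field. repeat split; apply not_0_INR; lia.
Qed.

(** The geometric expansion; Euler's formula turns its coefficients into those of the asymptotic
    series, over the factorials of the Laplace integrals. *)
Lemma frac_tail_expansion N t : (1 <= N)%nat -> Re t <> 0 ->
  (2 * t * frac_tail 1 t =
   - csum (fun j => barnes_coef (S j) / INR (fact (2 * j + 1)) * t ^ (2 * j + 1)) (N - 1)
   - 2 * (-1) ^ N * t ^ (2 * N - 1) * frac_tail N t)%C.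
Proof.
  intros HN Ht. induction HN as [|N HN IH].
  - simpl. ring.
  - rewrite IH, (frac_tail_step N t Ht).
    replace (S N - 1)%nat with (S (N - 1)) by lia. cbn [csum].
    replace (S (N - 1)) with N by lia.
    rewrite (barnes_coef_freq_zeta N HN).
    replace (2 * (N - 1) + 1)%nat with (2 * N - 1)%nat by lia.
    replace (2 * S N - 1)%nat with (2 * N - 1 + 2)%nat by lia. rewrite Cpow_add_r.
    rewrite !RtoC_mult, RtoC_pow. cbn [Cpow]. field. apply RtoC_neq, INR_fact_neq_0.
Qed.

(** * The remainder bound along a ray *)

Lemma Cexint_csum (f : nat -> R -> C) a b n :
  (forall k, Cexint (f k) a b) -> Cexint (fun s => csum (fun k => f k s) n) a b.
Proof.
  intros H. induction n as [|n IH]; simpl.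
  - apply Cexint_cont. intros; apply Ccont_const.
  - apply Cexint_plus; auto.
Qed.

Lemma CInt_csum (f : nat -> R -> C) a b n :
  (forall k, Cexint (f k) a b) ->
  CInt (fun s => csum (fun k => f k s) n) a b = csum (fun k => CInt (f k) a b) n.
Proof.
  intros H. induction n as [|n IH].
  - cbn [csum]. rewrite (CInt_RtoC (fun _ => 0)), (@RInt_const R_CompleteNormedModule).
    f_equal. apply Rmult_0_r.
  - cbn [csum]. rewrite CInt_plus, IH; auto using Cexint_csum.
Qed.

Lemma Clim_csum (u : nat -> nat -> C) (l : nat -> C) n :
  (forall k, (k < n)%nat -> Clim (u k) (l k)) ->
  Clim (fun p => csum (fun k => u k p) n) (csum l n).
Proof.
  induction n as [|n IH]; intros H; simpl; [apply Clim_const|].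
  apply Clim_plus; [apply IH | apply H]; auto.
Qed.

Lemma csum_geom (y : C) n : ((1 - y) * csum (fun k => y ^ k) n = 1 - y ^ n)%C.
Proof. induction n as [|n IH]; simpl; [ring|]. rewrite Cmult_plus_distr_l, IH. ring. Qed.

Lemma Ccont_lap_ker m z s : Ccont (lap_ker m z) s.
Proof.
  unfold lap_ker. apply Ccont_mult; [|ccont]. apply Ccont_mult; [ccont | apply Ccont_B3_laplace].
Qed.

(** Translating [z] by [k] multiplies the kernel by [exp (- k m s)]; the factor [1 - exp (- m
    s)] of [B3_laplace_frac_tail] cancels the denominator of this geometric sum. *)
Lemma csum_lap_ker m z (s : R) n : Re (m * s) <> 0 ->
  csum (fun k => lap_ker m (z + INR k) s) n =
  (m * (2 * (m * s) * frac_tail 1 (m * s))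
     * (Cexp (- (z * m * s)) - Cexp (- ((z + INR n) * m * s))))%C.
Proof.
  intros Ht. set (t := (m * s)%C) in *.
  assert (E : forall k, Cexp (- ((z + INR k) * m * s)) = (Cexp (- (z * m * s)) * Cexp (- t) ^ k)%C).
  { intros k. rewrite <- Cexp_INR, <- Cexp_plus. f_equal. unfold t. ring. }
  rewrite (csum_ext _ (fun k => (m * (t / 6 * B3_laplace t) * Cexp (- (z * m * s))) * Cexp (- t) ^ k)%C).
  2:{ intros k _. unfold lap_ker. rewrite E. fold t. unfold t. field. }
  rewrite csum_scal, B3_laplace_frac_tail, E by exact Ht.
  pose proof (csum_geom (Cexp (- t)) n) as G. set (S := csum _ n) in *.
  replace (m * ((1 - Cexp (- t)) * (2 * t * frac_tail 1 t)) * Cexp (- (z * m * s)) * S)%C with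
    (m * (2 * t * frac_tail 1 t) * Cexp (- (z * m * s)) * ((1 - Cexp (- t)) * S))%C by ring.
  rewrite G. ring.
Qed.

Definition em_sum (z : C) (n : nat) : C := (- csum (fun k => em_delta (z + INR k)) n)%C.

(** The integrand for [em_sum z n] minus the terms of the asymptotic series at [z] and plus
    those at [z + n]. For finite [n] every integrand is continuous up to [s = 0], and the
    passage to infinite [n] concerns numbers instead of integrals. *)
Definition diff_ker (N n : nat) (m z : C) (s : R) : C :=
  (- csum (fun k => lap_ker m (z + INR k) s) n
   - csum (fun j => barnes_coef (S j) / INR (fact (2 * j + 1)) *
       (m * (m * s) ^ (2 * j + 1) * Cexp (- (z * m * s))
        - m * (m * s) ^ (2 * j + 1) * Cexp (- ((z + INR n) * m * s)))) (N - 1))%C.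

(** The polynomial part of [frac_tail_expansion] cancels. *)
Lemma diff_ker_frac_tail N n m z (s : R) : (1 <= N)%nat -> Re (m * s) <> 0 ->
  diff_ker N n m z s =
  (2 * (-1) ^ N * m * (m * s) ^ (2 * N - 1) * frac_tail N (m * s)
     * (Cexp (- (z * m * s)) - Cexp (- ((z + INR n) * m * s))))%C.
Proof.
  intros HN Ht. unfold diff_ker. rewrite csum_lap_ker by exact Ht.
  rewrite (frac_tail_expansion N _ HN Ht).
  set (E := (Cexp (- (z * m * s)) - Cexp (- ((z + INR n) * m * s)))%C).
  rewrite (csum_ext (fun j => barnes_coef (S j) / INR (fact (2 * j + 1)) *
       (m * (m * s) ^ (2 * j + 1) * Cexp (- (z * m * s))
        - m * (m * s) ^ (2 * j + 1) * Cexp (- ((z + INR n) * m * s))))%C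
    (fun j => (m * E) * (barnes_coef (S j) / INR (fact (2 * j + 1)) * (m * s) ^ (2 * j + 1)))%C).
  2:{ intros j _. unfold E, Cdiv. ring. }
  rewrite csum_scal. ring.
Qed.

Lemma Ccont_mono m w p s : Ccont (fun s => m * (m * s) ^ p * Cexp (- (w * m * s)))%C s.
Proof.
  apply Ccont_mult; [|ccont]. apply Ccont_mult; [ccont|].
  destruct p as [|p]; [apply (Ccont_const 1) | ccont].
Qed.

Lemma Cexint_all f a b : (forall t, Ccont f t) -> Cexint f a b.
Proof. intros H. apply Cexint_cont. auto. Qed.

Lemma slit_shift_INR z k : slit_plane z -> slit_plane (z + INR k).
Proof. intros H. apply slit_shift; auto using pos_INR. Qed.

Lemma Cexint_diff_ker N n m z a b : Cexint (diff_ker N n m z) a b.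
Proof.
  unfold diff_ker. apply Cexint_minus.
  - apply Cexint_opp, (Cexint_csum (fun k => lap_ker m (z + INR k))).
    intros k. apply Cexint_all. intros; apply Ccont_lap_ker.
  - apply (Cexint_csum (fun j s => barnes_coef (S j) / INR (fact (2 * j + 1)) *
       (m * (m * s) ^ (2 * j + 1) * Cexp (- (z * m * s))
        - m * (m * s) ^ (2 * j + 1) * Cexp (- ((z + INR n) * m * s))))%C).
    intros j. apply Cexint_scal, Cexint_minus; apply Cexint_all; intros; apply Ccont_mono.
Qed.

Lemma diff_ker_limit N n m z :
  slit_plane z -> 0 <= Re m -> 0 < Re (z * m) ->
  Clim (fun T => CInt (diff_ker N n m z) 0 (INR T))
    (em_sum z n - csum (fun j => barnes_coef (S j) / z ^ (2 * S j)
       - barnes_coef (S j) / (z + INR n) ^ (2 * S j)) (N - 1))%C.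
Proof.
  intros Hz Hm Hc.
  assert (Hc' : forall k, 0 < Re ((z + INR k) * m)).
  { intros k. eapply Rlt_le_trans; [exact Hc | apply Re_mult_shift; auto using pos_INR]. }
  set (g := fun (j : nat) (s : R) => (barnes_coef (S j) / INR (fact (2 * j + 1)) *
       (m * (m * s) ^ (2 * j + 1) * Cexp (- (z * m * s))
        - m * (m * s) ^ (2 * j + 1) * Cexp (- ((z + INR n) * m * s))))%C).
  assert (Eg : forall j T, Cexint (g j) 0 T).
  { intros j T. apply Cexint_scal, Cexint_minus; apply Cexint_all; intros; apply Ccont_mono. }
  assert (El : forall k T, Cexint (lap_ker m (z + INR k)) 0 T).
  { intros k T. apply Cexint_all. intros; apply Ccont_lap_ker. }
  apply Clim_ext with (fun T => - csum (fun k => CInt (lap_ker m (z + INR k)) 0 (INR T)) n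
     - csum (fun j => CInt (g j) 0 (INR T)) (N - 1))%C.
  { intros T. unfold diff_ker. rewrite CInt_minus, CInt_opp.
    - f_equal; [f_equal|]; symmetry.
      + now apply (CInt_csum (fun k => lap_ker m (z + INR k))).
      + now apply (CInt_csum g).
    - now apply (Cexint_csum (fun k => lap_ker m (z + INR k))).
    - apply Cexint_opp. now apply (Cexint_csum (fun k => lap_ker m (z + INR k))).
    - now apply (Cexint_csum g). }
  apply Clim_minus.
  - apply Clim_opp. apply Clim_csum. intros k _. apply lap_ker_limit; auto.
    now apply slit_shift_INR.
  - apply Clim_csum. intros j _.
    apply Clim_ext with (fun T => barnes_coef (S j) / INR (fact (2 * j + 1)) *
      (CInt (fun s => m * (m * s) ^ (2 * j + 1) * Cexp (- (z * m * s))) 0 (INR T)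
       - CInt (fun s => m * (m * s) ^ (2 * j + 1) * Cexp (- ((z + INR n) * m * s))) 0 (INR T)))%C.
    { intros T. unfold g. rewrite CInt_scal, CInt_minus; auto.
      - apply Cexint_all; intros; apply Ccont_mono.
      - apply Cexint_all; intros; apply Ccont_mono.
      - apply Cexint_minus; apply Cexint_all; intros; apply Ccont_mono. }
    replace (2 * S j)%nat with (S (2 * j + 1)) by lia.
    assert (Hn0 : z <> 0) by now apply slit_neq_0.
    assert (Hn1 : (z + INR n)%C <> 0) by now apply slit_neq_0, slit_shift_INR.
    replace (barnes_coef (S j) / z ^ S (2 * j + 1) - barnes_coef (S j) / (z + INR n) ^ S (2 * j + 1))%C
      with (barnes_coef (S j) / INR (fact (2 * j + 1)) * (INR (fact (2 * j + 1)) / z ^ S (2 * j + 1)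
         - INR (fact (2 * j + 1)) / (z + INR n) ^ S (2 * j + 1)))%C.
    + apply Clim_scal, Clim_minus; now apply pow_lap_limit.
    + field. repeat split; try (now apply Cpow_nz); auto. apply RtoC_neq, INR_fact_neq_0.
Qed.

Definition barnes_sum (N : nat) (z : C) : C :=
  csum (fun j => barnes_coef (S j) / z ^ (2 * S j))%C (N - 1).

(** Along the ray [frac_tail N] is at most [freq_zeta (S N) / q], so only the integral of a
    power against an exponential remains. *)
Lemma em_sum_bound N n m z q :
  (1 <= N)%nat -> slit_plane z -> Cmod m = 1 -> 0 < Re m -> 0 < Re (z * m) -> 0 < q ->
  (forall s a, 0 < s -> 0 < a -> q * a ^ 2 <= Cmod ((m * s) ^ 2 + a ^ 2)) ->
  Cmod (em_sum z n - (barnes_sum N z - barnes_sum N (z + INR n))) <=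
  2 * (freq_zeta (S N) / q) *
    (INR (fact (2 * N - 1)) / Re (z * m) ^ (2 * N)
     + INR (fact (2 * N - 1)) / Re ((z + INR n) * m) ^ (2 * N)).
Proof.
  intros HN Hz Hm1 Hm Hc Hq H.
  set (B := 2 * (freq_zeta (S N) / q)).
  assert (HB : 0 <= B).
  { pose proof (freq_zeta_pos (S N) ltac:(lia)). unfold B. apply Rmult_le_pos; [lra|].
    left. now apply Rdiv_lt_0_compat. }
  set (c := Re (z * m)) in *. set (c' := Re ((z + INR n) * m)).
  assert (Hc' : 0 < c').
  { eapply Rlt_le_trans; [exact Hc | apply Re_mult_shift; [lra | apply pos_INR]]. }
  unfold barnes_sum. rewrite <- csum_minus.
  eapply Clim_Cmod_le; [|apply (diff_ker_limit N n m z Hz (Rlt_le _ _ Hm) Hc)].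
  exists 0%nat. intros T _. pose proof (pos_INR T) as HT.
  destruct (RInt_pow_exp_le (2 * N - 1) c (INR T) Hc HT) as [E1 I1].
  destruct (RInt_pow_exp_le (2 * N - 1) c' (INR T) Hc' HT) as [E2 I2].
  replace (S (2 * N - 1)) with (2 * N)%nat in I1, I2 by lia.
  eapply Rle_trans.
  - apply CInt_norm_le with
     (g := fun s => B * (s ^ (2 * N - 1) * exp (- (c * s)) + s ^ (2 * N - 1) * exp (- (c' * s)))).
    + exact HT.
    + apply Cexint_diff_ker.
    + apply ex_RInt_scalR. now apply ex_RInt_plusR.
    + intros s [Hs _].
      assert (Ht : Re (m * s) <> 0) by (rewrite re_scal_r; nra).
      rewrite diff_ker_frac_tail by assumption.
      rewrite !Cmod_mult, !Cmod_pow, Cmod_mult, Hm1, Cmod_R, (Cmod_R (-1)), (Cmod_Rpos s) by lra.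
      rewrite (Rabs_pos_eq 2), (Rabs_left (-1)) by lra. replace (- -1) with 1 by ring.
      rewrite pow1, Rmult_1_l, !Rmult_1_r.
      assert (FB : Cmod (frac_tail N (m * s)) <= freq_zeta (S N) / q).
      { apply frac_tail_bound; auto. }
      assert (EB : Cmod (Cexp (- (z * m * s)) - Cexp (- ((z + INR n) * m * s)))
                   <= exp (- (c * s)) + exp (- (c' * s))).
      { eapply Rle_trans; [apply Cmod_triangle'|]. rewrite !Cmod_Cexp, !re_opp, !re_scal_r.
        fold c c'. lra. }
      rewrite <- Rmult_plus_distr_l. unfold B.
      replace (2 * (freq_zeta (S N) / q) * (s ^ (2 * N - 1) * (exp (- (c * s)) + exp (- (c' * s)))))
        with (2 * s ^ (2 * N - 1) * (freq_zeta (S N) / q) * (exp (- (c * s)) + exp (- (c' * s)))) by ring.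
      assert (0 <= s ^ (2 * N - 1)) by (apply pow_le; lra).
      apply Rmult_le_compat; auto using Cmod_ge_0.
      * apply Rmult_le_pos; [lra | apply Cmod_ge_0].
      * apply Rmult_le_compat_l; lra.
  - rewrite RInt_scalR, RInt_plusR by (auto using ex_RInt_plusR).
    apply Rmult_le_compat_l; lra.
Qed.

Lemma is_lim_seq_inv_pow_shift (a b : R) k : 0 < a -> 0 < b -> (1 <= k)%nat ->
  is_lim_seq (fun n => / (a + INR n * b) ^ k) 0.
Proof.
  intros Ha Hb Hk.
  apply is_lim_seq_le_le_loc with (fun _ => 0) (fun n => (/ (Rmin a b) ^ k) / INR n);
    [|apply is_lim_seq_const | apply is_lim_seq_inv_INR].
  exists 1%nat. intros n Hn. assert (Hn' : 1 <= INR n) by (change 1 with (INR 1); now apply le_INR).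
  assert (Hd : 0 < Rmin a b) by now apply Rmin_pos.
  assert (Rmin a b * INR n <= a + INR n * b) by (pose proof (Rmin_r a b); nra).
  assert (0 < a + INR n * b) by nra.
  split; [left; now apply Rinv_0_lt_compat, pow_lt|].
  unfold Rdiv. rewrite <- Rinv_mult. apply Rinv_le_contravar.
  - apply Rmult_lt_0_compat; [now apply pow_lt | lra].
  - apply Rle_trans with ((Rmin a b * INR n) ^ k).
    + rewrite Rpow_mult_distr. apply Rmult_le_compat_l; [left; now apply pow_lt|].
      rewrite <- (pow_1 (INR n)) at 1. now apply Rle_pow.
    + apply pow_incr. split; [nra | assumption].
Qed.

Lemma barnes_sum_shift_limit N z : slit_plane z -> Clim (fun n => barnes_sum N (z + INR n)) 0.
Proof.
  intros Hz. unfold barnes_sum.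
  replace (RtoC 0) with (csum (fun _ => RtoC 0) (N - 1)).
  2:{ induction (N - 1)%nat as [|k IH]; simpl; [easy|]. rewrite IH. ring. }
  apply Clim_csum. intros j _.
  assert (Hz0 : 0 < Cmod z) by now apply Cmod_gt_0, slit_neq_0.
  (* beyond [2 |z|] the translates of [z] have modulus at least [n / 2] *)
  destruct (INR_unbounded (2 * Cmod z)) as [n0 Hn0].
  apply Clim_squeeze with (fun n => (Rabs (barnes_coef (S j)) * 2 ^ (2 * S j)) / INR n);
    [|apply is_lim_seq_inv_INR].
  exists (S n0). intros n Hn.
  assert (Hn1 : INR n0 <= INR n) by (apply le_INR; lia).
  assert (Hn2 : 1 <= INR n) by (change 1 with (INR 1); apply le_INR; lia).
  assert (L : INR n / 2 <= Cmod (z + INR n)).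
  { pose proof (Cmod_triangle_rev (INR n) (- z)) as K. rewrite Cmod_opp, Cmod_Rpos in K by lra.
    replace (INR n - - z)%C with (z + INR n)%C in K by ring. lra. }
  assert (Hne : (z + INR n)%C <> 0) by now apply slit_neq_0, slit_shift_INR.
  replace (barnes_coef (S j) / (z + INR n) ^ (2 * S j) - 0)%C
    with (barnes_coef (S j) / (z + INR n) ^ (2 * S j))%C by ring.
  rewrite Cmod_div, Cmod_pow, Cmod_R by (now apply Cpow_nz).
  unfold Rdiv. rewrite Rmult_assoc. apply Rmult_le_compat_l; [apply Rabs_pos|].
  apply Rle_trans with (/ (INR n / 2) ^ (2 * S j)).
  - apply Rinv_le_contravar; [apply pow_lt; lra|]. apply pow_incr. lra.
  - unfold Rdiv. rewrite Rpow_mult_distr, Rinv_mult, pow_inv, Rinv_inv, Rmult_comm.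
    apply Rmult_le_compat_l; [apply pow_le; lra|]. apply Rinv_le_contravar; [lra|].
    rewrite <- (pow_1 (INR n)) at 1. apply Rle_pow; [lra | lia].
Qed.

(** [em_sum_bound] for [n] tending to infinity, where all terms at [z + n] disappear. *)
Theorem em_limit_bound N m z q L :
  (1 <= N)%nat -> slit_plane z -> Cmod m = 1 -> 0 < Re m -> 0 < Re (z * m) -> 0 < q ->
  (forall s a, 0 < s -> 0 < a -> q * a ^ 2 <= Cmod ((m * s) ^ 2 + a ^ 2)) ->
  Clim (em_sum z) L ->
  Cmod (L - barnes_sum N z) <=
    2 * (freq_zeta (S N) / q) * (INR (fact (2 * N - 1)) / Re (z * m) ^ (2 * N)).
Proof.
  intros HN Hz Hm1 Hm Hc Hq H HL.
  assert (Lm : Clim (fun n => em_sum z n - (barnes_sum N z - barnes_sum N (z + INR n)))%C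
      (L - barnes_sum N z)%C).
  { replace (L - barnes_sum N z)%C with (L - (barnes_sum N z - 0))%C by ring.
    apply Clim_minus; [exact HL|]. apply Clim_minus; [apply Clim_const|].
    now apply barnes_sum_shift_limit. }
  apply Clim_mod in Lm.
  set (K := 2 * (freq_zeta (S N) / q)) in *. set (F := INR (fact (2 * N - 1))) in *.
  set (c := Re (z * m)) in *.
  assert (Lr : is_lim_seq (fun n => K * (F / c ^ (2 * N) + F * / (c + INR n * Re m) ^ (2 * N))
      + Cmod (em_sum z n - (barnes_sum N z - barnes_sum N (z + INR n)) - (L - barnes_sum N z)))
      (K * (F / c ^ (2 * N) + F * 0) + 0)).
  { apply is_lim_seq_plus'; [|exact Lm].
    apply (is_lim_seq_scal_l _ K (F / c ^ (2 * N) + F * 0)).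
    apply is_lim_seq_plus'; [apply is_lim_seq_const|].
    apply (is_lim_seq_scal_l _ F 0). apply is_lim_seq_inv_pow_shift; [exact Hc | exact Hm | lia]. }
  assert (Le : Rbar_le (Cmod (L - barnes_sum N z)) (K * (F / c ^ (2 * N) + F * 0) + 0)).
  2:{ simpl in Le. now rewrite Rmult_0_r, !Rplus_0_r in Le. }
  eapply is_lim_seq_le; [|apply is_lim_seq_const | exact Lr].
  intros n. pose proof (em_sum_bound N n m z q HN Hz Hm1 Hm Hc Hq H) as B. fold K F c in B.
  rewrite Cmult_plus_distr_r, re_plus, re_scal_l in B. fold c in B.
  set (x := (em_sum z n - (barnes_sum N z - barnes_sum N (z + INR n)))%C) in *.
  pose proof (Cmod_triangle' x (x - (L - barnes_sum N z))) as T.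
  replace (x - (x - (L - barnes_sum N z)))%C with (L - barnes_sum N z)%C in T by ring.
  cbv beta. fold x. unfold Rdiv in *. lra.
Qed.

(** * Sign of the remainder on the positive axis *)

(** The contribution of the lowest frequency, a lower bound for the whole series on the real
    axis. *)
Definition frac_tail_lower (N : nat) (s : R) : R := / (freq 0 ^ (2 * N) * (s ^ 2 + freq 0 ^ 2)).

Lemma frac_tail_lower_pos N s : 0 < frac_tail_lower N s.
Proof.
  unfold frac_tail_lower. pose proof (freq_pos 0) as H. pose proof (pow2_ge_0 s).
  apply Rinv_0_lt_compat, Rmult_lt_0_compat; [now apply pow_lt|].
  pose proof (pow_lt _ 2 H). lra.
Qed.

Lemma frac_tail_real N (s : R) : s <> 0 ->
  Im (frac_tail N s) = 0 /\ frac_tail_lower N s <= Re (frac_tail N s).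
Proof.
  intros Hs. assert (Ht := is_frac_tail N s Hs).
  set (r := fun n => / (freq n ^ (2 * N) * (s ^ 2 + freq n ^ 2))).
  assert (Hp : forall n, 0 < r n).
  { intros n. unfold r. pose proof (freq_pos n) as H. pose proof (pow2_ge_0 s).
    apply Rinv_0_lt_compat, Rmult_lt_0_compat; [now apply pow_lt|].
    pose proof (pow_lt _ 2 H). lra. }
  assert (Hr : csums (fun n => RtoC (r n)) (frac_tail N s)).
  { eapply csums_ext; [|exact Ht]. intros n. unfold r.
    specialize (Hp n). unfold r in Hp.
    rewrite RtoC_inv by (intros E; rewrite E, Rinv_0 in Hp; lra).
    now rewrite RtoC_mult, RtoC_plus, !RtoC_pow. }
  apply csums_components in Hr. destruct Hr as [A B]. split.
  - apply is_series_rsum, is_lim_seq_unique in B.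
    rewrite (Lim_seq_ext _ (fun _ => 0)), Lim_seq_const in B; [now injection B|].
    intros n. induction n as [|n IH]; cbn [rsum]; [reflexivity|].
    rewrite IH, im_RtoC. ring.
  - replace (frac_tail_lower N s) with (rsum r 1) by (simpl; unfold r, frac_tail_lower; ring).
    apply rsum_le_series; [intros n; left; apply Hp | exact A].
Qed.

(** On the positive axis every frequency contributes with the sign [(-1) ^ N]. Keeping only the
    lowest one, and the difference of exponentials for [n = 1], gives a bound independent of
    [n]. *)
Lemma diff_ker_real N n (x s : R) : (1 <= N)%nat -> (1 <= n)%nat -> 0 < s ->
  Im (diff_ker N n 1 x s) = 0 /\
  2 * s ^ (2 * N - 1) * frac_tail_lower N s * (exp (- (x * s)) - exp (- ((x + 1) * s)))
    <= (-1) ^ N * Re (diff_ker N n 1 x s).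
Proof.
  intros HN Hn Hs.
  rewrite diff_ker_frac_tail by (auto; rewrite Cmult_1_l; simpl; lra).
  rewrite !Cmult_1_l, !Cmult_1_r.
  destruct (frac_tail_real N s ltac:(lra)) as [I1 I2].
  replace (- (x * s))%C with (RtoC (- (x * s))) by (now rewrite RtoC_opp, RtoC_mult).
  replace (- ((x + INR n) * s))%C with (RtoC (- ((x + INR n) * s)))
    by (now rewrite RtoC_opp, RtoC_mult, RtoC_plus).
  rewrite !Cexp_RtoC.
  set (f := Re (frac_tail N s)) in *.
  replace (frac_tail N s) with (RtoC f) by (apply C_eq; simpl; auto).
  rewrite <- !RtoC_pow, <- RtoC_minus, <- !RtoC_mult.
  set (e := exp (- (x * s)) - exp (- ((x + INR n) * s))).
  split; [reflexivity|]. rewrite re_RtoC.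
  assert (Hn' : 1 <= INR n) by (change 1 with (INR 1); now apply le_INR).
  assert (E1 : exp (- ((x + INR n) * s)) <= exp (- ((x + 1) * s))) by (apply exp_mono; nra).
  assert (E2 : exp (- ((x + 1) * s)) <= exp (- (x * s))) by (apply exp_mono; nra).
  pose proof (frac_tail_lower_pos N s). assert (0 < s ^ (2 * N - 1)) by now apply pow_lt.
  replace ((-1) ^ N * (2 * (-1) ^ N * s ^ (2 * N - 1) * f * e)) with
    (((-1) ^ N * (-1) ^ N) * (2 * s ^ (2 * N - 1) * f * e)) by ring.
  rewrite <- Rpow_mult_distr. replace (-1 * -1) with 1 by ring. rewrite pow1, Rmult_1_l.
  apply Rmult_le_compat.
  - repeat apply Rmult_le_pos; lra.
  - lra.
  - apply Rmult_le_compat_l; lra.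
  - unfold e. lra.
Qed.

(** A bound independent of [n] and of the upper end of the integral, so that strict positivity
    survives both limits. *)
Definition sign_gap (N : nat) (x : R) : R :=
  RInt (fun s => 2 * s ^ (2 * N - 1) * frac_tail_lower N s * (exp (- (x * s)) - exp (- ((x + 1) * s)))) 0 1.

Lemma continuous_sign_gap N x s :
  continuous (fun s => 2 * s ^ (2 * N - 1) * frac_tail_lower N s
    * (exp (- (x * s)) - exp (- ((x + 1) * s)))) s.
Proof.
  apply (@ex_derive_continuous R_AbsRing R_NormedModule). unfold frac_tail_lower. auto_derive.
  pose proof (frac_tail_lower_pos N s) as H. unfold frac_tail_lower in H.
  intros E. simpl in H. rewrite E, Rinv_0 in H. lra.
Qed.

Lemma sign_gap_pos N x : 0 < sign_gap N x.
Proof.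
  apply RInt_gt_0; [lra| |].
  - intros s Hs. pose proof (frac_tail_lower_pos N s). assert (0 < s ^ (2 * N - 1)) by now apply pow_lt.
    apply Rmult_lt_0_compat; [apply Rmult_lt_0_compat; lra|].
    assert (exp (- ((x + 1) * s)) < exp (- (x * s))) by (apply exp_increasing; nra). lra.
  - intros s _. apply continuous_sign_gap.
Qed.

Lemma diff_ker_int_real N n T (x : R) : (1 <= N)%nat -> (1 <= n)%nat -> 1 <= T ->
  Im (CInt (diff_ker N n 1 x) 0 T) = 0 /\
  sign_gap N x <= (-1) ^ N * Re (CInt (diff_ker N n 1 x) 0 T).
Proof.
  intros HN Hn HT. set (f := diff_ker N n 1 x).
  assert (Hf : forall s, 0 < s -> Im (f s) = 0 /\
    2 * s ^ (2 * N - 1) * frac_tail_lower N s * (exp (- (x * s)) - exp (- ((x + 1) * s)))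
    <= (-1) ^ N * Re (f s)) by (intros; now apply diff_ker_real).
  assert (Hx : forall a b, Cexint f a b) by (intros; apply Cexint_diff_ker).
  split.
  - unfold CInt. cbn [Im snd]. rewrite (RInt_ext _ (fun _ => 0)).
    + rewrite (@RInt_const R_CompleteNormedModule). apply Rmult_0_r.
    + rewrite Rmin_left, Rmax_right by lra. intros s Hs. apply Hf. lra.
  - rewrite <- (CInt_Chasles f 0 1 T) by auto.
    rewrite re_plus, Rmult_plus_distr_l. unfold CInt; cbn [Re fst].
    destruct (Hx 0 1) as [H1 _]. destruct (Hx 1 T) as [H2 _].
    rewrite <- !RInt_scalR by assumption.
    assert (A : sign_gap N x <= RInt (fun s => (-1) ^ N * Re (f s)) 0 1).
    { apply RInt_le; [lra | | now apply ex_RInt_scalR |].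
      - apply (@ex_RInt_continuous R_CompleteNormedModule). intros; apply continuous_sign_gap.
      - intros s Hs. apply Hf. lra. }
    assert (B : 0 <= RInt (fun s => (-1) ^ N * Re (f s)) 1 T).
    { apply RInt_ge_0; [lra | now apply ex_RInt_scalR |]. intros s Hs.
      destruct (Hf s ltac:(lra)) as [_ K]. eapply Rle_trans; [|exact K].
      pose proof (frac_tail_lower_pos N s). assert (0 < s ^ (2 * N - 1)) by (apply pow_lt; lra).
      assert (exp (- ((x + 1) * s)) <= exp (- (x * s))) by (apply exp_mono; nra).
      repeat apply Rmult_le_pos; lra. }
    unfold Re in *. lra.
Qed.

(** [L - barnes_sum N x] is a limit of integrals of [diff_ker], all of sign [(-1) ^ N] and at
    least [sign_gap N x] in modulus. *)
Theorem em_limit_sign N (x : R) L :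
  (1 <= N)%nat -> 0 < x -> Clim (em_sum x) L ->
  Im (L - barnes_sum N x) = 0 /\ 0 < (-1) ^ N * Re (L - barnes_sum N x).
Proof.
  intros HN Hx HL.
  assert (S : slit_plane x) by now apply slit_RtoC.
  assert (Lm : Clim (fun n => em_sum x n - (barnes_sum N x - barnes_sum N (x + INR n)))%C
      (L - barnes_sum N x)%C).
  { replace (L - barnes_sum N x)%C with (L - (barnes_sum N x - 0))%C by ring.
    apply Clim_minus; [exact HL|]. apply Clim_minus; [apply Clim_const|].
    now apply barnes_sum_shift_limit. }
  assert (Hn : forall n, (1 <= n)%nat ->
    Im (em_sum x n - (barnes_sum N x - barnes_sum N (x + INR n))) = 0 /\
    sign_gap N x <= (-1) ^ N * Re (em_sum x n - (barnes_sum N x - barnes_sum N (x + INR n)))).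
  { intros n Hn.
    assert (LT := diff_ker_limit N n 1 x S ltac:(simpl; lra) ltac:(rewrite Cmult_1_r; simpl; lra)).
    rewrite csum_minus in LT. fold (barnes_sum N x) in LT. fold (barnes_sum N (x + INR n)) in LT.
    destruct LT as [LR LI].
    assert (HT : forall T, (1 <= T)%nat -> 1 <= INR T)
      by (intros T HT; change 1 with (INR 1); now apply le_INR).
    split.
    - apply is_lim_seq_unique in LI.
      assert (Z : is_lim_seq (fun T => Im (CInt (diff_ker N n 1 x) 0 (INR T))) 0).
      { apply is_lim_seq_ext_loc with (fun _ => 0); [|apply is_lim_seq_const].
        exists 1%nat. intros T HT1. symmetry. apply diff_ker_int_real; auto. }
      apply is_lim_seq_unique in Z. rewrite Z in LI. now injection LI.
    - apply (is_lim_seq_scal_l _ ((-1) ^ N)) in LR.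
      assert (Le : Rbar_le (sign_gap N x) (Rbar_mult ((-1) ^ N)
         (Re (em_sum x n - (barnes_sum N x - barnes_sum N (x + INR n)))))).
      { eapply is_lim_seq_le_loc; [|apply is_lim_seq_const | exact LR].
        exists 1%nat. intros T HT1. apply diff_ker_int_real; auto. }
      exact Le. }
  destruct Lm as [LR LI]. split.
  - apply is_lim_seq_unique in LI.
    assert (Z : is_lim_seq (fun n => Im (em_sum x n - (barnes_sum N x - barnes_sum N (x + INR n)))) 0).
    { apply is_lim_seq_ext_loc with (fun _ => 0); [|apply is_lim_seq_const].
      exists 1%nat. intros n H1. symmetry. now apply Hn. }
    apply is_lim_seq_unique in Z. rewrite Z in LI. now injection LI.
  - apply Rlt_le_trans with (sign_gap N x); [apply sign_gap_pos|].
    apply (is_lim_seq_scal_l _ ((-1) ^ N)) in LR.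
    assert (Le : Rbar_le (sign_gap N x) (Rbar_mult ((-1) ^ N) (Re (L - barnes_sum N x)))).
    { eapply is_lim_seq_le_loc; [|apply is_lim_seq_const | exact LR].
      exists 1%nat. intros n H1. now apply Hn. }
    exact Le.
Qed.

(** * Power series and the identity theorem *)

(** Analyticity at one point, in terms of [csums]; it can be checked along a curve. *)
Definition locally_pseries (f : C -> C) (s0 : C) : Prop :=
  exists (a : nat -> C) (r : R), 0 < r /\
    forall w, Cmod w < r -> csums (fun k => a k * w ^ k)%C (f (s0 + w)%C).

Lemma sum_n_csum (f : nat -> C) n : @sum_n C_AbelianMonoid f n = csum f (S n).
Proof.
  induction n as [|n IH].
  - rewrite sum_O. simpl. ring.
  - rewrite sum_Sn, IH. reflexivity.
Qed.

Lemma filterlim_C_Clim (u : nat -> C) (l : C) :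
  filterlim u eventually (locally l) -> Clim u l.
Proof.
  intros H. split.
  - intros P [e He]. apply (H (fun w => P (Re w))). exists e. intros w [Hw _]. now apply He.
  - intros P [e He]. apply (H (fun w => P (Im w))). exists e. intros w [_ Hw]. now apply He.
Qed.

Lemma is_series_csums (f : nat -> C) l :
  @is_series C_AbsRing C_NormedModule f l -> csums f l.
Proof.
  intros H. apply filterlim_C_Clim in H. apply Clim_incr_1.
  eapply Clim_ext; [|exact H]. intros n. apply sum_n_csum.
Qed.

Lemma pow_n_Cpow (w : C) k : @pow_n C_Ring w k = (w ^ k)%C.
Proof. induction k as [|k IH]; [reflexivity|]. simpl. now rewrite IH. Qed.

Lemma analytic_locally_pseries D f s0 : analytic_on D f -> D s0 -> locally_pseries f s0.
Proof.
  intros H Hs. destruct (H s0 Hs) as [a [r [Hr Ha]]]. exists a, r. split; [exact Hr|].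
  intros w Hw. specialize (Ha (s0 + w)%C). replace (s0 + w - s0)%C with w in Ha by ring.
  specialize (Ha Hw). apply is_series_csums in Ha.
  eapply csums_ext; [|exact Ha]. intros k.
  transitivity (@pow_n C_Ring w k * a k)%C; [reflexivity|]. rewrite pow_n_Cpow. apply Cmult_comm.
Qed.

Lemma csums_terms_bounded f l : csums f l -> exists B, 0 <= B /\ forall k, Cmod (f k) <= B.
Proof.
  intros H. assert (L : Clim f 0).
  { replace (RtoC 0) with (l - l)%C by ring.
    apply Clim_ext with (fun n => csum f (S n) - csum f n)%C; [intros; simpl; ring|].
    apply Clim_minus; [|exact H]. now apply Clim_incr_1. }
  apply Clim_mod in L.
  assert (L' : is_lim_seq (fun n => Cmod (f n)) 0).
  { eapply is_lim_seq_ext; [|exact L]. intros n. simpl. f_equal. ring. }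
  apply is_lim_seq_spec in L'. destruct (L' (mkposreal 1 Rlt_0_1)) as [N HN].
  assert (Hmax : exists B, 0 <= B /\ forall k, (k < N)%nat -> Cmod (f k) <= B).
  { clear. induction N as [|N [B [HB H]]]; [exists 0; split; [lra | lia]|].
    exists (Rmax B (Cmod (f N))). split; [eapply Rle_trans; [exact HB | apply Rmax_l]|].
    intros k Hk. destruct (Nat.eq_dec k N) as [->|]; [apply Rmax_r|].
    eapply Rle_trans; [apply H; lia | apply Rmax_l]. }
  destruct Hmax as [B [HB H1]]. exists (B + 1). split; [lra|]. intros k.
  destruct (Nat.lt_ge_cases k N) as [C|C].
  - specialize (H1 k C). lra.
  - specialize (HN k C). simpl in HN. rewrite Rminus_0_r, Rabs_pos_eq in HN by apply Cmod_ge_0. lra.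
Qed.

(** By Cauchy's estimate at radius [r / 2] the later terms are geometric for [|w| <= r / 4]. The
    shift [k] serves series whose first [k] coefficients vanish. *)
Lemma pseries_first_term (a : nat -> C) (r : R) (l : C) k :
  0 < r -> csums (fun j => a j * (RtoC (r / 2)) ^ j)%C l ->
  exists K, 0 <= K /\ forall w n, Cmod w <= r / 4 ->
    Cmod (csum (fun j => a (k + j)%nat * w ^ j) (S n) - a k)%C <= K * Cmod w.
Proof.
  intros Hr Hl. destruct (csums_terms_bounded _ _ Hl) as [B [HB H]].
  set (d := 2 / r). assert (Hd : 0 < d) by (apply Rdiv_lt_0_compat; lra).
  assert (Ha : forall j, Cmod (a j) <= B * d ^ j).
  { intros j. specialize (H j). rewrite Cmod_mult, Cmod_pow, Cmod_Rpos in H by lra.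
    assert (P : 0 < (r / 2) ^ j) by (apply pow_lt; lra).
    apply Rmult_le_reg_r with ((r / 2) ^ j); [exact P|].
    replace (B * d ^ j * (r / 2) ^ j) with (B * (d * (r / 2)) ^ j) by (rewrite Rpow_mult_distr; ring).
    replace (d * (r / 2)) with 1 by (unfold d; field; lra). rewrite pow1. lra. }
  assert (HBd : 0 <= B * d ^ S k) by (apply Rmult_le_pos; [exact HB | left; now apply pow_lt]).
  exists (2 * (B * d ^ (S k))). split; [lra|].
  intros w n Hw. pose proof (Cmod_ge_0 w) as Hw0.
  rewrite csum_Sl. rewrite Nat.add_0_r.
  replace (a k * w ^ 0 + csum (fun j => a (k + S j)%nat * w ^ S j) n - a k)%C
    with (w * csum (fun j => a (k + S j)%nat * w ^ j) n)%C.
  2:{ rewrite <- csum_scal. simpl. rewrite Cmult_1_r.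
      match goal with |- _ = (a k + ?x - a k)%C => replace (a k + x - a k)%C with x by ring end.
      apply csum_ext. intros j _. ring. }
  rewrite Cmod_mult, Rmult_comm. apply Rmult_le_compat_r; [exact Hw0|].
  eapply Rle_trans; [apply Cmod_csum|].
  apply Rle_trans with (rsum (fun j => (B * d ^ S k) * (/ 2) ^ j) n).
  - apply rsum_le. intros j _. rewrite Cmod_mult, Cmod_pow.
    apply Rle_trans with (B * d ^ (k + S j) * Cmod w ^ j).
    + apply Rmult_le_compat_r; [now apply pow_le | apply Ha].
    + replace (k + S j)%nat with (S k + j)%nat by lia. rewrite pow_add.
      replace (B * (d ^ S k * d ^ j) * Cmod w ^ j) with (B * d ^ S k * (d * Cmod w) ^ j)
        by (rewrite Rpow_mult_distr; ring).
      apply Rmult_le_compat_l; [exact HBd|].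
      apply pow_incr. split; [nra|].
      apply Rle_trans with (d * (r / 4)); [apply Rmult_le_compat_l; lra | right; unfold d; field; lra].
  - rewrite rsum_scal. rewrite (Rmult_comm 2). apply Rmult_le_compat_l; [exact HBd|].
    assert (E : forall n, rsum (fun j => (/ 2) ^ j) n = 2 - 2 * (/ 2) ^ n).
    { clear. induction n as [|n IH]; simpl; [ring|]. rewrite IH. field. }
    rewrite E. pose proof (pow_lt (/ 2) n ltac:(lra)). lra.
Qed.

Lemma csums_at_0 (a : nat -> C) : csums (fun k => a k * 0 ^ k)%C (a 0%nat).
Proof.
  apply Clim_ext_loc with (fun _ => a 0%nat); [|apply Clim_const].
  exists 1%nat. intros n Hn. induction Hn as [|n Hn IH].
  - simpl. ring.
  - cbn [csum]. rewrite <- IH. destruct n as [|n]; [lia|]. simpl. ring.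
Qed.

Lemma locally_pseries_lipschitz f s0 :
  locally_pseries f s0 -> exists K d, 0 <= K /\ 0 < d /\
    forall w, Cmod w <= d -> Cmod (f (s0 + w)%C - f s0) <= K * Cmod w.
Proof.
  intros [a [r [Hr H]]].
  assert (H2 : Cmod (r / 2)%R < r) by (rewrite Cmod_Rpos; lra).
  destruct (pseries_first_term a r _ 0 Hr (H _ H2)) as [K [HK B]].
  exists K, (r / 4). split; [exact HK|]. split; [lra|]. intros w Hw.
  assert (E : f s0 = a 0%nat).
  { assert (H0 : Cmod 0 < r) by (rewrite Cmod_0; lra). specialize (H _ H0).
    rewrite Cplus_0_r in H. apply (csums_unique _ _ _ H). apply csums_at_0. }
  rewrite E. apply (Clim_Cmod_le (fun n => csum (fun j => a j * w ^ j)%C (S n) - a 0%nat)%C).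
  - exists 0%nat. intros n _. exact (B w n Hw).
  - apply Clim_minus; [|apply Clim_const]. apply Clim_incr_1. apply H. lra.
Qed.

(** The coefficients vanish one after the other: once those before [k] do, [a k] is the limit of
    [f (s0 + w n) / w n ^ k]. *)
Lemma pseries_isolated_zeros (f : C -> C) (s0 : C) (w : nat -> C) :
  locally_pseries f s0 -> (forall n, w n <> 0 /\ f (s0 + w n)%C = 0) -> Clim w 0 ->
  exists d, 0 < d /\ forall v, Cmod v < d -> f (s0 + v)%C = 0.
Proof.
  intros [a [r [Hr H]]] Hw Lw.
  assert (Z : forall k, a k = 0).
  { intros k. induction k as [k IH] using (well_founded_induction Wf_nat.lt_wf).
    assert (H2 : Cmod (r / 2)%R < r) by (rewrite Cmod_Rpos; lra).
    destruct (pseries_first_term a r _ k Hr (H _ H2)) as [K [HK B]].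
    assert (S : forall n, Cmod (w n) <= r / 4 -> Cmod (a k) <= K * Cmod (w n)).
    { intros n Hn. destruct (Hw n) as [Hn0 Hn1].
      assert (Hn2 : Cmod (w n) < r) by lra. specialize (H _ Hn2). rewrite Hn1 in H.
      assert (E : forall p, csum (fun j => a j * w n ^ j)%C (k + p) =
         (w n ^ k * csum (fun j => a (k + j)%nat * w n ^ j) p)%C).
      { induction p as [|p IHp].
        - rewrite Nat.add_0_r. simpl. rewrite Cmult_0_r.
          clear - IH. induction k as [|k IHk]; [reflexivity|]. cbn [csum].
          rewrite IHk by (intros; apply IH; lia). rewrite IH by lia. ring.
        - rewrite Nat.add_succ_r. cbn [csum]. rewrite IHp, Cpow_add_r. ring. }
      assert (L : Clim (fun p => csum (fun j => a (k + j)%nat * w n ^ j)%C p) 0).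
      { replace (RtoC 0) with (/ (w n ^ k) * 0)%C by ring.
        apply Clim_ext with (fun p => / (w n ^ k) * csum (fun j => a j * w n ^ j) (k + p))%C.
        - intros p. rewrite E. field. now apply Cpow_nz.
        - apply Clim_scal. apply (Clim_subseq _ (fun p => (k + p)%nat)); [|exact H].
          apply eventually_subseq. intros p. lia. }
      replace (a k) with (- (0 - a k))%C by ring. rewrite Cmod_opp.
      apply (Clim_Cmod_le (fun p => csum (fun j => a (k + j)%nat * w n ^ j)%C (Datatypes.S p) - a k)%C).
      - exists 0%nat. intros p _. now apply B.
      - apply Clim_minus; [|apply Clim_const]. now apply Clim_incr_1. }
    apply Clim_mod in Lw.
    assert (Lw' : is_lim_seq (fun n => Cmod (w n)) 0).
    { eapply is_lim_seq_ext; [|exact Lw]. intros n. simpl. f_equal. ring. }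
    assert (Le : Rbar_le (Cmod (a k)) (Rbar_mult K 0)).
    { eapply is_lim_seq_le_loc; [|apply is_lim_seq_const | apply (is_lim_seq_scal_l _ K _ Lw')].
      apply is_lim_seq_spec in Lw'. assert (Hr4 : 0 < r / 4) by lra.
      destruct (Lw' (mkposreal _ Hr4)) as [N HN]. exists N. intros n Hn. apply S.
      specialize (HN n Hn). simpl in HN. rewrite Rminus_0_r, Rabs_pos_eq in HN by apply Cmod_ge_0. lra. }
    simpl in Le. rewrite Rmult_0_r in Le. apply Cmod_eq_0. pose proof (Cmod_ge_0 (a k)). lra. }
  exists r. split; [exact Hr|]. intros v Hv. specialize (H v Hv).
  apply (csums_unique _ _ _ H). apply Clim_ext with (fun _ => RtoC 0); [|apply Clim_const].
  intros n. induction n as [|n IH]; [reflexivity|]. cbn [csum]. rewrite <- IH, Z. ring.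
Qed.

Lemma locally_pseries_const c s0 : locally_pseries (fun _ => c) s0.
Proof.
  exists (fun k => match k with O => c | _ => 0 end), 1. split; [lra|]. intros w _.
  apply Clim_ext_loc with (fun _ => c); [|apply Clim_const].
  exists 1%nat. intros n Hn. induction Hn as [|n Hn IH].
  - simpl. ring.
  - cbn [csum]. rewrite <- IH. destruct n as [|n]; [lia|]. ring.
Qed.

Lemma locally_pseries_plus f g s0 :
  locally_pseries f s0 -> locally_pseries g s0 -> locally_pseries (fun s => f s + g s)%C s0.
Proof.
  intros [a [r [Hr H]]] [b [q [Hq G]]]. exists (fun k => a k + b k)%C, (Rmin r q).
  split; [now apply Rmin_pos|]. intros w Hw.
  apply csums_ext with (fun k => a k * w ^ k + b k * w ^ k)%C; [intros; ring|].
  apply csums_plus; [apply H | apply G].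
  - eapply Rlt_le_trans; [exact Hw | apply Rmin_l].
  - eapply Rlt_le_trans; [exact Hw | apply Rmin_r].
Qed.

(** Enough to multiply by the polynomials that occur, without products of power series. *)
Lemma locally_pseries_affine c f s0 :
  locally_pseries f s0 -> locally_pseries (fun s => (s + c) * f s)%C s0.
Proof.
  intros [a [r [Hr H]]].
  exists (fun k => match k with O => (s0 + c) * a 0%nat | S j => (s0 + c) * a (S j) + a j end)%C, r.
  split; [exact Hr|]. intros w Hw. specialize (H w Hw).
  set (b := (fun k => match k with O => (s0 + c) * a 0%nat | S j => (s0 + c) * a (S j) + a j end)%C).
  replace ((s0 + w + c) * f (s0 + w)%C)%C with ((s0 + c) * f (s0 + w)%C + w * f (s0 + w)%C)%C by ring.
  apply Clim_incr_1.
  assert (Q : forall n, csum (fun k => b k * w ^ k)%C (S n) =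
    ((s0 + c) * csum (fun k => a k * w ^ k) (S n) + w * csum (fun k => a k * w ^ k) n)%C).
  { intros n. induction n as [|n IH].
    - unfold b. simpl. ring.
    - replace (csum (fun k => b k * w ^ k) (S (S n)))%C
        with (csum (fun k => b k * w ^ k) (S n) + b (S n) * w ^ S n)%C by reflexivity.
      rewrite IH. unfold b. cbn [csum]. simpl Cpow. ring. }
  apply (Clim_ext (fun n => (s0 + c) * csum (fun k => a k * w ^ k) (S n) + w * csum (fun k => a k * w ^ k) n)%C).
  - intros n. symmetry. apply Q.
  - apply Clim_plus; apply Clim_scal; [now apply Clim_incr_1 | exact H].
Qed.

(** The half-circle from [3] to [-1] about the pole [1] of zeta; on it [Re s >= -1]. *)
Definition arc (u : R) : C := (1 + 2 * cos u, 2 * sin u).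

Lemma arc_lipschitz u v : Cmod (arc u - arc v) <= 2 * Rabs (u - v).
Proof.
  assert (D : forall t, Cderiv arc t (- 2 * sin t, 2 * cos t)).
  { intros t. split; unfold arc; simpl; auto_derive; try easy; ring. }
  replace (2 * Rabs (u - v)) with (Rabs (u - v) * 2) by ring.
  apply (Cderiv_MVT_abs arc (fun t => (- 2 * sin t, 2 * cos t))).
  - intros; apply D.
  - intros t _. split; simpl; apply (@ex_derive_continuous R_AbsRing R_NormedModule); auto_derive; easy.
  - intros t _. right. unfold Cmod; cbn [fst snd].
    replace ((- 2 * sin t) ^ 2 + (2 * cos t) ^ 2) with (2 ^ 2).
    + apply sqrt_pow2. lra.
    + pose proof (sin2_cos2 t) as H. unfold Rsqr in H. nra.
Qed.

Lemma arc_neq u v : 0 <= u < v -> v <= PI -> arc u <> arc v.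
Proof.
  intros H1 H2 E. injection E as E1 E2.
  assert (cos v < cos u) by (apply cos_decreasing_1; lra). lra.
Qed.

(** The supremum of the angles up to which [f] vanishes is an accumulation point of zeros, so
    [f] vanishes a little further; hence it is [PI]. *)
Lemma identity_along_arc (f : C -> C) :
  (forall u, 0 <= u <= PI -> locally_pseries f (arc u)) ->
  (forall s, 1 < Re s -> f s = 0) ->
  exists d, 0 < d /\ forall v, Cmod v < d -> f (- (1) + v)%C = 0.
Proof.
  intros Hf H1. pose proof PI_RGT_0 as Hpi.
  (* the angles up to which [f] vanishes; [Re (arc v) > 1] for [v <= PI / 4] *)
  set (E := fun u => u <= PI /\ forall v, 0 <= v <= u -> f (arc v) = 0).
  assert (E0 : E (PI / 4)).
  { split; [lra|]. intros v Hv. apply H1. unfold arc; simpl.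
    assert (0 < cos v) by (apply cos_gt_0; lra). lra. }
  destruct (completeness E) as [T [UB LUB]].
  { exists PI. intros u [Hu _]. exact Hu. }
  { now exists (PI / 4). }
  assert (T1 : PI / 4 <= T) by now apply UB.
  assert (T2 : T <= PI) by (apply LUB; intros u [Hu _]; exact Hu).
  assert (Good : forall v, 0 <= v < T -> f (arc v) = 0).
  { intros v Hv. destruct (Classical_Prop.classic (exists u, E u /\ v < u)) as [[u [[_ Hu] Hvu]]|N].
    - apply Hu. lra.
    - exfalso. assert (T <= v); [|lra]. apply LUB. intros u Hu.
      apply Rnot_lt_le. intros C. apply N. now exists u. }
  destruct (pseries_isolated_zeros f (arc T)
     (fun n => arc (T - T / 2 / INR (S n)) - arc T)%C) as [d [Hd Z]].
  - apply Hf. lra.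
  - intros n. pose proof (INR_S_pos n) as Hn.
    assert (Hn1 : 1 <= INR (S n)) by (change 1 with (INR 1); apply le_INR; lia).
    assert (P : 0 < T / 2 / INR (S n)) by (apply Rdiv_lt_0_compat; lra).
    assert (Q : T / 2 / INR (S n) <= T / 2).
    { apply Rle_div_l; [lra|]. rewrite <- (Rmult_1_r (T / 2)) at 1. apply Rmult_le_compat_l; lra. }
    split.
    + apply Cminus_eq_contra. apply arc_neq; lra.
    + replace (arc T + (arc (T - T / 2 / INR (S n)) - arc T))%C with (arc (T - T / 2 / INR (S n)))
        by ring.
      apply Good. lra.
  - apply Clim_incr_1 with (u := fun n => (arc (T - T / 2 / INR n) - arc T)%C).
    apply Clim_squeeze with (fun n => T / INR n); [|apply is_lim_seq_inv_INR].
    exists 1%nat. intros n Hn.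
    assert (Hn1 : 1 <= INR n) by (change 1 with (INR 1); now apply le_INR).
    replace (arc (T - T / 2 / INR n) - arc T - 0)%C with (arc (T - T / 2 / INR n) - arc T)%C by ring.
    eapply Rle_trans; [apply arc_lipschitz|].
    replace (T - T / 2 / INR n - T) with (- (T / 2 / INR n)) by ring.
    assert (0 < T / 2 / INR n) by (apply Rdiv_lt_0_compat; lra).
    rewrite Rabs_Ropp, Rabs_pos_eq by lra. right. field. lra.
  - assert (TP : T = PI).
    { apply Rle_antisym; [exact T2|]. apply Rnot_lt_le. intros C.
      (* the arc has speed [2], so [d / 4] more does not leave the disc of radius [d] *)
      set (e := Rmin (PI - T) (d / 4)).
      assert (He : 0 < e) by (apply Rmin_pos; lra).
      assert (He1 : e <= PI - T) by apply Rmin_l. assert (He2 : e <= d / 4) by apply Rmin_r.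
      assert (E (T + e)); [|specialize (UB (T + e) H); lra].
      split; [lra|]. intros v Hv. destruct (Rlt_dec v T) as [L|L]; [apply Good; lra|].
      replace (arc v) with (arc T + (arc v - arc T))%C by ring. apply Z.
      eapply Rle_lt_trans; [apply arc_lipschitz|]. rewrite Rabs_pos_eq; lra. }
    exists d. split; [exact Hd|]. intros v Hv. specialize (Z v Hv).
    replace (- (1))%C with (arc T); [exact Z|].
    rewrite TP. unfold arc. rewrite cos_PI, sin_PI. apply C_eq; simpl; ring.
Qed.

(** * The zeta function by Euler-Maclaurin summation *)

Definition zweight (x u : R) : R := B3 u / (x + u) ^ 3.

Lemma Ccont_zweight x u : 0 < x + u -> Ccont (fun v => RtoC (zweight x v)) u.
Proof.
  intros H. apply Ccont_RtoC, (@ex_derive_continuous R_AbsRing R_NormedModule).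
  unfold zweight, B3. auto_derive. repeat apply Rmult_integral_contrapositive_currified; lra.
Qed.

Lemma Cderiv_ln_shift (x u : R) : 0 < x + u ->
  Cderiv (fun v => RtoC (ln (x + v))) u (/ (x + u)%R)%C.
Proof.
  intros H. rewrite <- RtoC_inv by lra. apply Cderiv_RtoC. auto_derive; [exact H|]. field. lra.
Qed.

Lemma ln_ge_0 x : 1 <= x -> 0 <= ln x.
Proof. intros [H| <-]; [left; rewrite <- ln_1; apply ln_increasing; lra | rewrite ln_1; lra]. Qed.

Lemma exp_half_ln x : 0 < x -> exp (ln x / 2) = sqrt x.
Proof.
  intros H. symmetry. apply sqrt_lem_1; [lra | left; apply exp_pos |].
  rewrite <- exp_plus. replace (ln x / 2 + ln x / 2) with (ln x) by field. now apply exp_ln.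
Qed.

(** The weight decays like [x ^ (- 3)], so an integrand of growth [x ^ (3 / 2)] still leaves a
    summable [x ^ (- 3 / 2)]. *)
Lemma zweight_int_bound x g K :
  1 <= x -> 0 <= K -> (forall u, 0 <= u <= 1 -> Ccont g u) ->
  (forall u, 0 < u < 1 -> Cmod (g u) <= K * ((x + u) * sqrt (x + u))) ->
  Cmod (CInt (fun u => zweight x u * g u)%C 0 1) <= K * / (x * sqrt x).
Proof.
  intros Hx HK Hg H. replace (K * / (x * sqrt x)) with ((1 - 0) * (K * / (x * sqrt x))) by ring.
  apply CInt_norm_le_const; [lra| |].
  - apply Cexint_cont. rewrite Rmin_left, Rmax_right by lra. intros u Hu.
    apply Ccont_mult; [apply Ccont_zweight; lra | now apply Hg].
  - intros u Hu. rewrite Cmod_mult, Cmod_R. unfold zweight, Rdiv. rewrite Rabs_mult, Rabs_inv.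
    set (X := x + u) in *. assert (HX : x <= X) by (unfold X; lra).
    assert (S1 : 0 < sqrt x) by (apply sqrt_lt_R0; lra).
    assert (S2 : sqrt x <= sqrt X) by (apply sqrt_le_1; lra).
    assert (S3 : sqrt X * sqrt X = X) by (apply sqrt_sqrt; lra).
    assert (P3 : 0 < X ^ 3) by (apply pow_lt; lra).
    rewrite (Rabs_pos_eq (X ^ 3)) by lra.
    pose proof (B3_bound u ltac:(lra)) as HB. specialize (H u Hu). fold X in H.
    apply Rle_trans with (1 * / X ^ 3 * (K * (X * sqrt X))).
    + apply Rmult_le_compat; [| apply Cmod_ge_0 | | exact H].
      * apply Rmult_le_pos; [apply Rabs_pos | left; now apply Rinv_0_lt_compat].
      * apply Rmult_le_compat_r; [left; now apply Rinv_0_lt_compat | exact HB].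
    + replace (1 * / X ^ 3 * (K * (X * sqrt X))) with (K * / (X * sqrt X)).
      * apply Rmult_le_compat_l; [exact HK|]. apply Rinv_le_contravar; [nra|].
        apply Rmult_le_compat; lra.
      * replace (X ^ 3) with (X * X * (sqrt X * sqrt X)) by (rewrite S3; ring). field. lra.
Qed.

(** The coefficient of [h ^ j] in [em_zeta_term (s0 + h) k], from the exponential series of [exp (- h
    ln x)]. *)
Definition em_zeta_taylor (s0 : C) (j k : nat) : C :=
  CInt (fun u => zweight (INR (S k)) u * (Cexp (- (s0 * ln (INR (S k) + u)))
    * ((- ln (INR (S k) + u))%R ^ j / INR (fact j))))%C 0 1.

(** The Euler-Maclaurin error of [x ^ (- s)] from [k + 1] to [k + 2], up to a polynomial factor
    in [s]; see [em_zeta_term_em]. *)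
Definition em_zeta_term (s : C) (k : nat) : C :=
  CInt (fun u => zweight (INR (S k)) u * Cexp (- (s * ln (INR (S k) + u))))%C 0 1.

Definition em_zeta (s : C) : C := CSeries (em_zeta_term s).

Lemma INR_S_ge_1 k : 1 <= INR (S k).
Proof. change 1 with (INR 1). apply le_INR. lia. Qed.

Lemma Cmod_zpow (s : C) (b X : R) : 1 <= X -> - b <= Re s -> Cmod (Cexp (- (s * ln X))) <= exp (b * ln X).
Proof.
  intros HX Hs. rewrite Cmod_Cexp, re_opp, re_scal_r. apply exp_mono.
  pose proof (ln_ge_0 X HX). nra.
Qed.

Lemma Ccont_zpow (s : C) x u : 0 < x + u -> Ccont (fun v => Cexp (- (s * ln (x + v)))) u.
Proof.
  intros H. eapply Cderiv_Ccont. cder. now apply Cderiv_ln_shift.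
Qed.

Lemma Ccont_pow f u j : Ccont f u -> Ccont (fun v => f v ^ j)%C u.
Proof.
  intros H. induction j as [|j IH]; [apply (Ccont_const 1)|].
  apply (Ccont_ext (fun v => f v * f v ^ j)%C); [reflexivity|]. now apply Ccont_mult.
Qed.

Lemma Ccont_em_zeta_taylor_factor (s : C) x u j : 0 < x + u ->
  Ccont (fun v => Cexp (- (s * ln (x + v))) * ((- ln (x + v))%R ^ j / INR (fact j)))%C u.
Proof.
  intros H. apply Ccont_mult; [now apply Ccont_zpow|].
  apply Ccont_mult; [|apply Ccont_const]. apply Ccont_pow.
  apply (Ccont_ext (fun v => - RtoC (ln (x + v)))%C); [intros; now rewrite RtoC_opp|].
  apply Ccont_opp. eapply Cderiv_Ccont. now apply Cderiv_ln_shift.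
Qed.

Lemma em_zeta_term_bound s k : - (3 / 2) <= Re s -> Cmod (em_zeta_term s k) <= / (INR (S k) * sqrt (INR (S k))).
Proof.
  intros Hs. rewrite <- (Rmult_1_l (/ _)). pose proof (INR_S_ge_1 k).
  apply zweight_int_bound; [assumption | lra | |].
  - intros u Hu. apply Ccont_zpow. lra.
  - intros u Hu. eapply Rle_trans; [apply (Cmod_zpow s (3 / 2)); lra|].
    set (X := INR (S k) + u). assert (0 < X) by (unfold X; lra).
    replace (3 / 2 * ln X) with (ln X + ln X / 2) by field.
    rewrite exp_plus, exp_ln, exp_half_ln by assumption. lra.
Qed.

Lemma is_em_zeta s : - (3 / 2) <= Re s -> csums (em_zeta_term s) (em_zeta s).
Proof.
  intros Hs. apply CSeries_correct.
  apply csums_dominated with (fun k => / (INR (S k) * sqrt (INR (S k)))); [|apply ex_series_inv_32].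
  intros k. now apply em_zeta_term_bound.
Qed.

Lemma ex_em_zeta_taylor s0 j : - 1 <= Re s0 -> exists l, csums (em_zeta_taylor s0 j) l.
Proof.
  intros Hs. apply csums_dominated with (fun k => 2 ^ j * / (INR (S k) * sqrt (INR (S k)))).
  2:{ destruct ex_series_inv_32 as [l Hl]. exists (2 ^ j * l).
      exact (is_series_scal (2 ^ j) (fun k => / (INR (S k) * sqrt (INR (S k)))) l Hl). }
  intros k. pose proof (INR_S_ge_1 k). unfold em_zeta_taylor.
  apply zweight_int_bound; [assumption | apply pow_le; lra | |].
  - intros u Hu. apply Ccont_em_zeta_taylor_factor. lra.
  - intros u Hu. set (X := INR (S k) + u). assert (HX : 1 <= X) by (unfold X; lra).
    pose proof (ln_ge_0 X HX) as HL.
    rewrite Cmod_mult, Cmod_div, Cmod_pow, Cmod_R, Rabs_Ropp, !Cmod_Rpos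
      by (try apply pos_INR; try apply RtoC_neq, INR_fact_neq_0).
    rewrite (Rabs_pos_eq (ln X)) by lra.
    replace (2 ^ j * (X * sqrt X)) with (X * (2 ^ j * sqrt X)) by ring.
    apply Rmult_le_compat; [apply Cmod_ge_0 | | |].
    + apply Rmult_le_pos; [now apply pow_le|]. left. apply Rinv_0_lt_compat, INR_fact_lt_0.
    + eapply Rle_trans; [apply (Cmod_zpow s0 1); lra|]. rewrite Rmult_1_l, exp_ln; lra.
    + pose proof (pow_le_fact_exp (ln X / 2) j ltac:(lra)) as P. rewrite exp_half_ln in P by lra.
      replace (ln X ^ j / INR (fact j)) with (2 ^ j * ((ln X / 2) ^ j / INR (fact j))).
      * apply Rmult_le_compat_l; [apply pow_le; lra | exact P].
      * unfold Rdiv. rewrite <- Rmult_assoc, <- Rpow_mult_distr. do 2 f_equal. field.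
Qed.

Lemma csums_csum (F : nat -> nat -> C) (l : nat -> C) J :
  (forall j, csums (F j) (l j)) -> csums (fun k => csum (fun j => F j k) J) (csum l J).
Proof.
  intros H. induction J as [|J IH]; cbn [csum].
  - apply Clim_ext with (fun _ => RtoC 0); [|apply Clim_const].
    intros n. induction n as [|n IH]; [reflexivity|]. cbn [csum]. rewrite <- IH. ring.
  - now apply csums_plus.
Qed.

(** The sums over [j] and [k] may be exchanged because stopping the exponential series after [J]
    terms costs at most [2 ^ (- J) (k + 1) ^ (- 3 / 2)] in the [k]-th integral. *)
Lemma locally_pseries_em_zeta s0 : - 1 <= Re s0 -> locally_pseries em_zeta s0.
Proof.
  (* for [|h| < / 6] the factor [exp (3 |h| ln x)] is at most [sqrt x] *)
  intros Hs. exists (fun j => CSeries (em_zeta_taylor s0 j)), (/ 6). split; [lra|]. intros h Hh.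
  assert (Hre : - (3 / 2) <= Re (s0 + h)).
  { rewrite re_plus. pose proof (re_le_Cmod h) as R. apply Rabs_le_between in R. lra. }
  destruct ex_series_inv_32 as [G HG].
  apply Clim_squeeze with (fun J => G * (/ 2) ^ J).
  2:{ replace (Finite 0) with (Rbar_mult G 0) by (simpl; f_equal; ring).
      apply is_lim_seq_scal_l, is_lim_seq_geom. rewrite Rabs_pos_eq; lra. }
  exists 0%nat. intros J _.
  apply (csums_le (fun k => csum (fun j => em_zeta_taylor s0 j k * h ^ j) J - em_zeta_term (s0 + h) k)%C
    (fun k => (/ 2) ^ J * / (INR (S k) * sqrt (INR (S k))))).
  - intros k. pose proof (INR_S_ge_1 k) as Hk. set (x := INR (S k)) in *.
    assert (Ct : forall j, Cexint (fun u => zweight x u * (Cexp (- (s0 * ln (x + u)))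
      * ((- ln (x + u))%R ^ j / INR (fact j))))%C 0 1).
    { intros j. apply Cexint_cont. rewrite Rmin_left, Rmax_right by lra. intros u Hu.
      apply Ccont_mult; [apply Ccont_zweight; lra | apply Ccont_em_zeta_taylor_factor; lra]. }
    assert (Cz : Cexint (fun u => zweight x u * Cexp (- ((s0 + h) * ln (x + u))))%C 0 1).
    { apply Cexint_cont. rewrite Rmin_left, Rmax_right by lra. intros u Hu.
      apply Ccont_mult; [apply Ccont_zweight; lra | apply Ccont_zpow; lra]. }
    set (F := fun j u => (h ^ j * (zweight x u * (Cexp (- (s0 * ln (x + u)))
      * ((- ln (x + u))%R ^ j / INR (fact j)))))%C).
    assert (E : (csum (fun j => em_zeta_taylor s0 j k * h ^ j) J - em_zeta_term (s0 + h) k)%C =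
      CInt (fun u => zweight x u * (Cexp (- (s0 * ln (x + u))) *
        (cexp_poly J (- (h * ln (x + u))) - Cexp (- (h * ln (x + u))))))%C 0 1).
    { rewrite (csum_ext _ (fun j => CInt (F j) 0 1)).
      2:{ intros j _. unfold F. rewrite CInt_scal by apply Ct. apply Cmult_comm. }
      assert (CF : forall j, Cexint (F j) 0 1) by (intros j; apply Cexint_scal, Ct).
      rewrite <- (CInt_csum F) by exact CF. unfold em_zeta_term. fold x.
      rewrite <- CInt_minus by auto using Cexint_csum.
      apply CInt_ext; [lra|]. intros u _. unfold F, cexp_poly.
      replace (- ((s0 + h) * ln (x + u)))%C with (- (s0 * ln (x + u)) + - (h * ln (x + u)))%C by ring.
      rewrite Cexp_plus.
      rewrite (csum_ext _ (fun j => (zweight x u * Cexp (- (s0 * ln (x + u))))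
         * ((- (h * ln (x + u))) ^ j / INR (fact j)))%C).
      2:{ intros j _. replace (- (h * ln (x + u)))%C with (h * (- ln (x + u))%R)%C
            by (rewrite RtoC_opp; ring). rewrite Cpow_mult_l. unfold Cdiv. ring. }
      rewrite csum_scal. ring. }
    rewrite E. apply zweight_int_bound; [exact Hk | apply pow_le; lra | |].
    + intros u Hu. apply Ccont_mult; [apply Ccont_zpow; lra|]. apply Ccont_minus; [|apply Ccont_zpow; lra].
      unfold cexp_poly. clear - Hu Hk.
      assert (Cl : Ccont (fun v => - (h * ln (x + v)))%C u).
      { eapply Cderiv_Ccont. cder. apply Cderiv_ln_shift. lra. }
      induction J as [|J IH]; cbn [csum]; [apply Ccont_const|].
      apply Ccont_plus; [exact IH|]. apply Ccont_mult; [|apply Ccont_const]. now apply Ccont_pow.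
    + intros u Hu. set (X := x + u). assert (HX : 1 <= X) by (unfold X; lra).
      pose proof (ln_ge_0 X HX) as HL. rewrite Cmod_mult.
      replace ((/ 2) ^ J * (X * sqrt X)) with (X * ((/ 2) ^ J * sqrt X)) by ring.
      apply Rmult_le_compat; [apply Cmod_ge_0 | apply Cmod_ge_0 | |].
      * eapply Rle_trans; [apply (Cmod_zpow s0 1); lra|]. rewrite Rmult_1_l, exp_ln; lra.
      * rewrite Cmod_minus_sym. eapply Rle_trans; [apply cexp_taylor_geom|].
        apply Rmult_le_compat_l; [apply pow_le; lra|]. rewrite <- exp_half_ln by lra.
        apply exp_mono. rewrite Cmod_opp, Cmod_mult, Cmod_Rpos by exact HL. nra.
  - rewrite Rmult_comm.
    exact (is_series_scal ((/ 2) ^ J) (fun k => / (INR (S k) * sqrt (INR (S k)))) G HG).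
  - apply (csums_plus _ (fun k => - em_zeta_term (s0 + h) k)%C).
    + apply (csums_csum (fun j k => em_zeta_taylor s0 j k * h ^ j)%C).
      intros j. rewrite Cmult_comm. eapply csums_ext; [intros; apply Cmult_comm|].
      apply csums_scal. now apply CSeries_correct, ex_em_zeta_taylor.
    + apply csums_ext with (fun k => - (1) * em_zeta_term (s0 + h) k)%C; [intros; ring|].
      replace (- em_zeta (s0 + h))%C with (- (1) * em_zeta (s0 + h))%C by ring.
      apply csums_scal. now apply is_em_zeta.
Qed.

Definition zpow (s : C) (x : R) : C := Cexp (- (s * ln x)).

(** Integration by parts until [B3] has become constant. *)
Lemma em_zeta_term_em (s : C) k : s <> 1 -> let x := INR (S k) in
  (s * (s + 1) * (s + 2) / 6 * em_zeta_term s k =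
   ((x + 1)%R * zpow s (x + 1) - x * zpow s x) / (1 - s) - (zpow s x + zpow s (x + 1)) / 2
   - s * (zpow s (x + 1) / (x + 1)%R - zpow s x / x) / 12)%C.
Proof.
  intros Hs x. assert (Hx : 1 <= x) by apply INR_S_ge_1.
  assert (Hs1 : (1 - s)%C <> 0) by (apply Cminus_eq_contra; congruence).
  set (A := fun u : R => (- (1 / 6) * ((u ^ 3 - 3 / 2 * u ^ 2 + u / 2) * s * (s + 1) * zpow s (x + u) / (x + u) ^ 2
    + (3 * u ^ 2 - 3 * u + 1 / 2) * s * zpow s (x + u) / (x + u)
    + (6 * u - 3) * zpow s (x + u) - 6 * ((x + u) * zpow s (x + u) / (1 - s))))%C).
  assert (Hn : forall u, 0 <= u -> (x + u)%C <> 0)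
    by (intros u Hu; rewrite <- RtoC_plus; apply RtoC_neq; lra).
  unfold em_zeta_term. fold x.
  rewrite <- CInt_scal.
  2:{ apply Cexint_cont. rewrite Rmin_left, Rmax_right by lra. intros u Hu.
      apply Ccont_mult; [apply Ccont_zweight; lra | apply Ccont_zpow; lra]. }
  rewrite (CInt_FTC A); [|lra| |].
  - unfold A. rewrite !RtoC_plus. rewrite Rplus_0_r.
    specialize (Hn 0 (Rle_refl 0)) as H0. specialize (Hn 1 Rle_0_1) as H1.
    rewrite Cplus_0_r in H0. field. repeat split; auto.
  - intros u [Hu _]. unfold A, zpow. eapply Cderiv_val.
    + cder; try (apply Cderiv_ln_shift; lra); try apply Cpow_nz; auto.
    + cbv beta. unfold zweight. rewrite RtoC_div by (apply pow_nonzero; lra).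
      rewrite B3_C, RtoC_pow, RtoC_plus. cnum. field. auto.
  - intros u [Hu _]. apply Ccont_mult; [apply Ccont_const|].
    apply Ccont_mult; [apply Ccont_zweight; lra | apply Ccont_zpow; lra].
Qed.

Lemma zpow_1 s : zpow s 1 = 1.
Proof. unfold zpow. rewrite ln_1. replace (- (s * 0))%C with (RtoC 0) by ring. apply Cexp_0. Qed.

Lemma em_zeta_term_em_sum (s : C) n : s <> 1 -> let y := INR (S n) in
  (s * (s + 1) * (s + 2) / 6 * csum (em_zeta_term s) n =
   (y * zpow s y - 1) / (1 - s) - (csum (fun k => zpow s (INR (S k))) n + zpow s y / 2 - 1 / 2)
   - s * (zpow s y / y - 1) / 12)%C.
Proof.
  intros Hs. assert (Hs1 : (1 - s)%C <> 0) by (apply Cminus_eq_contra; congruence).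
  induction n as [|n IH]; cbn zeta in *.
  - simpl. rewrite zpow_1. field. auto.
  - cbn [csum]. rewrite Cmult_plus_distr_l, IH, (em_zeta_term_em s n Hs). cbn zeta.
    rewrite (S_INR (S n)). set (x := INR (S n)).
    assert (Hx : 1 <= x) by apply INR_S_ge_1. rewrite RtoC_plus.
    field. repeat split; auto; try (apply RtoC_neq; lra). rewrite <- RtoC_plus. apply RtoC_neq; lra.
Qed.

Lemma zpow_decay s : 1 < Re s -> Clim (fun n => INR (S n) * zpow s (INR (S n)))%C 0.
Proof.
  intros Hs. apply Clim_squeeze with (fun n => exp (- ((Re s - 1) * ln (INR (S n))))).
  - exists 0%nat. intros n _. pose proof (INR_S_pos n).
    replace (INR (S n) * zpow s (INR (S n)) - 0)%C with (INR (S n) * zpow s (INR (S n)))%C by ring.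
    unfold zpow. rewrite Cmod_mult, Cmod_Rpos, Cmod_Cexp by lra.
    rewrite <- (exp_ln (INR (S n))) at 1 by lra. rewrite <- exp_plus, re_opp, re_scal_r.
    right. f_equal. ring.
  - apply (is_lim_seq_incr_1 (fun n => exp (- ((Re s - 1) * ln (INR n))))).
    apply (is_lim_comp_seq exp _ m_infty); [apply is_lim_exp_m | exists 0%nat; discriminate |].
    apply (is_lim_seq_opp (fun n => (Re s - 1) * ln (INR n)) p_infty).
    replace p_infty with (Rbar_mult (Re s - 1) p_infty).
    + apply is_lim_seq_scal_l. apply (is_lim_comp_seq ln _ p_infty); [apply is_lim_ln_p | exists 0%nat; discriminate |].
      apply is_lim_seq_INR.
    + simpl. destruct (Rle_dec 0 (Re s - 1)) as [r|r]; [|lra].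
      destruct (Rle_lt_or_eq_dec 0 (Re s - 1) r); [reflexivity | lra].
Qed.

(** Euler-Maclaurin summation of the Dirichlet series: for [Re s > 1] the boundary terms at
    infinity vanish. *)
Lemma zeta_em zeta s : is_riemann_zeta zeta -> 1 < Re s ->
  (s * (s + 1) * (s + 2) / 6 * em_zeta s = 1 / (s - 1) - zeta s + 1 / 2 + s / 12)%C.
Proof.
  intros [_ Hz] Hs. specialize (Hz s Hs). apply is_series_csums in Hz.
  assert (Hs1 : s <> 1) by (intros ->; simpl in Hs; lra).
  assert (Hs2 : (1 - s)%C <> 0) by (apply Cminus_eq_contra; congruence).
  assert (Hs3 : (s - 1)%C <> 0) by (apply Cminus_eq_contra; congruence).
  assert (D := zpow_decay s Hs).
  assert (D2 : forall P : nat -> R, (forall n, 0 <= P n <= INR (S n)) ->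
     Clim (fun n => P n * zpow s (INR (S n)))%C 0).
  { intros P HP. apply Clim_mod in D. apply Clim_squeeze with (2 := D). exists 0%nat. intros n _.
    specialize (HP n). rewrite !Cmod_minus_sym with (y := RtoC 0).
    replace (0 - P n * zpow s (INR (S n)))%C with (- (P n * zpow s (INR (S n))))%C by ring.
    replace (0 - INR (S n) * zpow s (INR (S n)))%C with (- (INR (S n) * zpow s (INR (S n))))%C by ring.
    rewrite !Cmod_opp, !Cmod_mult, !Cmod_Rpos by lra.
    apply Rmult_le_compat_r; [apply Cmod_ge_0 | lra]. }
  assert (D3 := D2 (fun _ => 1) (fun n => conj Rle_0_1 (INR_S_ge_1 n))).
  assert (D4 := D2 (fun n => / INR (S n))).
  assert (H4 : forall n, 0 <= / INR (S n) <= INR (S n)).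
  { intros n. pose proof (INR_S_ge_1 n). split; [left; apply Rinv_0_lt_compat; lra|].
    apply Rle_trans with 1; [|assumption]. rewrite <- Rinv_1. apply Rinv_le_contravar; lra. }
  specialize (D4 H4). cbv beta in D3, D4.
  apply (Clim_unique (fun n => s * (s + 1) * (s + 2) / 6 * csum (em_zeta_term s) n)%C).
  { apply Clim_scal, is_em_zeta. lra. }
  replace (1 / (s - 1) - zeta s + 1 / 2 + s / 12)%C with
    (/ (1 - s) * (0 - 1) - (zeta s + / 2 * 0 - 1 / 2) - s / 12 * (0 - 1))%C by (field; auto).
  apply Clim_ext with (fun n => / (1 - s) * (INR (S n) * zpow s (INR (S n)) - 1)
    - (csum (fun k => zpow s (INR (S k))) n + / 2 * (1 * zpow s (INR (S n))) - 1 / 2)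
    - s / 12 * ((/ INR (S n))%R * zpow s (INR (S n)) - 1))%C.
  { intros n. rewrite (em_zeta_term_em_sum s n Hs1). cbn zeta. pose proof (INR_S_pos n).
    rewrite RtoC_inv by lra. field. split; [apply RtoC_neq; lra | auto]. }
  apply Clim_minus; [apply Clim_minus|].
  - apply Clim_scal, Clim_minus; [exact D | apply Clim_const].
  - apply Clim_minus; [|apply Clim_const]. apply Clim_plus; [|now apply Clim_scal].
    eapply Clim_ext; [|exact Hz]. intros n. apply csum_ext. intros k _. unfold zpow. f_equal. ring.
  - apply Clim_scal, Clim_minus; [exact D4 | apply Clim_const].
Qed.

(** * The derivative of zeta at [-1] *)

Lemma locally_pseries_scal c f s0 :
  locally_pseries f s0 -> locally_pseries (fun s => c * f s)%C s0.
Proof.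
  intros [a [r [Hr H]]]. exists (fun k => c * a k)%C, r. split; [exact Hr|]. intros w Hw.
  apply csums_ext with (fun k => c * (a k * w ^ k))%C; [intros; ring|]. now apply csums_scal, H.
Qed.

(** Multiplied by [s - 1], both sides of [zeta_em] are analytic all along [arc]. *)
Lemma zeta_near_m1 zeta : is_riemann_zeta zeta ->
  exists d, 0 < d /\ forall v, Cmod v < d -> let s := (- (1) + v)%C in
    ((s - 1) * zeta s = 1 + (s - 1) * (1 / 2 + s / 12) - (s - 1) * s * (s + 1) * (s + 2) / 6 * em_zeta s)%C.
Proof.
  intros Hz.
  (* the asserted identity as a sum of nested products by factors [s + c] *)
  set (f := fun s : C => ((s + - (1)) * zeta s + (- (1) + (s + - (1)) * ((s + 6) * (- (1 / 12))
     + (s + 0) * ((s + 1) * ((s + 2) * (1 / 6 * em_zeta s))))))%C).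
  destruct (identity_along_arc f) as [d [Hd H]].
  - intros u Hu. unfold f.
    assert (Hre : - 1 <= Re (arc u)) by (unfold arc; simpl; pose proof (COS_bound u); lra).
    assert (Hn1 : arc u <> 1).
    { intros E. injection E as E1 E2. pose proof (sin2_cos2 u) as S. unfold Rsqr in S. nra. }
    apply locally_pseries_plus.
    + apply locally_pseries_affine. exact (analytic_locally_pseries _ _ _ (proj1 Hz) Hn1).
    + apply locally_pseries_plus; [apply locally_pseries_const|].
      apply locally_pseries_affine, locally_pseries_plus.
      * apply locally_pseries_affine, locally_pseries_const.
      * do 3 apply locally_pseries_affine. now apply locally_pseries_scal, locally_pseries_em_zeta.
  - intros s Hs. unfold f. pose proof (zeta_em zeta s Hz Hs) as E.
    assert (Hs3 : (s - 1)%C <> 0).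
    { apply Cminus_eq_contra. intros ->. simpl in Hs. lra. }
    replace ((s + 0) * ((s + 1) * ((s + 2) * (1 / 6 * em_zeta s))))%C
      with (s * (s + 1) * (s + 2) / 6 * em_zeta s)%C by field.
    rewrite E. field. exact Hs3.
  - exists d. split; [exact Hd|]. intros v Hv s. specialize (H v Hv). fold s in H. unfold f in H.
    apply Ceq_minus. rewrite <- H. field.
Qed.

Lemma is_lim_linear (g : R -> R) (a l K d : R) :
  0 < d -> (forall x, x <> a -> Rabs (x - a) < d -> Rabs (g x - l) <= K * Rabs (x - a)) ->
  is_lim g a l.
Proof.
  intros Hd H. apply is_lim_spec. intros eps.
  assert (He : 0 < eps / (Rabs K + 1)).
  { apply Rdiv_lt_0_compat; [apply cond_pos | pose proof (Rabs_pos K); lra]. }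
  assert (Hm : 0 < Rmin d (eps / (Rabs K + 1))) by (apply Rmin_pos; lra).
  exists (mkposreal _ Hm). intros x Hx Hxa.
  assert (Hx' : Rabs (x - a) < Rmin d (eps / (Rabs K + 1))) by exact Hx.
  pose proof (Rmin_l d (eps / (Rabs K + 1))). pose proof (Rmin_r d (eps / (Rabs K + 1))).
  specialize (H x Hxa ltac:(lra)). eapply Rle_lt_trans; [exact H|].
  pose proof (Rabs_pos (x - a)). pose proof (Rle_abs K). pose proof (Rabs_pos K).
  apply Rle_lt_trans with ((Rabs K + 1) * Rabs (x - a)); [apply Rmult_le_compat_r; lra|].
  apply Rlt_le_trans with ((Rabs K + 1) * (eps / (Rabs K + 1))).
  - apply Rmult_lt_compat_l; lra.
  - right. field. lra.
Qed.

(** [C_derive] is a limit along the real direction, so real increments decide. *)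
Lemma C_derive_unique_real (f : C -> C) (z0 l : C) (K d : R) :
  0 < d ->
  (forall h : R, h <> 0 -> Rabs h < d -> Cmod ((f (z0 + h)%C - f z0) / h - l) <= K * Rabs h) ->
  C_derive f z0 = l.
Proof.
  intros Hd H. unfold C_derive, C_lim.
  assert (E : forall x, (x, snd z0) = (z0 + (x - fst z0)%R)%C).
  { intros x. destruct z0 as [a b]. apply C_eq; simpl; ring. }
  assert (G : forall x, x <> fst z0 -> Rabs (x - fst z0) < d ->
     Cmod ((f (x, snd z0) - f z0) / ((x, snd z0) - z0) - l) <= K * Rabs (x - fst z0)).
  { intros x Hx Hxd. rewrite E. set (h := x - fst z0) in *.
    replace (z0 + h - z0)%C with (RtoC h) by ring. apply H; [unfold h; lra | exact Hxd]. }
  apply C_eq.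
  - change (Re (?a, ?b)) with a.
    rewrite (is_lim_unique _ _ (Re l)); [reflexivity|].
    apply (is_lim_linear _ _ _ K d Hd). intros x Hx Hxd. specialize (G x Hx Hxd).
    eapply Rle_trans; [|exact G]. rewrite <- (re_minus _ l). apply re_le_Cmod.
  - change (Im (?a, ?b)) with b.
    rewrite (is_lim_unique _ _ (Im l)); [reflexivity|].
    apply (is_lim_linear _ _ _ K d Hd). intros x Hx Hxd. specialize (G x Hx Hxd).
    eapply Rle_trans; [|exact G]. rewrite <- (im_minus _ l). apply im_le_Cmod.
Qed.

(** The polynomial factor of [em_zeta] vanishes at [-1]; so the derivative of zeta there involves the
    value of [em_zeta] only. *)
Lemma zeta_derive_m1 zeta : is_riemann_zeta zeta ->
  C_derive zeta (- (1)) = (- (1 / 6) + em_zeta (- (1)) / 6)%C.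
Proof.
  intros Hz. destruct (zeta_near_m1 zeta Hz) as [d [Hd H]].
  (* the difference quotient of zeta at [-1] with step [h] is [Q (-1 + h) + / (2 (h - 2))] *)
  set (Q := fun s : C => (1 / 12 + (s + 0) * ((s + 2) * (- (1 / 6) * em_zeta s)))%C).
  assert (HQ : locally_pseries Q (- (1))).
  { apply locally_pseries_plus; [apply locally_pseries_const|].
    do 2 apply locally_pseries_affine. apply locally_pseries_scal, locally_pseries_em_zeta. simpl; lra. }
  destruct (locally_pseries_lipschitz Q _ HQ) as [K [e [HK [He HL]]]].
  apply (C_derive_unique_real _ _ _ (K + / 4) (Rmin (Rmin d e) 1)).
  { apply Rmin_pos; [now apply Rmin_pos | lra]. }
  intros h Hh Hhd.
  assert (D1 : Rabs h < d) by (eapply Rlt_le_trans; [exact Hhd | eapply Rle_trans; [apply Rmin_l | apply Rmin_l]]).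
  assert (D2 : Rabs h < e) by (eapply Rlt_le_trans; [exact Hhd | eapply Rle_trans; [apply Rmin_l | apply Rmin_r]]).
  assert (D3 : Rabs h < 1) by (eapply Rlt_le_trans; [exact Hhd | apply Rmin_r]).
  assert (Hh0 : RtoC h <> 0) by now apply RtoC_neq.
  assert (Hh2 : (h - 2)%C <> 0).
  { rewrite <- RtoC_minus. apply RtoC_neq. apply Rabs_def2 in D3. lra. }
  assert (E1 : zeta (- (1) + h)%C = (1 / (h - 2) + (1 / 2 + (- (1) + h) / 12)
     - (- (1) + h) * h * (1 + h) / 6 * em_zeta (- (1) + h))%C).
  { specialize (H h ltac:(rewrite Cmod_R; exact D1)). cbn zeta in H.
    replace (zeta (- (1) + h)%C) with ((- (1) + h - 1) * zeta (- (1) + h) / (h - 2))%C.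
    - rewrite H. field. exact Hh2.
    - replace (- (1) + h - 1)%C with (h - 2)%C by ring. field. exact Hh2. }
  assert (E0 : zeta (- (1))%C = (- (1 / 12))%C).
  { specialize (H 0 ltac:(rewrite Cmod_0; exact Hd)). cbn zeta in H. rewrite Cplus_0_r in H.
    replace (zeta (- (1))%C) with ((- (1) - 1) * zeta (- (1)) / (- (2)))%C by field.
    rewrite H. field. }
  rewrite E1, E0.
  specialize (HL h ltac:(rewrite Cmod_R; lra)). rewrite Cmod_R in HL.
  replace ((1 / (h - 2) + (1 / 2 + (- (1) + h) / 12) - (- (1) + h) * h * (1 + h) / 6 * em_zeta (- (1) + h)
     - - (1 / 12)) / h - (- (1 / 6) + em_zeta (- (1)) / 6))%C
   with ((Q (- (1) + h)%C - Q (- (1))%C) + / 4 * (h * / (h - 2)))%C.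
  2:{ unfold Q. field. auto. }
  eapply Rle_trans; [apply Cmod_triangle|].
  assert (Hq : Cmod (/ 4 * (h * / (h - 2))) <= / 4 * Rabs h).
  { rewrite !Cmod_mult, Cmod_inv, Cmod_inv, (Cmod_Rpos 4), (Cmod_R h) by first [exact Hh2 | lra | apply RtoC_neq; lra].
    apply Rmult_le_compat_l; [lra|]. rewrite <- (Rmult_1_r (Rabs h)) at 2.
    apply Rmult_le_compat_l; [apply Rabs_pos|]. rewrite <- Rinv_1. apply Rinv_le_contravar; [lra|].
    rewrite <- RtoC_minus, Cmod_R. apply Rabs_def2 in D3. rewrite Rabs_left; lra. }
  lra.
Qed.

(** At [s = -1] the terms of [em_zeta] are six times the Euler-Maclaurin errors of [x log x]. *)
Theorem glaisher_em zeta : is_riemann_zeta zeta ->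
  csums (fun k => em_delta (INR (S k))) (C_derive zeta (- (1)) + 1 / 6)%C.
Proof.
  intros Hz. rewrite (zeta_derive_m1 zeta Hz).
  replace (- (1 / 6) + em_zeta (- (1)) / 6 + 1 / 6)%C with (/ 6 * em_zeta (- (1)))%C by field.
  assert (Hm : csums (em_zeta_term (- (1))) (em_zeta (- (1)))) by (apply is_em_zeta; simpl; lra).
  apply csums_ext with (fun k => / 6 * em_zeta_term (- (1)) k)%C; [|now apply csums_scal].
  intros k. pose proof (INR_S_ge_1 k) as Hk. set (x := INR (S k)) in *.
  rewrite em_delta_int by (apply slit_RtoC; lra).
  unfold em_zeta_term. fold x. rewrite <- CInt_scal.
  - apply CInt_ext; [lra|]. intros u Hu. unfold zweight.
    replace (- (- (1) * ln (x + u)))%C with (RtoC (ln (x + u))) by ring.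
    rewrite Cexp_RtoC, exp_ln, RtoC_div, RtoC_pow, RtoC_plus by (try apply pow_nonzero; lra).
    field. rewrite <- RtoC_plus. apply RtoC_neq. lra.
  - apply Cexint_cont. rewrite Rmin_left, Rmax_right by lra. intros u Hu.
    apply Ccont_mult; [apply Ccont_zweight; lra | apply Ccont_zpow; lra].
Qed.

(** * Euler's constant and Stirling's formula *)

Lemma ln_le_minus_1 x : 0 < x -> ln x <= x - 1.
Proof.
  intros H. pose proof (exp_ineq1_le (ln x)) as E. rewrite exp_ln in E by exact H. lra.
Qed.

Lemma ln_1_plus_bounds y : 0 < y -> y - y ^ 2 <= ln (1 + y) <= y.
Proof.
  intros H. split.
  - pose proof (ln_le_minus_1 (/ (1 + y)) ltac:(apply Rinv_0_lt_compat; lra)) as L.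
    rewrite ln_Rinv in L by lra.
    assert (y - y ^ 2 <= 1 - / (1 + y)); [|lra].
    replace (1 - / (1 + y)) with (y / (1 + y)) by (field; lra).
    apply Rle_div_r; [lra|]. nra.
  - pose proof (ln_le_minus_1 (1 + y) ltac:(lra)). lra.
Qed.

Lemma ln_S_minus_ln n : (1 <= n)%nat -> ln (INR (S n)) - ln (INR n) = ln (1 + / INR n).
Proof.
  intros H. assert (0 < INR n) by (apply lt_0_INR; lia).
  rewrite S_INR. replace (INR n + 1) with (INR n * (1 + / INR n)) by (field; lra).
  assert (0 < / INR n) by now apply Rinv_0_lt_compat. rewrite ln_mult by lra. ring.
Qed.

Definition harmonic (n : nat) : R := rsum (fun k => / INR (S k)) n.

Lemma ln_S_minus_ln_lim : is_lim_seq (fun n => ln (INR (S n)) - ln (INR n)) 0.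
Proof.
  apply is_lim_seq_le_le_loc with (fun _ => 0) (fun n => 1 / INR n);
    [|apply is_lim_seq_const | apply is_lim_seq_inv_INR].
  exists 1%nat. intros n Hn. rewrite ln_S_minus_ln by exact Hn.
  assert (H : 0 < INR n) by (apply lt_0_INR; lia).
  assert (H1 : 0 < / INR n) by now apply Rinv_0_lt_compat.
  split; [rewrite <- ln_1; left; apply ln_increasing; lra|].
  pose proof (ln_1_plus_bounds _ H1). unfold Rdiv. lra.
Qed.

(** Convergence follows from [0 <= y - ln (1 + y) <= y ^ 2] at [y = / k]. *)
Lemma is_lim_euler_gamma : is_lim_seq (fun n => harmonic n - ln (INR n)) euler_gamma.
Proof.
  set (t := fun k => / INR (S k) - (ln (INR (S (S k))) - ln (INR (S k)))).
  assert (Ht : forall k, 0 <= t k <= / INR (S k) ^ 2).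
  { intros k. unfold t. rewrite ln_S_minus_ln by lia. pose proof (INR_S_pos k) as H.
    pose proof (ln_1_plus_bounds (/ INR (S k)) ltac:(now apply Rinv_0_lt_compat)) as L.
    rewrite <- pow_inv. lra. }
  destruct (@ex_series_le R_AbsRing R_CompleteNormedModule t (fun k => / INR (S k) ^ 2)) as [g Hg].
  { intros k. change (norm (t k)) with (Rabs (t k)). rewrite Rabs_pos_eq; apply Ht. }
  { apply ex_series_inv_sq. }
  apply is_series_rsum in Hg.
  assert (E : forall n, rsum t n = harmonic n - ln (INR (S n))).
  { induction n as [|n IH].
    - unfold harmonic; cbn [rsum]. replace (INR 1) with 1 by reflexivity. rewrite ln_1. ring.
    - unfold harmonic in *. cbn [rsum]. rewrite IH. unfold t. ring. }
  assert (L : is_lim_seq (fun n => harmonic n - ln (INR n)) g).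
  { replace (Finite g) with (Finite (g + 0)) by (f_equal; ring).
    apply is_lim_seq_ext with (fun n => rsum t n + (ln (INR (S n)) - ln (INR n))).
    - intros n. rewrite E. ring.
    - apply is_lim_seq_plus'; [exact Hg | apply ln_S_minus_ln_lim]. }
  assert (Eg : euler_gamma = g).
  { unfold euler_gamma. rewrite (is_lim_seq_unique _ g); [reflexivity|].
    eapply is_lim_seq_ext_loc; [|exact L]. exists 1%nat. intros n Hn. f_equal.
    unfold harmonic. clear - Hn. induction Hn as [|n Hn IH].
    - rewrite sum_n_n. simpl. ring.
    - rewrite sum_n_Sm by lia. rewrite <- IH. reflexivity. }
  rewrite Eg. exact L.
Qed.

Definition wallis (n : nat) : R := RInt (fun x => sin x ^ n) 0 (PI / 2).

Lemma ex_RInt_sin_pow n a b : ex_RInt (fun x => sin x ^ n) a b.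
Proof.
  apply (@ex_RInt_continuous R_CompleteNormedModule). intros x _.
  apply (@ex_derive_continuous R_AbsRing R_NormedModule). auto_derive. easy.
Qed.

Lemma wallis_rec n : INR (n + 2) * wallis (n + 2) = INR (n + 1) * wallis n.
Proof.
  assert (H : is_RInt (fun x => INR (n + 2) * sin x ^ (n + 2) - INR (n + 1) * sin x ^ n) 0 (PI / 2)
    (- cos (PI / 2) * sin (PI / 2) ^ (n + 1) - - cos 0 * sin 0 ^ (n + 1))).
  { apply (is_RInt_derive (fun x => - cos x * sin x ^ (n + 1))).
    - intros x _. auto_derive; [easy|].
      replace (n + 1)%nat with (S n) by lia. replace (n + 2)%nat with (S (S n)) by lia. cbn [pred].
      pose proof (sin2_cos2 x) as SC. unfold Rsqr in SC. rewrite (S_INR (S n)).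
      set (p := sin x ^ n). replace (sin x ^ S n) with (sin x * p) by reflexivity.
      replace (sin x ^ S (S n)) with (sin x * (sin x * p)) by reflexivity.
      replace (- cos x * (1 * cos x * (INR (S n) * p))) with (- (cos x * cos x) * (INR (S n) * p)) by ring.
      replace (cos x * cos x) with (1 - sin x * sin x) by lra. ring.
    - intros x _. apply (@ex_derive_continuous R_AbsRing R_NormedModule). auto_derive. easy. }
  rewrite cos_PI2, sin_0, pow_i in H by lia.
  apply (@is_RInt_unique R_CompleteNormedModule) in H.
  pose proof (ex_RInt_sin_pow (n + 2) 0 (PI / 2)) as E2. pose proof (ex_RInt_sin_pow n 0 (PI / 2)) as E0.
  rewrite RInt_minusR, (RInt_scalR _ _ _ _ E2), (RInt_scalR _ _ _ _ E0) in H
    by (apply ex_RInt_scalR; assumption).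
  fold (wallis (n + 2)) (wallis n) in H. lra.
Qed.

Lemma wallis_decr n : wallis (S n) <= wallis n.
Proof.
  pose proof PI_RGT_0. apply RInt_le; [lra | apply ex_RInt_sin_pow | apply ex_RInt_sin_pow |].
  intros x Hx. pose proof (SIN_bound x). pose proof (sin_gt_0 x ltac:(lra) ltac:(lra)) as S.
  pose proof (pow_lt _ n S). simpl. nra.
Qed.

Lemma wallis_0 : wallis 0 = PI / 2.
Proof.
  unfold wallis. simpl. rewrite (@RInt_const R_CompleteNormedModule).
  unfold scal; simpl; unfold mult; simpl. ring.
Qed.

Lemma wallis_1 : wallis 1 = 1.
Proof.
  unfold wallis. apply is_RInt_unique.
  replace 1 with (- cos (PI / 2) - - cos 0) by (rewrite cos_PI2, cos_0; ring).
  apply (is_RInt_derive (fun x => - cos x)).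
  - intros x _. auto_derive; [easy|]. ring.
  - intros x _. apply (@ex_derive_continuous R_AbsRing R_NormedModule). auto_derive. easy.
Qed.

Lemma wallis_prod n : INR (n + 1) * (wallis n * wallis (S n)) = PI / 2.
Proof.
  induction n as [|n IH].
  - rewrite wallis_0, wallis_1. simpl. ring.
  - rewrite <- IH. pose proof (wallis_rec n) as H.
    replace (S n + 1)%nat with (n + 2)%nat by lia. replace (S (S n)) with (n + 2)%nat by lia.
    replace (INR (n + 2) * (wallis (S n) * wallis (n + 2)))
      with (INR (n + 2) * wallis (n + 2) * wallis (S n)) by ring. rewrite H. ring.
Qed.

(** The central binomial coefficient over [4 ^ n]. *)
Definition central (n : nat) : R := INR (fact (2 * n)) / (4 ^ n * (INR (fact n)) ^ 2).

Lemma central_pos n : 0 < central n.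
Proof.
  unfold central. apply Rdiv_lt_0_compat; [apply INR_fact_lt_0|].
  apply Rmult_lt_0_compat; [apply pow_lt; lra | apply pow_lt, INR_fact_lt_0].
Qed.

Lemma wallis_central n : wallis (2 * n) = PI / 2 * central n.
Proof.
  induction n as [|n IH].
  - simpl Nat.mul. rewrite wallis_0. unfold central. simpl. field.
  - pose proof (wallis_rec (2 * n)) as H. replace (2 * S n)%nat with (2 * n + 2)%nat by lia.
    assert (N : INR (2 * n + 2) <> 0) by (apply not_0_INR; lia).
    apply Rmult_eq_reg_l with (INR (2 * n + 2)); [|exact N]. rewrite H, IH. unfold central.
    replace (2 * S n)%nat with (S (S (2 * n))) by lia.
    replace (2 * n + 2)%nat with (S (S (2 * n))) by lia.
    replace (2 * n + 1)%nat with (S (2 * n)) by lia.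
    rewrite !INR_fact_S. rewrite !S_INR, mult_INR. simpl (4 ^ S n). simpl (INR 2).
    field. repeat split; try apply INR_fact_neq_0; try (apply pow_nonzero; lra).
    pose proof (pos_INR n); lra.
Qed.

(** The integrals [wallis] decrease, products of consecutive ones are known, and those of even
    index are multiples of [central]. *)
Lemma central_bounds n :
  2 / PI <= INR (2 * n + 1) * central n ^ 2 <= 2 / PI * (1 + / INR (2 * n + 1)).
Proof.
  pose proof PI_RGT_0 as Hpi. set (x := INR (2 * n + 1)).
  assert (Hx : 0 < x) by (apply lt_0_INR; lia).
  pose proof (wallis_prod (2 * n)) as P. fold x in P.
  pose proof (wallis_decr (2 * n)) as D1. pose proof (wallis_decr (S (2 * n))) as D2.
  pose proof (wallis_rec (2 * n)) as Rc. fold x in Rc.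
  replace (2 * n + 2)%nat with (S (S (2 * n))) in Rc by lia.
  replace (INR (S (S (2 * n)))) with (x + 1) in Rc
    by (unfold x; replace (2 * n + 1)%nat with (S (2 * n)) by lia; now rewrite <- S_INR).
  rewrite wallis_central in *. pose proof (central_pos n) as C.
  set (c := central n) in *. set (w1 := wallis (S (2 * n))) in *. set (w2 := wallis (S (S (2 * n)))) in *.
  split.
  - apply Rmult_le_reg_l with (PI / 2 * (PI / 2)); [nra|].
    replace (PI / 2 * (PI / 2) * (2 / PI)) with (PI / 2) by (field; lra).
    replace (PI / 2 * (PI / 2) * (x * c ^ 2)) with (x * ((PI / 2 * c) * (PI / 2 * c))) by ring.
    rewrite <- P at 1. apply Rmult_le_compat_l; [lra|]. apply Rmult_le_compat_l; [nra | exact D1].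
  - apply Rmult_le_reg_l with (PI / 2 * (PI / 2)); [nra|].
    replace (PI / 2 * (PI / 2) * (2 / PI * (1 + / x))) with (PI / 2 * ((x + 1) / x)) by (field; lra).
    replace (PI / 2 * (PI / 2) * (x * c ^ 2)) with ((x * (PI / 2 * c)) * (PI / 2 * c)) by ring.
    rewrite <- Rc.
    replace (PI / 2 * ((x + 1) / x)) with ((x + 1) * w1 * (PI / 2 * c)) by (rewrite <- P at 2; field; lra).
    apply Rmult_le_compat_r; [nra|]. apply Rmult_le_compat_l; lra.
Qed.

Definition stirling_seq (n : nat) : R := ln (INR (fact n)) - (INR n + / 2) * ln (INR n) + INR n.

Lemma Rln_taylor3 y : 0 <= y <= / 2 -> Rabs (ln (1 + y) - y + y ^ 2 / 2) <= 2 * y ^ 3.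
Proof.
  intros Hy. pose proof (Clog_taylor3 y) as H. rewrite Cmod_Rpos in H by lra.
  specialize (H ltac:(lra)). rewrite <- RtoC_plus, Clog_RtoC in H by lra.
  rewrite <- RtoC_minus, <- RtoC_pow, <- RtoC_div, <- RtoC_plus, Cmod_R in H by lra. exact H.
Qed.

(** In the expansion of [ln (1 + / n)] the contributions of order [1] and [/ n] cancel. *)
Lemma stirling_step n : (2 <= n)%nat ->
  Rabs (stirling_seq (S n) - stirling_seq n) <= 4 * / INR n ^ 2.
Proof.
  intros Hn. assert (H2 : 2 <= INR n) by (change 2 with (INR 2); now apply le_INR).
  set (y := / INR n). assert (Hy : 0 < y <= / 2).
  { unfold y. split; [apply Rinv_0_lt_compat; lra | apply Rinv_le_contravar; lra]. }
  pose proof (Rln_taylor3 y ltac:(lra)) as T.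
  pose proof (ln_S_minus_ln n ltac:(lia)) as L. fold y in L.
  assert (E : stirling_seq (S n) - stirling_seq n = 1 - (INR n + / 2) * ln (1 + y)).
  { unfold stirling_seq. rewrite INR_fact_S, ln_mult by (apply INR_S_pos || apply INR_fact_lt_0).
    rewrite <- L, !S_INR. field. }
  rewrite E. rewrite <- pow_inv. fold y.
  assert (Ny : INR n * y = 1) by (unfold y; field; lra).
  set (d := ln (1 + y) - y + y ^ 2 / 2) in *.
  replace (1 - (INR n + / 2) * ln (1 + y)) with (y ^ 2 / 4 - (INR n + / 2) * d).
  2:{ unfold d. replace (ln (1 + y)) with (d + y - y ^ 2 / 2) by (unfold d; ring). fold d.
      replace 1 with (INR n * y) at 2 by exact Ny.
      replace ((INR n + / 2) * (d + y - y ^ 2 / 2)) with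
        ((INR n + / 2) * d + INR n * y + / 2 * y - (INR n * y) * y / 2 - y ^ 2 / 4) by field.
      replace (d + y - y ^ 2 / 2 - y + y ^ 2 / 2) with d by field. rewrite Ny. field. }
  eapply Rle_trans; [apply Rabs_triang|]. rewrite Rabs_Ropp, Rabs_mult, !Rabs_pos_eq by (try lra; nra).
  assert ((INR n + / 2) * Rabs d <= (INR n + / 2) * (2 * y ^ 3)) by (apply Rmult_le_compat_l; lra).
  replace ((INR n + / 2) * (2 * y ^ 3)) with (2 * (INR n * y) * y ^ 2 + y ^ 2 * y) in H by field.
  rewrite Ny in H. assert (0 <= y ^ 2) by nra. nra.
Qed.

Lemma ex_lim_stirling : exists c : R, is_lim_seq stirling_seq c.
Proof.
  set (t := fun k => stirling_seq (S (S (S k))) - stirling_seq (S (S k))).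
  destruct (@ex_series_le R_AbsRing R_CompleteNormedModule t (fun k => 4 * / INR (S (S k)) ^ 2)) as [c Hc].
  { intros k. apply stirling_step. lia. }
  { destruct ex_series_inv_sq as [l Hl].
    destruct (ex_series_incr_1 (fun k => / INR (S k) ^ 2)) as [Hi _].
    destruct (Hi (ex_intro _ l Hl)) as [l' Hl']. exists (4 * l').
    exact (is_series_scal 4 (fun k => / INR (S (S k)) ^ 2) l' Hl'). }
  apply is_series_rsum in Hc. exists (c + stirling_seq 2).
  apply is_lim_seq_incr_1, is_lim_seq_incr_1.
  apply is_lim_seq_ext with (fun n => rsum t n + stirling_seq 2).
  - intros n. induction n as [|n IH]; cbn [rsum]; [ring|].
    unfold t at 2. rewrite <- IH. ring.
  - apply is_lim_seq_plus'; [exact Hc | apply is_lim_seq_const].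
Qed.

(** The limit [c] exists by [stirling_step]; Wallis's product identifies it. *)
Theorem stirling : is_lim_seq stirling_seq (ln (2 * PI) / 2).
Proof.
  destruct ex_lim_stirling as [c Hc]. pose proof PI_RGT_0 as Hpi.
  replace (ln (2 * PI) / 2) with c; [exact Hc|].
  (* two evaluations of the limit of [ln ((2 n + 1) (central n) ^ 2)] *)
  assert (L1 : is_lim_seq (fun n => ln (INR (2 * n + 1) * central n ^ 2)) (ln (2 / PI))).
  { apply is_lim_seq_le_le_loc with (fun _ => ln (2 / PI)) (fun n => ln (2 / PI) + 1 / INR n).
    - exists 1%nat. intros n Hn. destruct (central_bounds n) as [B1 B2].
      assert (P0 : 0 < 2 / PI) by (apply Rdiv_lt_0_compat; lra).
      split; [destruct B1 as [B1|B1]; [left; now apply ln_increasing | right; now rewrite B1]|].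
      assert (Hx : 0 < INR n) by (apply lt_0_INR; lia).
      assert (Hx2 : INR n <= INR (2 * n + 1)) by (apply le_INR; lia).
      assert (Hi : 0 < / INR (2 * n + 1)) by (apply Rinv_0_lt_compat; lra).
      apply Rle_trans with (ln (2 / PI * (1 + / INR (2 * n + 1)))).
      + destruct B2 as [B2|B2]; [left; apply ln_increasing; lra | right; now rewrite B2].
      + rewrite ln_mult by lra. apply Rplus_le_compat_l.
        apply Rle_trans with (/ INR (2 * n + 1)); [apply ln_1_plus_bounds, Hi|].
        unfold Rdiv. rewrite Rmult_1_l. apply Rinv_le_contravar; lra.
    - apply is_lim_seq_const.
    - replace (Finite (ln (2 / PI))) with (Finite (ln (2 / PI) + 0)) by (f_equal; ring).
      apply is_lim_seq_plus'; [apply is_lim_seq_const | apply is_lim_seq_inv_INR]. }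
  assert (L2 : is_lim_seq (fun n => ln (INR (2 * n + 1) * central n ^ 2))
     (0 + (ln 2 + 2 * (c - 2 * c) + ln 2))).
  { apply is_lim_seq_ext_loc with (fun n => (ln (INR (S (2 * n))) - ln (INR (2 * n))) +
      (ln 2 + 2 * (stirling_seq (2 * n) - 2 * stirling_seq n) + ln 2)).
    - exists 1%nat. intros n Hn. assert (Hx : 0 < INR n) by (apply lt_0_INR; lia).
      pose proof (central_pos n) as C.
      rewrite ln_mult by (try apply pow_lt, C; apply lt_0_INR; lia).
      replace (2 * n + 1)%nat with (S (2 * n)) by lia.
      replace (ln (central n ^ 2)) with (2 * ln (central n)).
      2:{ simpl. rewrite Rmult_1_r, ln_mult by exact C. ring. }
      assert (F1 : 0 < INR (fact n)) by apply INR_fact_lt_0.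
      assert (F2 : 0 < INR (fact (2 * n))) by apply INR_fact_lt_0.
      assert (F3 : 0 < 4 ^ n) by (apply pow_lt; lra).
      assert (F4 : 0 < INR (fact n) ^ 2) by now apply pow_lt.
      assert (F5 : 0 < 4 ^ n * INR (fact n) ^ 2) by now apply Rmult_lt_0_compat.
      assert (F6 : 0 < / (4 ^ n * INR (fact n) ^ 2)) by now apply Rinv_0_lt_compat.
      unfold central, Rdiv.
      rewrite (ln_mult _ _ F2 F6), (ln_Rinv _ F5), (ln_mult _ _ F3 F4), (ln_pow 4), (ln_pow (INR (fact n)))
        by lra.
      unfold stirling_seq. rewrite mult_INR. simpl (INR 2). replace (1 + 1) with 2 by ring.
      rewrite (ln_mult 2 (INR n)) by lra. replace (ln 4) with (ln 2 + ln 2).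
      + simpl. field.
      + replace 4 with (2 * 2) by ring. rewrite ln_mult by lra. ring.
    - assert (F : filterlim (fun n => (2 * n)%nat) eventually eventually)
        by (apply eventually_subseq; intros; lia).
      apply is_lim_seq_plus'.
      + exact (is_lim_seq_subseq (fun n => ln (INR (S n)) - ln (INR n)) _ _ F ln_S_minus_ln_lim).
      + apply is_lim_seq_plus'; [|apply is_lim_seq_const].
        apply is_lim_seq_plus'; [apply is_lim_seq_const|].
        apply (is_lim_seq_scal_l _ 2 (c - 2 * c)). apply is_lim_seq_minus'.
        * exact (is_lim_seq_subseq stirling_seq _ _ F Hc).
        * exact (is_lim_seq_scal_l stirling_seq 2 c Hc). }
  apply is_lim_seq_unique in L1, L2. rewrite L1 in L2. injection L2 as E.
  unfold Rdiv in E. rewrite ln_mult, ln_Rinv in E by (try apply Rinv_0_lt_compat; lra).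
  rewrite ln_mult by lra. lra.
Qed.

(** * Logarithmic branches as limits *)

Lemma uniform_limit_continuous (f : R -> R) x :
  (forall e, 0 < e -> exists g, continuous g x /\ forall y, Rabs (f y - g y) <= e) -> continuous f x.
Proof.
  intros H. apply filterlim_locally. intros eps. destruct eps as [e He].
  destruct (H (e / 4) ltac:(lra)) as [g [Hg Hfg]].
  assert (He4 : 0 < e / 4) by lra.
  pose proof (proj1 (filterlim_locally g (g x)) Hg (mkposreal _ He4)) as L.
  eapply filter_imp; [|exact L]. intros y Hy.
  assert (Hy' : Rabs (g y - g x) < e / 4) by exact Hy.
  change (Rabs (f y - f x) < e).
  replace (f y - f x) with ((f y - g y) + (g y - g x) + - (f x - g x)) by ring.
  pose proof (Hfg y). pose proof (Hfg x).
  eapply Rle_lt_trans; [apply Rabs_triang|]. rewrite Rabs_Ropp.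
  pose proof (Rabs_triang (f y - g y) (g y - g x)). lra.
Qed.

Lemma uniform_limit_Ccont (f : R -> C) x :
  (forall e, 0 < e -> exists g, Ccont g x /\ forall y, Cmod (f y - g y) <= e) -> Ccont f x.
Proof.
  intros H. split; apply uniform_limit_continuous; intros e He; destruct (H e He) as [g [[G1 G2] Hg]].
  - exists (fun y => Re (g y)). split; [exact G1|]. intros y. rewrite <- re_minus.
    eapply Rle_trans; [apply re_le_Cmod | apply Hg].
  - exists (fun y => Im (g y)). split; [exact G2|]. intros y. rewrite <- im_minus.
    eapply Rle_trans; [apply im_le_Cmod | apply Hg].
Qed.

Lemma Ccont_Cmod f x e : Ccont f x -> 0 < e -> locally x (fun y => Cmod (f y - f x) < e).
Proof.
  intros [A B] He. assert (He2 : 0 < e / 2) by lra.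
  pose proof (proj1 (filterlim_locally (fun y => Re (f y)) (Re (f x))) A (mkposreal _ He2)) as LA.
  pose proof (proj1 (filterlim_locally (fun y => Im (f y)) (Im (f x))) B (mkposreal _ He2)) as LB.
  eapply filter_imp; [|exact (filter_and _ _ LA LB)]. intros y [H1 H2].
  assert (H1' : Rabs (Re (f y) - Re (f x)) < e / 2) by exact H1.
  assert (H2' : Rabs (Im (f y) - Im (f x)) < e / 2) by exact H2.
  eapply Rle_lt_trans; [apply Cmod_le_Re_Im|]. rewrite re_minus, im_minus. lra.
Qed.

Lemma Ccont_of_Cmod f x : (forall e, 0 < e -> locally x (fun y => Cmod (f y - f x) < e)) -> Ccont f x.
Proof.
  intros H. split; apply filterlim_locally; intros [e He]; specialize (H e He);
    (eapply filter_imp; [|exact H]); intros y Hy.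
  - change (Rabs (Re (f y) - Re (f x)) < e). rewrite <- re_minus.
    eapply Rle_lt_trans; [apply re_le_Cmod | exact Hy].
  - change (Rabs (Im (f y) - Im (f x)) < e). rewrite <- im_minus.
    eapply Rle_lt_trans; [apply im_le_Cmod | exact Hy].
Qed.

Lemma Ccont_locally_pseries (L : C -> C) (g : R -> C) x :
  locally_pseries L (g x) -> Ccont g x -> Ccont (fun y => L (g y)) x.
Proof.
  intros HL Hg. destruct (locally_pseries_lipschitz L _ HL) as [K [d [HK [Hd H]]]].
  apply Ccont_of_Cmod. intros e He.
  assert (Hm : 0 < Rmin d (e / (K + 1))) by (apply Rmin_pos; [exact Hd | apply Rdiv_lt_0_compat; lra]).
  eapply filter_imp; [|exact (Ccont_Cmod g x _ Hg Hm)]. intros y Hy. cbv beta in Hy.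
  pose proof (Rmin_l d (e / (K + 1))). pose proof (Rmin_r d (e / (K + 1))).
  specialize (H (g y - g x)%C ltac:(lra)).
  replace (g x + (g y - g x))%C with (g y) in H by ring.
  eapply Rle_lt_trans; [exact H|]. pose proof (Cmod_ge_0 (g y - g x)).
  apply Rle_lt_trans with ((K + 1) * Cmod (g y - g x)); [apply Rmult_le_compat_r; lra|].
  apply Rlt_le_trans with ((K + 1) * (e / (K + 1))); [apply Rmult_lt_compat_l; lra|].
  right. field. lra.
Qed.

(** The projection of the line onto [[0, 1]]. *)
Definition clamp (r : R) : R := (1 + Rabs r - Rabs (r - 1)) / 2.

Ltac abs_cases :=
  unfold clamp, Rabs;
  repeat match goal with |- context [Rcase_abs ?a] => destruct (Rcase_abs a) end; lra.

Lemma clamp_bounds r : 0 <= clamp r <= 1.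
Proof. abs_cases. Qed.

Lemma clamp_id r : 0 <= r <= 1 -> clamp r = r.
Proof. intros H. abs_cases. Qed.

Lemma clamp_lipschitz r s : Rabs (clamp r - clamp s) <= Rabs (r - s).
Proof.
  assert (H : - Rabs (r - s) <= clamp r - clamp s <= Rabs (r - s)) by abs_cases.
  now apply Rabs_le.
Qed.

Lemma Ccont_clamp f x : Ccont f (clamp x) -> Ccont (fun y => f (clamp y)) x.
Proof.
  intros H.
  assert (Cl : continuous clamp x).
  { apply filterlim_locally. intros [e He]. exists (mkposreal e He). intros y Hy.
    eapply Rle_lt_trans; [apply clamp_lipschitz | exact Hy]. }
  destruct H as [A B]. split.
  - exact (continuous_comp clamp (fun y => Re (f y)) x Cl A).
  - exact (continuous_comp clamp (fun y => Im (f y)) x Cl B).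
Qed.

(** The slit plane is star-shaped about [1], so these segments stay inside it. *)
Definition segment (z : C) (r : R) : C := (1 + r * (z - 1))%C.

Lemma slit_segment z r : slit_plane z -> 0 <= r <= 1 -> slit_plane (segment z r).
Proof.
  intros Hz Hr. unfold segment, slit_plane.
  rewrite re_plus, im_plus, re_scal_l, im_scal_l, re_minus, im_minus. simpl.
  destruct Hz as [H|H].
  - left. destruct (Req_dec r 0) as [->|]; [lra|]. nra.
  - destruct (Req_dec r 0) as [->|Hr0]; [left; lra|]. right.
    rewrite Rminus_0_r, Rplus_0_l. now apply Rmult_integral_contrapositive_currified.
Qed.

Lemma Cmod_segment z r : 0 <= r <= 1 -> Cmod (segment z r) <= 1 + Cmod z.
Proof.
  intros Hr. unfold segment. replace (1 + r * (z - 1))%C with ((1 - r)%R + r * z)%C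
    by (rewrite RtoC_minus; ring).
  eapply Rle_trans; [apply Cmod_triangle|]. rewrite Cmod_scalR, Cmod_Rpos by lra.
  pose proof (Cmod_ge_0 z). nra.
Qed.

Lemma Clim_telescope (u : nat -> C) (g : nat -> R) (G : R) N :
  (forall n, (N <= n)%nat -> Cmod (u (S n) - u n) <= g (n - N)%nat) -> is_series g G ->
  exists l, Clim u l /\ forall n, Cmod (l - u (N + n)%nat) <= G - rsum g n.
Proof.
  intros H HG.
  set (f := fun k => (u (N + S k)%nat - u (N + k)%nat)%C).
  assert (Hf : forall k, Cmod (f k) <= g k).
  { intros k. unfold f. specialize (H (N + k)%nat ltac:(lia)).
    replace (N + k - N)%nat with k in H by lia. now rewrite Nat.add_succ_r. }
  destruct (csums_dominated f g Hf (ex_intro _ _ HG)) as [l Hl].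
  assert (E : forall n, csum f n = (u (N + n)%nat - u N)%C).
  { intros n. unfold f. rewrite (csum_tele (fun k => u (N + k)%nat)). now rewrite Nat.add_0_r. }
  exists (l + u N)%C. split.
  - assert (L : Clim (fun n => u (N + n)%nat) (l + u N)%C).
    { apply Clim_ext with (fun n => csum f n + u N)%C; [intros n; rewrite E; ring|].
      apply Clim_plus; [exact Hl | apply Clim_const]. }
    destruct L as [A B]. split.
    + apply (is_lim_seq_incr_n (fun n => Re (u n)) N).
      eapply is_lim_seq_ext; [|exact A]. intros n. now rewrite Nat.add_comm.
    + apply (is_lim_seq_incr_n (fun n => Im (u n)) N).
      eapply is_lim_seq_ext; [|exact B]. intros n. now rewrite Nat.add_comm.
  - intros n. replace (l + u N - u (N + n)%nat)%C with (l - csum f n)%C by (rewrite E; ring).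
    now apply (csums_tail f g).
Qed.

(** On the segment from [1] to [z] the limit of the [u n] is continuous, by uniform convergence,
    and so is [L]. Their difference vanishes at [1] and takes its values among the multiples of
    [2 i PI], so it is zero. *)
Theorem log_branch_limit (F L : C -> C) (u : nat -> C -> C) :
  is_log_branch F L ->
  (forall n z r, slit_plane z -> 0 <= r <= 1 -> Ccont (fun s => u n (segment z s)) r) ->
  (forall M, exists N g, ex_series g /\ forall n z, (N <= n)%nat -> slit_plane z -> Cmod z <= M ->
     Cmod (u (S n) z - u n z) <= g (n - N)%nat) ->
  (forall z l, slit_plane z -> Clim (fun n => u n z) l -> Cexp l = F z) ->
  (forall n, Im (u n (RtoC 1)) = 0) ->
  forall z, slit_plane z -> Clim (fun n => u n z) (L z).
Proof.
  intros [HL1 [HL2 HL3]] Hc Hu He H1 z Hz.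
  destruct (Hu (1 + Cmod z)) as [N [g [[G HG] Hg]]].
  (* clamping extends the segment to the whole line, where the intermediate value theorem
     applies *)
  set (p := fun r => segment z (clamp r)).
  assert (Hp : forall r, slit_plane (p r)) by (intros; apply slit_segment; auto using clamp_bounds).
  assert (Hpm : forall r, Cmod (p r) <= 1 + Cmod z) by (intros; apply Cmod_segment, clamp_bounds).
  assert (Hl : forall r, exists l, Clim (fun n => u n (p r)) l /\
      forall n, Cmod (l - u (N + n)%nat (p r)) <= G - rsum g n).
  { intros r. apply (Clim_telescope (fun n => u n (p r)) g G N); [|exact HG].
    intros n Hn. apply Hg; auto. }
  set (U := fun r => CLim_seq (fun n => u n (p r))).
  assert (HU : forall r, Clim (fun n => u n (p r)) (U r) /\
      forall n, Cmod (U r - u (N + n)%nat (p r)) <= G - rsum g n).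
  { intros r. destruct (Hl r) as [l [K1 K2]]. unfold U. now rewrite (CLim_seq_Clim _ _ K1). }
  assert (CU : forall r, Ccont U r).
  { intros r. apply uniform_limit_Ccont. intros e Hpos.
    apply is_series_rsum in HG. apply is_lim_seq_spec in HG.
    destruct (HG (mkposreal e Hpos)) as [n Hn]. specialize (Hn n (le_n n)). simpl in Hn.
    exists (fun y => u (N + n)%nat (p y)). split.
    - unfold p. apply (Ccont_clamp (fun s => u (N + n)%nat (segment z s))). apply Hc; auto using clamp_bounds.
    - intros y. destruct (HU y) as [_ K]. specialize (K n). apply Rabs_def2 in Hn. lra. }
  assert (Cp : forall r, Ccont p r).
  { intros r. unfold p. apply Ccont_clamp. unfold segment. ccont. }
  set (D := fun r => (U r - L (p r))%C).
  assert (CD : forall r, Ccont D r).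
  { intros r. unfold D. apply Ccont_minus; [apply CU|].
    apply Ccont_locally_pseries; [|apply Cp]. apply (analytic_locally_pseries _ _ _ HL1), Hp. }
  assert (ED : forall r, Cexp (D r) = 1).
  { intros r. unfold D. rewrite Cexp_minus. rewrite (He (p r) (U r) (Hp r)) by apply HU.
    rewrite HL2 by apply Hp. field. rewrite <- HL2 by apply Hp. apply Cexp_neq_0. }
  assert (Eq : forall r, Re (D r) = 0 /\ cos (Im (D r)) = 1).
  { intros r. pose proof (ED r) as E. pose proof (Cmod_Cexp (D r)) as M. rewrite E, Cmod_1 in M.
    assert (R0 : Re (D r) = 0).
    { rewrite <- exp_0 in M. symmetry. now apply exp_inv. }
    split; [exact R0|].
    assert (E1 : exp (Re (D r)) * cos (Im (D r)) = 1) by exact (f_equal Re E).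
    rewrite R0, exp_0 in E1. lra. }
  assert (P0 : p 0 = 1).
  { unfold p. rewrite clamp_id by lra. unfold segment. ring. }
  assert (P1 : p 1 = z).
  { unfold p. rewrite clamp_id by lra. unfold segment. ring. }
  assert (D0 : Im (D 0) = 0).
  { unfold D. rewrite im_minus, P0, (HL3 1) by lra.
    destruct (HU 0) as [[_ K] _]. rewrite P0 in K.
    assert (K' : is_lim_seq (fun n => Im (u n (RtoC 1))) 0).
    { apply is_lim_seq_ext with (fun _ => 0); [intros; now rewrite H1 | apply is_lim_seq_const]. }
    apply is_lim_seq_unique in K, K'. rewrite K in K'.
    pose proof (f_equal real K') as E. cbn [real] in E. rewrite E. ring. }
  assert (D1 : Im (D 1) = 0).
  { (* the argument cannot leave [0] without meeting [PI] or [- PI] *)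
    pose proof PI_RGT_0 as Hpi.
    assert (Cf : continuity (fun r => Im (D r))).
    { intros r. apply continuity_pt_filterlim. apply CD. }
    destruct (Rtotal_order (Im (D 1)) 0) as [Hlt|[E|Hgt]]; [|exact E|].
    - destruct (Rle_dec (Im (D 1)) (- PI)) as [Hq|Hq].
      + destruct (IVT_gen _ 0 1 (- PI) Cf) as [r [_ Er]].
        { rewrite D0, Rmin_right, Rmax_left; lra. }
        destruct (Eq r) as [_ C]. rewrite Er, cos_neg, cos_PI in C. lra.
      + apply cos_eq_1; [lra | apply Eq].
    - destruct (Rle_dec PI (Im (D 1))) as [Hq|Hq].
      + destruct (IVT_gen _ 0 1 PI Cf) as [r [_ Er]].
        { rewrite D0, Rmin_left, Rmax_right; lra. }
        destruct (Eq r) as [_ C]. rewrite Er, cos_PI in C. lra.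
      + apply cos_eq_1; [lra | apply Eq]. }
  assert (EU : U 1 = L z).
  { apply Ceq_minus. unfold D in D1. rewrite <- P1. change (D 1 = 0).
    apply C_eq; [apply Eq | exact D1]. }
  rewrite <- EU. rewrite <- P1. apply HU.
Qed.

(** * Partial sums for the Barnes and Gamma products *)

Definition barnes_term (z : C) (k : nat) : C :=
  (INR (S k) * Clog (1 + z / INR (S k)) - z + z ^ 2 / (2 * INR (S k)))%C.

(** Principal logarithms taken factor by factor are continuous on the slit plane, which [z -> 1
    + z / k] maps to itself. *)
Definition barnes_partial (n : nat) (z : C) : C :=
  (z / 2 * ln (2 * PI) + - ((z * (z + 1) + euler_gamma * z ^ 2) / 2) + csum (barnes_term z) n)%C.

Definition gamma_term (w : C) (k : nat) : C := (Clog (1 + w / INR (S k)) - w / INR (S k))%C.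

Definition gamma_partial (n : nat) (z : C) : C :=
  (- (Clog (z + 1) + euler_gamma * (z + 1) + csum (gamma_term (z + 1)) n))%C.

Lemma RtoC_INR_S_neq k : RtoC (INR (S k)) <> 0.
Proof. apply RtoC_neq, not_0_INR. lia. Qed.

Lemma slit_1_div z k : slit_plane z -> slit_plane (1 + z / INR (S k)).
Proof.
  intros Hz. pose proof (INR_S_pos k) as Hk. assert (Hi : 0 < / INR (S k)) by now apply Rinv_0_lt_compat.
  unfold slit_plane. unfold Cdiv. rewrite <- RtoC_inv by lra.
  rewrite re_plus, im_plus, re_scal_r, im_scal_r. simpl (Re 1). simpl (Im 1).
  destruct Hz as [H|H]; [left; nra | right].
  rewrite Rplus_0_l. apply Rmult_integral_contrapositive_currified; lra.
Qed.

Lemma slit_plus_1 z : slit_plane z -> slit_plane (z + 1).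
Proof. intros H. apply (slit_shift z 1 H). lra. Qed.

Lemma Cprod_S f n : Cprod f (S n) = (Cprod f n * f (S n))%C.
Proof. reflexivity. Qed.

Lemma Cprod_Cexp (f g : nat -> C) n :
  (forall k, f (S k) = Cexp (g k)) -> Cprod f n = Cexp (csum g n).
Proof.
  intros H. induction n as [|n IH]; [symmetry; apply Cexp_0|].
  rewrite Cprod_S, IH, H. cbn [csum]. now rewrite Cexp_plus.
Qed.

Lemma Cprod_inf_Cexp (f g : nat -> C) l :
  (forall k, f (S k) = Cexp (g k)) -> csums g l -> Cprod_inf f = Cexp l.
Proof.
  intros H Hl. unfold Cprod_inf. apply CLim_seq_Clim.
  eapply Clim_ext; [intros n; symmetry; now apply (Cprod_Cexp f g)|]. now apply Clim_Cexp.
Qed.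

Lemma Cmod_div_small z M k : Cmod z <= M -> 2 * M <= INR (S k) -> Cmod (z / INR (S k)) <= / 2.
Proof.
  intros H1 H2. pose proof (INR_S_pos k). rewrite Cmod_div by apply RtoC_INR_S_neq.
  rewrite Cmod_Rpos by lra. apply Rle_div_l; lra.
Qed.

Lemma barnes_term_bound z M k : Cmod z <= M -> 2 * M <= INR (S k) ->
  Cmod (barnes_term z k) <= 2 * M ^ 3 * / INR (S k) ^ 2.
Proof.
  intros H1 H2. pose proof (INR_S_pos k) as Hk. pose proof (Cmod_ge_0 z).
  set (w := (z / INR (S k))%C).
  assert (Hw : Cmod w <= / 2) by now apply (Cmod_div_small z M).
  replace (barnes_term z k) with (INR (S k) * (Clog (1 + w) - w + w ^ 2 / 2))%C.
  2:{ unfold barnes_term, w. field. apply RtoC_INR_S_neq. }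
  rewrite Cmod_scalR by lra. pose proof (Clog_taylor3 w Hw) as T.
  assert (E : Cmod w = Cmod z / INR (S k)).
  { unfold w. rewrite Cmod_div, Cmod_Rpos by (apply RtoC_INR_S_neq || lra). reflexivity. }
  rewrite E in T.
  apply Rle_trans with (INR (S k) * (2 * (Cmod z / INR (S k)) ^ 3)); [apply Rmult_le_compat_l; lra|].
  replace (INR (S k) * (2 * (Cmod z / INR (S k)) ^ 3)) with (2 * Cmod z ^ 3 * / INR (S k) ^ 2) by (field; lra).
  apply Rmult_le_compat_r; [left; apply Rinv_0_lt_compat, pow_lt; lra|].
  apply Rmult_le_compat_l; [lra|]. apply pow_incr. lra.
Qed.

Lemma gamma_term_bound z M k : Cmod z <= M -> 2 * M <= INR (S k) ->
  Cmod (gamma_term z k) <= 2 * M ^ 2 * / INR (S k) ^ 2.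
Proof.
  intros H1 H2. pose proof (INR_S_pos k) as Hk. pose proof (Cmod_ge_0 z).
  unfold gamma_term. set (w := (z / INR (S k))%C).
  assert (Hw : Cmod w <= / 2) by now apply (Cmod_div_small z M).
  pose proof (Clog_taylor2 w Hw) as T.
  assert (E : Cmod w = Cmod z / INR (S k)).
  { unfold w. rewrite Cmod_div, Cmod_Rpos by (apply RtoC_INR_S_neq || lra). reflexivity. }
  rewrite E in T. eapply Rle_trans; [exact T|].
  replace (2 * (Cmod z / INR (S k)) ^ 2) with (2 * Cmod z ^ 2 * / INR (S k) ^ 2) by (field; lra).
  apply Rmult_le_compat_r; [left; apply Rinv_0_lt_compat, pow_lt; lra|].
  apply Rmult_le_compat_l; [lra|]. apply pow_incr. lra.
Qed.

Lemma ex_series_inv_sq_shift (K : R) N : ex_series (fun n => K * / INR (S (N + n)) ^ 2).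
Proof.
  destruct (ex_series_incr_n (fun k => / INR (S k) ^ 2) N) as [H _].
  destruct (H ex_series_inv_sq) as [l Hl]. exists (K * l).
  exact (is_series_scal K (fun n => / INR (S (N + n)) ^ 2) l Hl).
Qed.

Lemma Ccont_csum (f : R -> nat -> C) n r :
  (forall k, Ccont (fun s => f s k) r) -> Ccont (fun s => csum (f s) n) r.
Proof.
  intros H. induction n as [|n IH]; cbn [csum]; [apply Ccont_const|]. now apply Ccont_plus.
Qed.

Theorem barnes_partial_limit logG1 :
  is_log_branch (fun z => barnesG (z + 1)%C) logG1 ->
  forall z, slit_plane z -> Clim (fun n => barnes_partial n z) (logG1 z).
Proof.
  intros H. apply (log_branch_limit _ _ barnes_partial H).
  - intros n z r Hz Hr. unfold barnes_partial.
    assert (Hs := slit_segment z r Hz Hr). unfold segment in *.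
    apply Ccont_plus; [ccont|]. apply (Ccont_csum (fun s => barnes_term (1 + s * (z - 1)))).
    intros k. unfold barnes_term. ccont. now apply slit_1_div.
  - intros M. destruct (INR_unbounded (2 * M)) as [N HN].
    exists N, (fun n => 2 * M ^ 3 * / INR (S (N + n)) ^ 2). split; [apply ex_series_inv_sq_shift|].
    intros n z Hn Hz HM. unfold barnes_partial. cbn [csum].
    replace (N + (n - N))%nat with n by lia.
    match goal with |- Cmod ?x <= _ => replace x with (barnes_term z n) by ring end.
    apply barnes_term_bound; [exact HM|]. apply Rle_trans with (INR N); [lra | apply le_INR; lia].
  - intros z l Hz Hl. unfold barnesG. replace (z + 1 - 1)%C with z by ring.
    unfold barnesG1. set (A := (z / 2 * ln (2 * PI))%C) in *.
    set (B := (- ((z * (z + 1) + euler_gamma * z ^ 2) / 2))%C) in *.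
    assert (Hs : csums (barnes_term z) (l - (A + B))%C).
    { apply Clim_ext with (fun n => barnes_partial n z - (A + B))%C.
      - intros n. unfold barnes_partial, A, B. ring.
      - apply Clim_minus; [exact Hl | apply Clim_const]. }
    rewrite (Cprod_inf_Cexp _ (barnes_term z) _) with (2 := Hs).
    + rewrite <- !Cexp_plus. f_equal. ring.
    + intros k. unfold barnes_term.
      replace (INR (S k) * Clog (1 + z / INR (S k)) - z + z ^ 2 / (2 * INR (S k)))%C
        with (INR (S k) * Clog (1 + z / INR (S k)) + (- z + z ^ 2 / (2 * INR (S k))))%C by ring.
      rewrite (Cexp_plus (INR (S k) * _)), Cexp_INR, Cexp_Clog by now apply slit_neq_0, slit_1_div.
      reflexivity.
  - intros n. unfold barnes_partial.
    replace (csum (barnes_term 1) n) with (RtoC (rsum (fun k =>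
      INR (S k) * ln (1 + / INR (S k)) - 1 + 1 / (2 * INR (S k))) n)).
    + replace (1 / 2 * ln (2 * PI))%C with (RtoC (1 / 2 * ln (2 * PI))) by now rewrite RtoC_mult, RtoC_div by lra.
      replace (- ((1 * (1 + 1) + euler_gamma * 1 ^ 2) / 2))%C with (RtoC (- ((1 * (1 + 1) + euler_gamma * 1 ^ 2) / 2)))
        by now rewrite RtoC_opp, RtoC_div, RtoC_plus, !RtoC_mult, RtoC_plus, RtoC_pow by lra.
      rewrite <- !RtoC_plus. apply im_RtoC.
    + rewrite <- csum_RtoC. apply csum_ext. intros k _. unfold barnes_term.
      pose proof (INR_S_pos k) as Hk. assert (0 < / INR (S k)) by now apply Rinv_0_lt_compat.
      replace (1 + 1 / INR (S k))%C with (RtoC (1 + / INR (S k)))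
        by (rewrite RtoC_plus, RtoC_inv by lra; field; apply RtoC_INR_S_neq).
      rewrite Clog_RtoC by lra.
      rewrite RtoC_plus, RtoC_minus, RtoC_mult, RtoC_div, RtoC_mult by lra. simpl Cpow. field.
      apply RtoC_INR_S_neq.
Qed.

Theorem gamma_partial_limit logGamma1 :
  is_log_branch (fun z => CGamma (z + 1)%C) logGamma1 ->
  forall z, slit_plane z -> Clim (fun n => gamma_partial n z) (logGamma1 z).
Proof.
  intros H. apply (log_branch_limit _ _ gamma_partial H).
  - intros n z r Hz Hr. unfold gamma_partial.
    assert (Hs := slit_plus_1 _ (slit_segment z r Hz Hr)). unfold segment in *.
    apply Ccont_opp, Ccont_plus; [ccont; exact Hs|].
    apply (Ccont_csum (fun s => gamma_term (1 + s * (z - 1) + 1))).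
    intros k. unfold gamma_term. ccont. now apply slit_1_div.
  - intros M. destruct (INR_unbounded (2 * (M + 1))) as [N HN].
    exists N, (fun n => 2 * (M + 1) ^ 2 * / INR (S (N + n)) ^ 2). split; [apply ex_series_inv_sq_shift|].
    intros n z Hn Hz HM. unfold gamma_partial. cbn [csum].
    replace (N + (n - N))%nat with n by lia.
    match goal with |- Cmod ?x <= _ => replace x with (- gamma_term (z + 1) n)%C by ring end.
    rewrite Cmod_opp. apply gamma_term_bound.
    + eapply Rle_trans; [apply Cmod_triangle|]. rewrite Cmod_1. lra.
    + apply Rle_trans with (INR N); [lra | apply le_INR; lia].
  - intros z l Hz Hl. unfold CGamma. set (w := (z + 1)%C) in *.
    assert (Hw : slit_plane w) by now apply slit_plus_1.
    set (B := (euler_gamma * w)%C) in *.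
    assert (Hs : csums (gamma_term w) (- l - (Clog w + B))%C).
    { apply Clim_ext with (fun n => - gamma_partial n z - (Clog w + B))%C.
      - intros n. unfold gamma_partial, B, w. ring.
      - apply Clim_minus; [now apply Clim_opp | apply Clim_const]. }
    rewrite (Cprod_inf_Cexp _ (gamma_term w) _) with (2 := Hs).
    + rewrite <- (Cexp_Clog w) at 1 by now apply slit_neq_0.
      rewrite <- !Cexp_plus, <- Cexp_opp. f_equal. ring.
    + intros k. unfold gamma_term, Cminus.
      rewrite Cexp_plus, Cexp_Clog by now apply slit_neq_0, slit_1_div. reflexivity.
  - intros n. unfold gamma_partial.
    replace (csum (gamma_term (1 + 1)) n) with (RtoC (rsum (fun k =>
      ln (1 + 2 / INR (S k)) - 2 / INR (S k)) n)).
    + replace (1 + 1)%C with (RtoC 2) by ring.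
      rewrite Clog_RtoC by lra. rewrite <- RtoC_mult, <- !RtoC_plus, <- RtoC_opp. apply im_RtoC.
    + rewrite <- csum_RtoC. apply csum_ext. intros k _. unfold gamma_term.
      pose proof (INR_S_pos k) as Hk. assert (0 < 2 / INR (S k)) by (apply Rdiv_lt_0_compat; lra).
      replace (1 + 1)%C with (RtoC 2) by ring.
      rewrite <- RtoC_div, <- RtoC_plus, Clog_RtoC, <- RtoC_minus by lra. reflexivity.
Qed.

(** * The remainder as a sum of Euler-Maclaurin errors *)

(** Distributes the embedding of the reals over an expression, as preparation for [field]. *)
Ltac push_RtoC :=
  repeat first [ rewrite RtoC_minus | rewrite RtoC_plus | rewrite RtoC_mult | rewrite RtoC_opp
    | rewrite RtoC_pow | rewrite RtoC_inv by lra | rewrite RtoC_div by lra ].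

Lemma Clog_shift_split z k : slit_plane z ->
  Clog (1 + z / INR (S k)) = (Clog (z + INR (S k)) - ln (INR (S k)))%C.
Proof.
  intros Hz. pose proof (INR_S_pos k) as Hk.
  replace (z + INR (S k))%C with (INR (S k) * (1 + z / INR (S k)))%C by (field; apply RtoC_INR_S_neq).
  rewrite Clog_scal by (try exact Hk; now apply slit_neq_0, slit_1_div). ring.
Qed.

Definition sum_log (n : nat) : R := rsum (fun k => ln (INR (S k))) n.

Definition sum_klog (n : nat) : R := rsum (fun k => INR (S k) * ln (INR (S k))) n.

Lemma sum_log_fact n : sum_log n = ln (INR (fact n)).
Proof.
  induction n as [|n IH]; unfold sum_log in *; cbn [rsum].
  - simpl. now rewrite ln_1.
  - rewrite IH, INR_fact_S, ln_mult by (apply INR_S_pos || apply INR_fact_lt_0). ring.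
Qed.

(** By induction on [n]: the logarithm of [z + k] has the coefficient [k] in the sum for [G] and
    [- 1] in the sum for the Gamma function, so that the sums combine into [w log w] at [w = z +
    k]. *)
Lemma partial_difference z n : slit_plane z ->
  (barnes_partial n z - z * gamma_partial n z =
   z / 2 * ln (2 * PI) - z * (z + 1) / 2 - (z ^ 2 / 2 + z) * (harmonic n - euler_gamma) - INR n * z
   + csum (fun k => wlogw (z + INR (S k))) n + z * Clog (z + INR (S n)) - sum_klog n - z * sum_log n)%C.
Proof.
  intros Hz. induction n as [|n IH].
  - unfold barnes_partial, gamma_partial, sum_klog, sum_log, harmonic. cbn [csum rsum INR]. field.
  - assert (Hn := RtoC_INR_S_neq n).
    assert (E1 : barnes_partial (S n) z = (barnes_partial n z + barnes_term z n)%C)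
      by (unfold barnes_partial; cbn [csum]; ring).
    assert (E2 : gamma_partial (S n) z = (gamma_partial n z - gamma_term (z + 1) n)%C)
      by (unfold gamma_partial; cbn [csum]; ring).
    rewrite E1, E2.
    replace (barnes_partial n z + barnes_term z n - z * (gamma_partial n z - gamma_term (z + 1) n))%C
      with ((barnes_partial n z - z * gamma_partial n z) + barnes_term z n + z * gamma_term (z + 1) n)%C by ring.
    rewrite IH. unfold barnes_term, gamma_term.
    rewrite !Clog_shift_split by (try apply slit_plus_1; exact Hz).
    unfold sum_klog, sum_log, harmonic. cbn [csum rsum].
    rewrite !RtoC_plus, RtoC_mult, RtoC_inv by (apply not_0_INR; lia).
    replace (z + 1 + INR (S n))%C with (z + INR (S (S n)))%C
      by (rewrite (S_INR (S n)), RtoC_plus; ring).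
    unfold wlogw. rewrite (S_INR n) in *. rewrite RtoC_plus in *. field. exact Hn.
Qed.

Lemma em_sum_telescope z n :
  em_sum z n =
  (wlogw_int z + wlogw z / 2 + Clog z / 12
   - (wlogw_int (z + INR n) + wlogw (z + INR n) / 2 + Clog (z + INR n) / 12)
   + csum (fun k => wlogw (z + INR (S k))) n)%C.
Proof.
  unfold em_sum. induction n as [|n IH].
  - cbn [csum INR]. rewrite !Cplus_0_r. field.
  - cbn [csum].
    replace (- (csum (fun k => em_delta (z + INR k)) n + em_delta (z + INR n)))%C
      with (- csum (fun k => em_delta (z + INR k)) n - em_delta (z + INR n))%C by ring.
    rewrite IH. unfold em_delta.
    replace (z + INR n + 1)%C with (z + INR (S n))%C by (rewrite S_INR, RtoC_plus; ring). field.
Qed.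

(** Glaisher's elementary description of his constant: these numbers converge to [1 / 4 - log
    A]. *)
Definition glaisher_partial (n : nat) : R :=
  (INR n ^ 2 / 2 + INR n / 2 + / 12) * ln (INR n) - INR n ^ 2 / 4 + / 4 - sum_klog n.

Lemma glaisher_partial_csum n :
  csum (fun k => em_delta (INR (S k))) n = glaisher_partial (S n).
Proof.
  assert (E := em_sum_telescope 1 n). unfold em_sum in E.
  assert (H : forall k, (1 + INR k)%C = RtoC (INR (S k))) by (intros; rewrite S_INR, RtoC_plus; ring).
  rewrite (csum_ext (fun k => em_delta (1 + INR k)) (fun k => em_delta (INR (S k)))) in E
    by (intros; now rewrite H).
  rewrite (csum_ext (fun k => wlogw (1 + INR (S k))) (fun k => RtoC (INR (S (S k)) * ln (INR (S (S k)))))) in E.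
  2:{ intros k _. rewrite H. unfold wlogw. rewrite Clog_RtoC by apply INR_S_pos. now rewrite RtoC_mult. }
  rewrite csum_RtoC in E.
  replace (csum (fun k => em_delta (INR (S k))) n) with (- - csum (fun k => em_delta (INR (S k))) n)%C by ring.
  rewrite E, H. unfold glaisher_partial, sum_klog. rewrite rsum_Sl.
  unfold wlogw, wlogw_int. rewrite !Clog_RtoC by (apply INR_S_pos || lra).
  change (INR 1) with 1. rewrite ln_1.
  set (x := INR (S n)). set (l := ln x). set (t := rsum _ n).
  push_RtoC. field.
Qed.

Lemma glaisher_partial_limit zeta : is_riemann_zeta zeta ->
  Clim (fun n => RtoC (glaisher_partial n)) (C_derive zeta (- (1)) + 1 / 6)%C.
Proof.
  intros Hz. apply Clim_incr_1. eapply Clim_ext; [|exact (glaisher_em zeta Hz)].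
  intros n. apply glaisher_partial_csum.
Qed.

Definition log_error (z : C) (n : nat) : C :=
  (Clog (1 + z / INR n) - z / INR n + (z / INR n) ^ 2 / 2)%C.

Lemma Clim_inv_INR (c : C) : Clim (fun n => c / INR n)%C 0.
Proof.
  apply Clim_squeeze with (fun n => Cmod c / INR n); [|apply is_lim_seq_inv_INR].
  exists 1%nat. intros n Hn. assert (H : 0 < INR n) by (apply lt_0_INR; lia).
  replace (c / INR n - 0)%C with (c / INR n)%C by ring.
  rewrite Cmod_div, Cmod_Rpos by (try apply RtoC_neq; lra). lra.
Qed.

Lemma log_error_bound z :
  exists N, forall n, (N <= n)%nat -> (1 <= n)%nat /\
    Cmod (z / INR n) <= / 2 /\ Cmod (log_error z n) <= 2 * (Cmod z / INR n) ^ 3.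
Proof.
  destruct (INR_unbounded (2 * Cmod z)) as [N HN]. exists (S N). intros n Hn.
  assert (Hn1 : INR N <= INR n) by (apply le_INR; lia).
  assert (H0 : 0 < INR n) by (apply lt_0_INR; lia).
  assert (E : Cmod (z / INR n) = Cmod z / INR n).
  { rewrite Cmod_div, Cmod_Rpos by (try apply RtoC_neq; lra). reflexivity. }
  assert (Hs : Cmod (z / INR n) <= / 2) by (rewrite E; apply Rle_div_l; lra).
  split; [lia|]. split; [exact Hs|]. rewrite <- E. now apply Clog_taylor3.
Qed.

Lemma Clim_log_1_plus z : Clim (fun n => Clog (1 + z / INR n)) 0.
Proof.
  destruct (log_error_bound z) as [N HN].
  apply Clim_squeeze with (fun n => 2 * Cmod z / INR n); [|apply is_lim_seq_inv_INR].
  exists N. intros n Hn. destruct (HN n Hn) as [H1 [H2 _]].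
  assert (H0 : 0 < INR n) by (apply lt_0_INR; lia).
  assert (E : Cmod (z / INR n) = Cmod z / INR n).
  { rewrite Cmod_div, Cmod_Rpos by (try apply RtoC_neq; lra). reflexivity. }
  pose proof (Clog_taylor2 _ H2) as T. rewrite E in *.
  replace (Clog (1 + z / INR n) - 0)%C with ((Clog (1 + z / INR n) - z / INR n) + z / INR n)%C by ring.
  eapply Rle_trans; [apply Cmod_triangle|]. rewrite E.
  assert (0 <= Cmod z / INR n) by (rewrite <- E; apply Cmod_ge_0).
  replace (2 * Cmod z / INR n) with (2 * (Cmod z / INR n)) by (unfold Rdiv; ring). nra.
Qed.

(** [log_error] is of order [n ^ (- 3)]. *)
Lemma Clim_quad_log_error z :
  Clim (fun n => ((z + INR n) ^ 2 / 2 + (z + INR n) / 2 + 1 / 12) * log_error z n)%C 0.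
Proof.
  destruct (log_error_bound z) as [N HN]. set (M := Cmod z).
  apply Clim_squeeze with (fun n => ((M + 1) ^ 2 + (M + 1) + 1) * (2 * M ^ 3) / INR n); [|apply is_lim_seq_inv_INR].
  exists N. intros n Hn. destruct (HN n Hn) as [H1 [_ H3]]. fold M in H3.
  assert (H0 : 1 <= INR n) by (change 1 with (INR 1); now apply le_INR).
  assert (HM : 0 <= M) by apply Cmod_ge_0.
  replace (((z + INR n) ^ 2 / 2 + (z + INR n) / 2 + 1 / 12) * log_error z n - 0)%C
    with (((z + INR n) ^ 2 / 2 + (z + INR n) / 2 + 1 / 12) * log_error z n)%C by ring.
  rewrite Cmod_mult.
  replace (((M + 1) ^ 2 + (M + 1) + 1) * (2 * M ^ 3) / INR n)
    with ((((M + 1) ^ 2 + (M + 1) + 1) * INR n ^ 2) * (2 * (M / INR n) ^ 3)) by (field; lra).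
  apply Rmult_le_compat; auto using Cmod_ge_0.
  assert (A : Cmod (z + INR n) <= (M + 1) * INR n).
  { eapply Rle_trans; [apply Cmod_triangle|]. rewrite Cmod_Rpos by lra. fold M. nra. }
  pose proof (Cmod_ge_0 (z + INR n)) as A0.
  eapply Rle_trans; [apply Cmod_triangle|]. rewrite (Cmod_div 1 12), Cmod_1, (Cmod_Rpos 12) by (try apply RtoC_neq; lra).
  assert (B : Cmod ((z + INR n) ^ 2 / 2 + (z + INR n) / 2) <= ((M + 1) * INR n) ^ 2 + (M + 1) * INR n).
  { eapply Rle_trans; [apply Cmod_triangle|].
    rewrite !Cmod_div, Cmod_pow, (Cmod_Rpos 2) by (try apply RtoC_neq; lra).
    assert (Cmod (z + INR n) ^ 2 <= ((M + 1) * INR n) ^ 2) by (apply pow_incr; lra).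
    pose proof (pow2_ge_0 (Cmod (z + INR n))). lra. }
  assert (INR n <= INR n ^ 2) by nra. assert (1 <= INR n ^ 2) by nra. nra.
Qed.

(** After [Clog (1 + z / n)] is expanded to second order, [em_sum z n] consists of the partial
    sums of the two logarithms, [glaisher_partial], the errors in Euler's constant and in
    Stirling's formula, and terms that tend to [0]. *)
Theorem em_sum_limit zeta logG1 logGamma1 z :
  is_riemann_zeta zeta ->
  is_log_branch (fun z => barnesG (z + 1)%C) logG1 ->
  is_log_branch (fun z => CGamma (z + 1)%C) logGamma1 ->
  slit_plane z ->
  Clim (em_sum z) (logG1 z - (1 / 4 * z ^ 2 + z * logGamma1 z
    - (1 / 2 * (z * (z + 1)) + 1 / 12) * Clog z - log_glaisher zeta))%C.
Proof.
  intros Hze HG HGa Hz.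
  set (A := (logG1 z - z * logGamma1 z)%C).
  set (K := (- (1 / 4) * z ^ 2 + (1 / 2 * (z * (z + 1)) + 1 / 12) * Clog z + 1 / 12 + 1 / 6)%C).
  set (B := (C_derive zeta (- (1)) + 1 / 6)%C).
  (* the last bracket lists the limits of the error terms *)
  replace (logG1 z - _)%C with (A + K - B - ((z ^ 2 / 2 + z) * - 0 + z * 0 - z * 0 + 0 + 0 * 0 + 0))%C
    by (unfold A, B, K, log_glaisher; field).
  assert (LA : Clim (fun n => barnes_partial n z - z * gamma_partial n z)%C A).
  { apply Clim_minus; [now apply barnes_partial_limit|]. apply Clim_scal. now apply gamma_partial_limit. }
  assert (LB := glaisher_partial_limit zeta Hze). fold B in LB.
  assert (Lh : Clim (fun n => RtoC (harmonic n - ln (INR n) - euler_gamma)) 0).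
  { apply Clim_RtoC. replace (Finite 0) with (Finite (euler_gamma - euler_gamma)) by (f_equal; ring).
    apply is_lim_seq_minus'; [apply is_lim_euler_gamma | apply is_lim_seq_const]. }
  assert (Ls : Clim (fun n => RtoC (stirling_seq n - ln (2 * PI) / 2)) 0).
  { apply Clim_RtoC. replace (Finite 0) with (Finite (ln (2 * PI) / 2 - ln (2 * PI) / 2)) by (f_equal; ring).
    apply is_lim_seq_minus'; [apply stirling | apply is_lim_seq_const]. }
  apply Clim_ext_loc with (fun n => (barnes_partial n z - z * gamma_partial n z) + K - glaisher_partial n
    - ((z ^ 2 / 2 + z) * - RtoC (harmonic n - ln (INR n) - euler_gamma)
       + z * Clog (1 + (z + 1) / INR n) - z * RtoC (stirling_seq n - ln (2 * PI) / 2)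
       + (z ^ 2 / 4 + z / 12) / INR n
       + (- z ^ 4 / 4 - z ^ 3 / 4 - z ^ 2 / 24) / INR n * (1 / INR n)
       + ((z + INR n) ^ 2 / 2 + (z + INR n) / 2 + 1 / 12) * log_error z n))%C.
  - exists 1%nat. intros n Hn.
    assert (H0 : 0 < INR n) by (apply lt_0_INR; lia).
    assert (Hn0 : RtoC (INR n) <> 0) by (apply RtoC_neq; lra).
    rewrite em_sum_telescope, partial_difference by exact Hz.
    destruct n as [|m]; [lia|].
    set (n := S m) in *.
    unfold log_error, n. rewrite !Clog_shift_split by (try apply slit_plus_1; exact Hz). fold n.
    replace (z + 1 + INR n)%C with (z + INR (S n))%C by (rewrite (S_INR n), RtoC_plus; ring).
    unfold stirling_seq, glaisher_partial. rewrite <- sum_log_fact.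
    unfold K, wlogw, wlogw_int.
    set (x := INR n) in *. set (l := ln x). set (q := ln (2 * PI)).
    set (L1 := Clog (z + x)). set (L2 := Clog (z + INR (S n))).
    set (sk := sum_klog n). set (sl := sum_log n). set (h := harmonic n). set (g := euler_gamma).
    set (cs := csum _ n). set (L0 := Clog z).
    push_RtoC.
    field. exact Hn0.
  - apply Clim_minus; [apply Clim_minus; [apply Clim_plus; [exact LA | apply Clim_const] | exact LB]|].
    apply Clim_plus; [|apply Clim_quad_log_error].
    apply Clim_plus; [|apply Clim_mult; apply Clim_inv_INR].
    apply Clim_plus; [|apply Clim_inv_INR].
    apply Clim_minus; [|now apply Clim_scal].
    apply Clim_plus; [|apply Clim_scal, Clim_log_1_plus].
    apply Clim_scal, Clim_opp, Lh.
Qed.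

(** * Choice of the ray of integration *)

Lemma slit_of_Carg (z : C) : z <> 0 -> Rabs (Carg z) < PI -> slit_plane z.
Proof.
  intros Hz Ha. destruct (Carg_spec z Hz) as [_ E]. pose proof (proj1 (Cmod_gt_0 z) Hz) as Hm.
  destruct (Req_dec (Im z) 0) as [H0|H0]; [left | now right].
  rewrite E in H0. cbn [Im snd] in H0.
  assert (S0 : sin (Carg z) = 0) by (apply Rmult_integral in H0; destruct H0; lra).
  assert (C0 : Carg z = 0).
  { apply Rabs_def2 in Ha. destruct (Rtotal_order (Carg z) 0) as [L|[L|L]]; [|exact L|].
    - assert (0 < sin (- Carg z)) by (apply sin_gt_0; lra). rewrite sin_neg in H. lra.
    - assert (0 < sin (Carg z)) by (apply sin_gt_0; lra). lra. }
  rewrite E. cbn [Re fst]. rewrite C0, cos_0. lra.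
Qed.

(** The conjugate direction, chosen so that [z * ray phi] has the argument [Carg z - phi]. *)
Definition ray (phi : R) : C := (cos phi, - sin phi).

Lemma Cmod_ray phi : Cmod (ray phi) = 1.
Proof.
  unfold Cmod, ray; cbn [fst snd]. rewrite <- sqrt_1. f_equal.
  pose proof (sin2_cos2 phi) as H. unfold Rsqr in H. simpl. lra.
Qed.

Lemma Re_mult_ray (z : C) phi : z <> 0 -> Re (z * ray phi) = Cmod z * cos (Carg z - phi).
Proof.
  intros Hz. destruct (Carg_spec z Hz) as [_ E]. rewrite cos_minus.
  rewrite re_mult. rewrite E at 1 2. simpl. ring.
Qed.

Lemma Cmod_ray_sq_plus (phi s a : R) :
  Cmod ((ray phi * s) ^ 2 + a ^ 2) ^ 2 = (s ^ 2 + a ^ 2) ^ 2 - 4 * s ^ 2 * a ^ 2 * sin phi ^ 2.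
Proof.
  rewrite Cmod2_alt. unfold ray; simpl.
  pose proof (sin2_cos2 phi) as H. unfold Rsqr in H. set (x := sin phi) in *. set (y := cos phi) in *.
  assert (Hy : y * y = 1 - x * x) by lra.
  transitivity ((s * s * (y * y - x * x) + a * a) ^ 2 + 4 * s ^ 4 * (x * x) * (y * y)); [ring|].
  rewrite Hy. ring.
Qed.

Lemma ray_lower (q phi s a : R) : 0 <= q ->
  q ^ 2 * a ^ 4 <= (s ^ 2 + a ^ 2) ^ 2 - 4 * s ^ 2 * a ^ 2 * sin phi ^ 2 ->
  q * a ^ 2 <= Cmod ((ray phi * s) ^ 2 + a ^ 2).
Proof.
  intros Hq H. rewrite <- Cmod_ray_sq_plus in H.
  apply Rsqr_incr_0_var; [|apply Cmod_ge_0]. unfold Rsqr.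
  replace (q * a ^ 2 * (q * a ^ 2)) with (q ^ 2 * a ^ 4) by ring. simpl in H |- *. lra.
Qed.

(** Here [t ^ 2] has a nonnegative real part. *)
Lemma ray_lower_1 (phi s a : R) : 0 <= cos (2 * phi) -> 1 * a ^ 2 <= Cmod ((ray phi * s) ^ 2 + a ^ 2).
Proof.
  intros H. rewrite cos_2a_sin in H. apply ray_lower; [lra|].
  pose proof (pow2_ge_0 s). pose proof (pow2_ge_0 a).
  replace ((s ^ 2 + a ^ 2) ^ 2 - 4 * s ^ 2 * a ^ 2 * sin phi ^ 2)
    with (s ^ 2 * s ^ 2 + 2 * (s ^ 2 * a ^ 2) * (1 - 2 * sin phi * sin phi) + a ^ 4) by ring.
  assert (0 <= s ^ 2 * a ^ 2) by now apply Rmult_le_pos. nra.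
Qed.

(** The left side is the distance from [- a ^ 2] to the line through [0] and [t ^ 2]. *)
Lemma ray_lower_sin2 (phi s a : R) : Rabs (sin (2 * phi)) * a ^ 2 <= Cmod ((ray phi * s) ^ 2 + a ^ 2).
Proof.
  apply ray_lower; [apply Rabs_pos|]. rewrite pow2_abs, sin_2a.
  pose proof (sin2_cos2 phi) as H. unfold Rsqr in H. set (x := sin phi) in *. set (y := cos phi) in *.
  replace ((2 * x * y) ^ 2 * a ^ 4) with (4 * (x * x) * (y * y) * a ^ 4) by ring.
  replace (y * y) with (1 - x * x) by lra.
  pose proof (pow2_ge_0 (s ^ 2 + (1 - 2 * (x * x)) * a ^ 2)). nra.
Qed.

(** The squares of the two sides differ by [c ^ 2 (2 s ^ 2 a ^ 2 + s ^ 4) + (1 - c ^ 2) (s ^ 2 -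
    a ^ 2) ^ 2], where [c = cos phi]. *)
Lemma ray_lower_cos (phi s a : R) : 0 <= cos phi -> cos phi * a ^ 2 <= Cmod ((ray phi * s) ^ 2 + a ^ 2).
Proof.
  intros H. apply ray_lower; [exact H|].
  pose proof (sin2_cos2 phi) as S. unfold Rsqr in S.
  replace (cos phi ^ 2) with (1 - sin phi ^ 2) by (simpl; lra).
  pose proof (pow2_ge_0 s). pose proof (pow2_ge_0 a). pose proof (pow2_ge_0 (sin phi)) as Sx.
  assert (Sy : 0 <= 1 - sin phi ^ 2) by (simpl; nra).
  assert (0 <= s ^ 2 * a ^ 2) by now apply Rmult_le_pos.
  assert (0 <= s ^ 2 * s ^ 2) by now apply Rmult_le_pos.
  pose proof (pow2_ge_0 (s ^ 2 - a ^ 2)).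
  assert (0 <= (1 - sin phi ^ 2) * (2 * (s ^ 2 * a ^ 2) + s ^ 2 * s ^ 2)) by (apply Rmult_le_pos; lra).
  assert (0 <= sin phi ^ 2 * (s ^ 2 - a ^ 2) ^ 2) by now apply Rmult_le_pos.
  nra.
Qed.

(** * Bounds for the remainder *)

Lemma sum_n_m_csum (f : nat -> C) n :
  @sum_n_m C_AbelianMonoid f 1 n = csum (fun j => f (S j)) n.
Proof.
  induction n as [|n IH].
  - rewrite sum_n_m_zero by lia. reflexivity.
  - rewrite sum_n_Sm by lia. rewrite IH. reflexivity.
Qed.

Definition first_omitted (N : nat) (r : R) : R :=
  Rabs (bernoulli (2 * N + 2)) / (INR (2 * N) * INR (2 * N + 1) * INR (2 * N + 2) * r ^ (2 * N)).

Lemma first_omitted_coef N r : (1 <= N)%nat -> 0 < r ->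
  first_omitted N r = 2 * freq_zeta (S N) * (INR (fact (2 * N - 1)) / r ^ (2 * N)).
Proof.
  intros HN Hr. pose proof (barnes_coef_freq_zeta N HN) as E. unfold barnes_coef in E.
  assert (H1 : 0 < INR (2 * N)) by (apply lt_0_INR; lia).
  assert (H2 : 0 < INR (2 * N + 1)) by (apply lt_0_INR; lia).
  assert (H3 : 0 < INR (2 * N + 2)) by (apply lt_0_INR; lia).
  assert (P : 0 < INR (2 * N) * INR (2 * N + 1) * INR (2 * N + 2)) by (repeat apply Rmult_lt_0_compat; assumption).
  assert (Hp : 0 < r ^ (2 * N)) by now apply pow_lt.
  assert (EB : Rabs (bernoulli (2 * N + 2)) / (INR (2 * N) * INR (2 * N + 1) * INR (2 * N + 2))
     = 2 * INR (fact (2 * N - 1)) * freq_zeta (S N)).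
  { pose proof (f_equal Rabs E) as EA. unfold Rdiv in EA. rewrite Rabs_mult, Rabs_inv in EA.
    rewrite (Rabs_pos_eq (INR (2 * N) * _ * _)) in EA by lra.
    unfold Rdiv. rewrite EA, !Rabs_mult, pow_1_abs.
    pose proof (freq_zeta_pos (S N) ltac:(lia)). pose proof (INR_fact_lt_0 (2 * N - 1)).
    rewrite !Rabs_pos_eq by lra. ring. }
  unfold first_omitted.
  replace (Rabs (bernoulli (2 * N + 2)) / (INR (2 * N) * INR (2 * N + 1) * INR (2 * N + 2) * r ^ (2 * N)))
    with (Rabs (bernoulli (2 * N + 2)) / (INR (2 * N) * INR (2 * N + 1) * INR (2 * N + 2)) / r ^ (2 * N))
    by (field; repeat split; lra).
  rewrite EB. field. lra.
Qed.

Lemma first_omitted_pos N r : (1 <= N)%nat -> 0 < r -> 0 < first_omitted N r.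
Proof.
  intros HN Hr. rewrite first_omitted_coef by assumption.
  pose proof (freq_zeta_pos (S N) ltac:(lia)). pose proof (INR_fact_lt_0 (2 * N - 1)).
  apply Rmult_lt_0_compat; [lra|]. apply Rdiv_lt_0_compat; [assumption | now apply pow_lt].
Qed.

Lemma ray_bound N (z : C) phi q L :
  (1 <= N)%nat -> z <> 0 -> Clim (em_sum z) L -> slit_plane z -> Rabs phi < PI / 2 -> Rabs (Carg z - phi) < PI / 2 ->
  0 < q -> (forall s a : R, q * a ^ 2 <= Cmod ((ray phi * s) ^ 2 + a ^ 2)) ->
  Cmod (L - barnes_sum N z) <=
    first_omitted N (Cmod z) * / (q * cos (Carg z - phi) ^ (2 * N)).
Proof.
  intros HN Hz0 HL Hz Hphi Hth Hq H.
  apply Rabs_def2 in Hphi. apply Rabs_def2 in Hth.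
  assert (C1 : 0 < cos phi) by (apply cos_gt_0; lra).
  assert (C2 : 0 < cos (Carg z - phi)) by (apply cos_gt_0; lra).
  pose proof (proj1 (Cmod_gt_0 z) Hz0) as Hm.
  eapply Rle_trans.
  - apply (em_limit_bound N (ray phi) z q L); auto.
    + apply Cmod_ray.
    + rewrite Re_mult_ray by exact Hz0. now apply Rmult_lt_0_compat.
  - rewrite Re_mult_ray, first_omitted_coef, Rpow_mult_distr by assumption.
    right. field. repeat split; try (apply pow_nonzero); lra.
Qed.

Lemma exp_pow_nat (x : R) n : exp x ^ n = exp (INR n * x).
Proof.
  induction n as [|n IH]; [simpl; now rewrite Rmult_0_l, exp_0|].
  rewrite S_INR, Rmult_plus_distr_r, exp_plus, <- IH, Rmult_1_l. simpl. ring.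
Qed.

(** The left side is least at [tan d ^ 2 = / p] with [p = 2 N + 1]. There its square is [(p + 1)
    / 4 (1 + / p) ^ p], and [(1 + / p) ^ p <= exp 1]. *)
Lemma optimal_angle N : (1 <= N)%nat ->
  exists d, 0 < d < PI / 4 /\
    / (sin (2 * d) * cos d ^ (2 * N)) <= sqrt (exp 1 / 4 * (2 * INR N + 5 / 2)).
Proof.
  intros HN. set (p := 2 * INR N + 1).
  assert (HN1 : 1 <= INR N) by (change 1 with (INR 1); now apply le_INR).
  assert (Hp : 3 <= p) by (unfold p; lra).
  (* [u = tan d], so that [cos d ^ 2 = p / (p + 1)] *)
  set (u := / sqrt p).
  assert (Hs : 0 < sqrt p) by (apply sqrt_lt_R0; lra).
  assert (Hs2 : sqrt p * sqrt p = p) by (apply sqrt_sqrt; lra).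
  assert (Hu : 0 < u < 1).
  { unfold u. split; [now apply Rinv_0_lt_compat|]. rewrite <- Rinv_1. apply Rinv_lt_contravar; nra. }
  exists (atan u). pose proof (atan_bound u) as Ab.
  assert (D1 : 0 < atan u) by (rewrite <- atan_0; apply atan_increasing; lra).
  assert (D2 : atan u < PI / 4) by (rewrite <- atan_1; apply atan_increasing; lra).
  split; [lra|]. set (d := atan u) in *.
  assert (Hc : 0 < cos d) by (apply cos_gt_0; lra).
  assert (Hsd : 0 < sin d) by (apply sin_gt_0; lra).
  assert (T : sin d = u * cos d).
  { pose proof (tan_atan u) as T. fold d in T. unfold tan in T. rewrite <- T. field. lra. }
  assert (U2 : u * u = / p) by (unfold u; rewrite <- Hs2 at 3; field; lra).
  pose proof (sin2_cos2 d) as S. unfold Rsqr in S.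
  assert (C2 : cos d * cos d = p / (p + 1)).
  { rewrite T in S. replace (u * cos d * (u * cos d)) with ((u * u) * (cos d * cos d)) in S by ring.
    rewrite U2 in S. apply Rmult_eq_reg_r with ((p + 1) / p); [|apply Rgt_not_eq, Rdiv_lt_0_compat; lra].
    replace (p / (p + 1) * ((p + 1) / p)) with 1 by (field; lra).
    transitivity (/ p * (cos d * cos d) + cos d * cos d); [field; lra | exact S]. }
  set (V := / (sin (2 * d) * cos d ^ (2 * N))).
  assert (HV : 0 < V).
  { unfold V. apply Rinv_0_lt_compat, Rmult_lt_0_compat; [|now apply pow_lt].
    rewrite sin_2a. nra. }
  rewrite <- (sqrt_square V) by lra. apply sqrt_le_1_alt.
  assert (Hq : 0 < (p + 1) / p) by (apply Rdiv_lt_0_compat; lra).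
  assert (EV : V * V = (p + 1) / 4 * ((p + 1) / p) ^ (2 * N + 1)).
  { unfold V. rewrite sin_2a, T, <- Rinv_mult.
    replace (2 * (u * cos d) * cos d * cos d ^ (2 * N) * (2 * (u * cos d) * cos d * cos d ^ (2 * N)))
      with (4 * (u * u) * ((cos d * cos d) * (cos d * cos d) * (cos d ^ (2 * N) * cos d ^ (2 * N)))) by ring.
    rewrite <- (Rpow_mult_distr (cos d) (cos d)), C2, U2.
    replace (p / (p + 1)) with (/ ((p + 1) / p)) by (field; lra).
    rewrite pow_inv, pow_add, pow_1.
    replace ((p + 1) / 4 * (((p + 1) / p) ^ (2 * N) * ((p + 1) / p)))
      with (p / 4 * (((p + 1) / p) * ((p + 1) / p) * ((p + 1) / p) ^ (2 * N))) by (field; lra).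
    assert (0 < ((p + 1) / p) ^ (2 * N)) by now apply pow_lt.
    set (Q := ((p + 1) / p) ^ (2 * N)) in *. set (r := (p + 1) / p) in *. field. repeat split; lra. }
  rewrite EV.
  assert (Ee : ((p + 1) / p) ^ (2 * N + 1) <= exp 1).
  { apply Rle_trans with (exp (/ p) ^ (2 * N + 1)).
    - apply pow_incr. split; [lra|]. pose proof (exp_ineq1_le (/ p)) as L.
      replace ((p + 1) / p) with (1 + / p) by (field; lra). exact L.
    - right. rewrite exp_pow_nat. f_equal. rewrite plus_INR, mult_INR. simpl (INR 2). simpl (INR 1).
      unfold p in *. field. lra. }
  replace (exp 1 / 4 * (2 * INR N + 5 / 2)) with ((p + 3 / 2) / 4 * exp 1) by (unfold p; field).
  pose proof (exp_pos 1).
  apply Rle_trans with ((p + 1) / 4 * exp 1); [apply Rmult_le_compat_l; lra | apply Rmult_le_compat_r; lra].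
Qed.

Lemma sin_2_abs_ge d t : 0 < d < PI / 4 -> PI / 4 <= Rabs t <= PI / 2 - d -> sin (2 * d) <= Rabs (sin (2 * t)).
Proof.
  intros Hd Ht. pose proof PI_RGT_0.
  assert (E : sin (2 * d) <= sin (2 * Rabs t)).
  { rewrite <- (sin_PI_x (2 * d)). apply sin_decr_1; lra. }
  unfold Rabs in E. destruct (Rcase_abs t).
  - replace (2 * - t) with (- (2 * t)) in E by ring. rewrite sin_neg in E.
    rewrite <- Rabs_Ropp. pose proof (Rle_abs (- sin (2 * t))). lra.
  - pose proof (Rle_abs (sin (2 * t))). lra.
Qed.

(** The ray through [z] is good as long as [|sin (2 theta)|] is not small. Closer to the
    imaginary axis a ray that stops at the angle [d] from the axis is better, at the cost of
    [cos d ^ (2 N)]. *)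
Lemma remainder_bound_uniform N (z : C) L :
  (1 <= N)%nat -> z <> 0 -> Clim (em_sum z) L -> PI / 4 < Rabs (Carg z) <= PI / 2 ->
  Cmod (L - barnes_sum N z) <=
    first_omitted N (Cmod z) * sqrt (exp 1 / 4 * (2 * INR N + 5 / 2)).
Proof.
  intros HN Hz HL Ht. pose proof PI_RGT_0 as Hpi.
  assert (Hs : slit_plane z) by (apply slit_of_Carg; [exact Hz | lra]).
  pose proof (first_omitted_pos N (Cmod z) HN (proj1 (Cmod_gt_0 z) Hz)) as HF.
  destruct (optimal_angle N HN) as [d [Hd HV]].
  assert (S2 : 0 < sin (2 * d)) by (apply sin_gt_0; lra).
  assert (Hc : 0 < cos d) by (apply cos_gt_0; lra).
  assert (Hcp : 0 < cos d ^ (2 * N)) by now apply pow_lt.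
  set (th := Carg z) in *.
  eapply Rle_trans; [|apply Rmult_le_compat_l; [lra | exact HV]].
  destruct (Rle_dec (Rabs th) (PI / 2 - d)) as [C|C].
  - assert (Sq : sin (2 * d) <= Rabs (sin (2 * th))) by (apply sin_2_abs_ge; lra).
    eapply Rle_trans; [apply (ray_bound N z th (Rabs (sin (2 * th))) L)|]; auto; fold th.
    + lra.
    + rewrite Rminus_diag, Rabs_R0. lra.
    + lra.
    + intros s a. apply ray_lower_sin2.
    + rewrite Rminus_diag, cos_0, pow1, Rmult_1_r. apply Rmult_le_compat_l; [lra|].
      apply Rinv_le_contravar; [now apply Rmult_lt_0_compat|].
      assert (cos d ^ (2 * N) <= 1).
      { rewrite <- (pow1 (2 * N)). apply pow_incr. pose proof (COS_bound d). lra. }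
      nra.
  - (* rotate only as far as [PI / 2 - d] towards the argument of [z] *)
    set (phi := if Rcase_abs th then - (PI / 2 - d) else PI / 2 - d).
    assert (Hphi : Rabs phi = PI / 2 - d /\ Rabs (th - phi) <= d /\ Rabs (sin (2 * phi)) = sin (2 * d)).
    { unfold phi. destruct (Rcase_abs th) as [N0|N0].
      - rewrite Rabs_left in Ht, C by lra. split; [rewrite Rabs_left; lra|]. split; [apply Rabs_le; lra|].
        replace (2 * - (PI / 2 - d)) with (- (PI - 2 * d)) by field.
        rewrite sin_neg, sin_PI_x, Rabs_Ropp. apply Rabs_pos_eq. lra.
      - rewrite Rabs_pos_eq in Ht, C by lra. split; [rewrite Rabs_pos_eq; lra|]. split; [apply Rabs_le; lra|].
        replace (2 * (PI / 2 - d)) with (PI - 2 * d) by field.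
        rewrite sin_PI_x. apply Rabs_pos_eq. lra. }
    destruct Hphi as [P1 [P2 P3]].
    eapply Rle_trans; [apply (ray_bound N z phi (Rabs (sin (2 * phi))) L)|]; auto; fold th.
    + lra.
    + lra.
    + lra.
    + intros s a. apply ray_lower_sin2.
    + rewrite P3. apply Rmult_le_compat_l; [lra|].
      assert (Cc : cos d <= cos (th - phi)).
      { assert (K : cos d <= cos (Rabs (th - phi))).
        { apply cos_decr_1; try lra; apply Rabs_pos. }
        unfold Rabs in K. destruct (Rcase_abs (th - phi)); [rewrite cos_neg in K|]; exact K. }
      apply Rinv_le_contravar; [now apply Rmult_lt_0_compat|].
      apply Rmult_le_compat_l; [lra|]. apply pow_incr. lra.
Qed.

Lemma pow_m1_cases n : (-1) ^ n = 1 \/ (-1) ^ n = -1.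
Proof. induction n as [|n [IH|IH]]; simpl; rewrite ?IH; lra. Qed.

Theorem theorem1p2
  (zeta logG1 logGamma1 : C -> C)
  (Hzeta : is_riemann_zeta zeta)
  (HlogG : is_log_branch (fun z => barnesG (z + 1)%C) logG1)
  (HlogGamma : is_log_branch (fun z => CGamma (z + 1)%C) logGamma1)
  (N : nat) (HN : (1 <= N)%nat) (z : C) (Hz : z <> RtoC 0) :
  let theta := Carg z in
  let RN := barnes_remainder zeta logG1 logGamma1 N z in
  let bound := Rabs (bernoulli (2 * N + 2)) /
    (INR (2 * N) * INR (2 * N + 1) * INR (2 * N + 2) * Cmod z ^ (2 * N)) in
  ((PI / 4 < Rabs theta <= PI / 2 ->
      Cmod RN <=
        bound * min_csc theta (sqrt (exp 1 / 4 * (2 * INR N + 5 / 2)))) /\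
   (Rabs theta <= PI / 4 -> Cmod RN <= bound)) /\
  (Rabs theta < PI ->
     Cmod RN <= bound * (/ cos (theta / 2)) ^ (2 * N + 1)) /\
  (Im z = 0 -> 0 < Re z ->
     Im RN = 0 /\
     sign (Re RN) =
       sign (bernoulli (2 * N + 2) /
         (INR (2 * N) * INR (2 * N + 1) * INR (2 * N + 2) * Re z ^ (2 * N))) /\
     Cmod RN < bound).
Proof.
  intros theta RN bound. pose proof PI_RGT_0 as Hpi.
  change bound with (first_omitted N (Cmod z)).
  pose proof (proj1 (Cmod_gt_0 z) Hz) as Hm.
  pose proof (first_omitted_pos N (Cmod z) HN Hm) as HF.
  assert (Slit : Rabs theta < PI -> slit_plane z) by now apply slit_of_Carg.
  assert (Lim : slit_plane z -> exists L, Clim (em_sum z) L /\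
      forall M, barnes_remainder zeta logG1 logGamma1 M z = (L - barnes_sum M z)%C).
  { intros Hs. eexists. split; [now apply (em_sum_limit zeta logG1 logGamma1)|].
    intros M. unfold barnes_remainder. rewrite sum_n_m_csum. fold (barnes_sum M z). ring. }
  assert (Ray : Rabs theta < PI -> forall phi q, Rabs phi < PI / 2 -> Rabs (theta - phi) < PI / 2 ->
    0 < q -> (forall s a : R, q * a ^ 2 <= Cmod ((ray phi * s) ^ 2 + a ^ 2)) ->
    Cmod RN <= first_omitted N (Cmod z) * / (q * cos (theta - phi) ^ (2 * N))).
  { intros Ht phi q H1 H2 H3 H4. destruct (Lim (Slit Ht)) as [L [HL E]]. unfold RN. rewrite E.
    apply ray_bound; auto. }
  split; [split|split].
  - intros Ht. destruct (Lim (Slit ltac:(lra))) as [L [HL EL]].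
    pose proof (remainder_bound_uniform N z L HN Hz HL Ht) as B.
    rewrite <- EL in B. fold RN in B. unfold min_csc. destruct (Req_EM_T (Rabs theta) (PI / 2)) as [E|E]; [exact B|].
    apply Rmin_case; [|exact B].
    assert (S2 : sin (2 * theta) <> 0).
    { intros S0. set (d := (PI / 2 - Rabs theta) / 2).
      assert (Hd : 0 < d < PI / 4) by (unfold d; lra).
      pose proof (sin_2_abs_ge d theta Hd ltac:(unfold d; lra)) as Sg.
      rewrite S0, Rabs_R0 in Sg. assert (0 < sin (2 * d)) by (apply sin_gt_0; lra). lra. }
    assert (Hq : 0 < Rabs (sin (2 * theta))) by now apply Rabs_pos_lt.
    specialize (Ray ltac:(lra) theta (Rabs (sin (2 * theta))) ltac:(lra)).
    rewrite Rminus_diag, Rabs_R0, cos_0, pow1, Rmult_1_r in Ray. rewrite Rabs_inv.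
    apply Ray; [lra | exact Hq | intros; apply ray_lower_sin2].
  - intros Ht. specialize (Ray ltac:(lra) theta 1 ltac:(lra)).
    rewrite Rminus_diag, Rabs_R0, cos_0, pow1, Rmult_1_r, Rinv_1, Rmult_1_r in Ray.
    apply Ray; [lra | lra |]. intros s a. apply ray_lower_1.
    apply Rabs_le_between in Ht. apply cos_ge_0; lra.
  - intros Ht. specialize (Ray Ht (theta / 2) (cos (theta / 2))).
    pose proof Ht as Ht'. apply Rabs_def2 in Ht'.
    assert (Hc : 0 < cos (theta / 2)) by (apply cos_gt_0; lra).
    replace (theta - theta / 2) with (theta / 2) in Ray by field.
    assert (Hh : Rabs (theta / 2) < PI / 2) by (apply Rabs_def1; lra).
    specialize (Ray Hh Hh Hc (fun s a => ray_lower_cos _ s a (Rlt_le _ _ Hc))).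
    rewrite pow_inv, Nat.add_1_r. exact Ray.
  - intros HI HR. assert (Ez : z = RtoC (Re z)) by (apply C_eq; simpl; auto).
    set (x := Re z) in *.
    assert (Hx : Cmod z = x) by (rewrite Ez; apply Cmod_Rpos; lra). rewrite Hx in *.
    assert (Hs : slit_plane z) by now left.
    destruct (Lim Hs) as [L [HL E]].
    unfold RN. rewrite E. rewrite Ez in HL |- *.
    destruct (em_limit_sign N x L HN HR HL) as [I1 P1].
    destruct (em_limit_sign (S N) x L ltac:(lia) HR HL) as [_ P2].
    (* consecutive remainders differ by one term and have opposite signs *)
    assert (St : (L - barnes_sum (S N) x)%C = (L - barnes_sum N x - RtoC (barnes_coef N / x ^ (2 * N)))%C).
    { unfold barnes_sum. replace (S N - 1)%nat with (S (N - 1)) by lia. cbn [csum].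
      replace (S (N - 1)) with N by lia.
      rewrite RtoC_div, RtoC_pow by (apply pow_nonzero; lra). ring. }
    rewrite St, re_minus, re_RtoC in P2. set (r := Re (L - barnes_sum N x)) in *.
    assert (Hxp : 0 < x ^ (2 * N)) by now apply pow_lt.
    assert (T : barnes_coef N / x ^ (2 * N) = (-1) ^ N * first_omitted N x).
    { rewrite first_omitted_coef, barnes_coef_freq_zeta by assumption. field. lra. }
    rewrite T in P2.
    assert (Sq : (-1) ^ N * (-1) ^ N = 1).
    { rewrite <- Rpow_mult_distr. replace (-1 * -1) with 1 by ring. apply pow1. }
    assert (Lt : (-1) ^ N * r < first_omitted N x).
    { simpl in P2. replace (-1 * (-1) ^ N * (r - (-1) ^ N * first_omitted N x))
        with (((-1) ^ N * (-1) ^ N) * first_omitted N x - (-1) ^ N * r) in P2 by ring.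
      rewrite Sq in P2. lra. }
    split; [exact I1|]. split.
    + replace (bernoulli (2 * N + 2) / (INR (2 * N) * INR (2 * N + 1) * INR (2 * N + 2) * x ^ (2 * N)))
        with (barnes_coef N / x ^ (2 * N)).
      2:{ unfold barnes_coef. field. repeat split; try lra; apply not_0_INR; lia. }
      rewrite T. destruct (pow_m1_cases N) as [Eq|Eq]; rewrite Eq in *.
      * rewrite (sign_eq_1 r), sign_eq_1; lra.
      * rewrite (sign_eq_m1 r), sign_eq_m1; lra.
    + replace (L - barnes_sum N x)%C with (RtoC r) by (apply C_eq; simpl; auto).
      rewrite Cmod_R. destruct (pow_m1_cases N) as [Eq|Eq]; rewrite Eq in *.
      * rewrite Rabs_pos_eq; lra.
      * rewrite Rabs_left; lra.
Qed.
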